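(* Let $d\in\mathbb{N}$, $m\in\mathbb{N}_0$, let $\psi:(-\frac12,\frac12)^d\to\mathbb{R}^d$, $\psi(\mathbf{x})=(\psi_1(x_1),\ldots,\psi_d(x_d))^\top$, be a $d$-variate transformation with $d$-variate density function $\varrho(\mathbf{y})=\prod_{j=1}^d\varrho_j(y_j)$, let $\omega:\mathbb{R}^d\to[0,\infty)$, $\omega(\mathbf{y})=\prod_{j=1}^d\omega_j(y_j)$, be a non-negative product weight function, let $h\in L_2(\mathbb{R}^d,\omega)\cap H^m_{\mathrm{mix}}(\mathbb{R}^d)$, and let $$f(\mathbf{x}):=h(\psi_1(x_1),\ldots,\psi_d(x_d))\prod_{k=1}^d\sqrt{\omega_k(\psi_k(x_k))\,\psi_k'(x_k)},\qquad\mathbf{x}\in\mathbb{T}^d,$$ be the corresponding transformed function. If for all multi-indices $\mathbf{m}=(m_1,\ldots,m_d)^\top\in\mathbb{N}_0^d$ with $\|\mathbf{m}\|_{\ell_\infty}\le m$, all $\ell=1,\ldots,d$ and all $j_\ell=0,\ldots,m$ we have $$\varrho_\ell^{(j_\ell)}\in\mathcal{C}_0(\mathbb{R}),\qquad\psi_\ell^{(j_\ell)}\in\mathcal{C}\left((-\tfrac12,\tfrac12)\right)$$ and $$\max_{j_\ell=0,\ldots,m_\ell}\left\|\frac{\mathrm{d}^{m_\ell-j_\ell}}{\mathrm{d}x_\ell^{m_\ell-j_\ell}}\left[\sqrt{(\omega_\ell\circ\psi_\ell)\,\psi_\ell'}\right](x_\ell)\;\psi_\ell'(x_\ell)^{\max(-\frac12,\,2j_\ell-\frac32)}\right\|_{L_\infty(\mathbb{T})}<\infty,$$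 then $f\in H^m_{\mathrm{mix}}(\mathbb{T}^d)$.
   Context: $\mathbb{T}^d\simeq[-\frac12,\frac12)^d$ is the $d$-dimensional torus. A univariate transformation is a map $\psi_j:(-\frac12,\frac12)\to\mathbb{R}$ that is continuously differentiable, strictly increasing, odd, and satisfies $\lim_{x\to-1/2}\psi_j(x)=-\infty$ and $\lim_{x\to1/2}\psi_j(x)=\infty$; its density function is $\varrho_j(y):=(\psi_j^{-1})'(y)=\frac{1}{\psi_j'(\psi_j^{-1}(y))}$. A $d$-variate transformation acts componentwise by univariate transformations $\psi_1,\ldots,\psi_d$ (possibly different in each coordinate), and its density is $\varrho(\mathbf{y})=\prod_{j=1}^d\varrho_j(y_j)$. A product weight function is $\omega(\mathbf{y})=\prod_{j=1}^d\omega_j(y_j)$ with univariate weight functions $\omega_j:\mathbb{R}\to[0,\infty)$. $\mathcal{C}_0(\mathbb{R})$ is the space of continuous functions $\mathbb{R}\to\mathbb{C}$ vanishing at infinity, and $\mathcal{C}((-\frac12,\frac12))$ is the space of continuous functions on $(-\frac12,\frac12)$. A superscript $(j)$ denotes the $j$-th derivative of a univariate function. $\|\mathbf{m}\|_{\ell_\infty}=\max_j|m_j|$. The weighted space is $L_2(\mathbb{R}^d,\omega)=\{h\in L_2(\mathbb{R}^d):\|h\|_{L_2(\mathbb{R}^d,\omega)}:=(\int_{\mathbb{R}^d}|h(\mathbf{y})|^2\omega(\mathbf{y})\,\mathrm{d}\mathbf{y})^{1/2}<\infty\}$. For $\Omega\in\{\mathbb{T}^d,\mathbb{R}^d\}$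 the Sobolev space of mixed natural smoothness is $H^m_{\mathrm{mix}}(\Omega)=\{f\in L_2(\Omega):\|f\|_{H^m_{\mathrm{mix}}(\Omega)}<\infty\}$ with $\|f\|_{H^m_{\mathrm{mix}}(\Omega)}:=\left(\sum_{\|\boldsymbol{\alpha}\|_{\ell_\infty}\le m}\|D^{\boldsymbol{\alpha}}[f]\|_{L_2(\Omega)}^2\right)^{1/2}$, the sum running over $\boldsymbol{\alpha}\in\mathbb{N}_0^d$, where $D^{\boldsymbol{\alpha}}[f]=\frac{\partial^{\alpha_1}}{\partial x_1^{\alpha_1}}\cdots\frac{\partial^{\alpha_d}}{\partial x_d^{\alpha_d}}[f]$. *)

(* Defs.v *)
From HB Require Import structures.
From mathcomp Require Import all_boot all_order all_algebra.
From mathcomp Require Import all_classical all_reals all_analysis.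
From mathcomp Require Import complex.
Set Implicit Arguments.
Unset Strict Implicit.
Unset Printing Implicit Defensive.
Import Order.TTheory GRing.Theory Num.Theory.
Import numFieldNormedType.Exports.
Local Open Scope classical_set_scope.
Local Open Scope ring_scope.

Definition measure_rV_display : measure_display -> measure_display.
Proof. exact. Qed.

Section measurable_rV.
Context {R : realType} (n : nat).

Let coors : 'I_n -> 'rV[R]_n -> measurableTypeR R := fun i x => x ord0 i.

Let rV_set0 : g_sigma_preimage coors set0.
Proof. exact: sigma_algebra0. Qed.

Let rV_setC A : g_sigma_preimage coors A -> g_sigma_preimage coors (~` A).
Proof. exact: sigma_algebraC. Qed.

Let rV_bigcup (F : _^nat) : (forall i, g_sigma_preimage coors (F i)) ->
  g_sigma_preimage coors (\bigcup_i (F i)).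
Proof. exact: sigma_algebra_bigcup. Qed.

HB.instance Definition _ :=
  @isMeasurable.Build (measure_rV_display default_measure_display)
  'rV[R]_n (g_sigma_preimage coors) rV_set0 rV_setC rV_bigcup.

End measurable_rV.

Section measurable_fun_rV.
Context {R : realType}.

Lemma measurable_rV_coord n (i : 'I_n) :
  measurable_fun [set: 'rV[R]_n] (fun x => x ord0 i : measurableTypeR R).
Proof.
move=> _ Y mY; rewrite setTI; apply: sub_sigma_algebra => /=.
rewrite -bigcup_seq/=; exists i => /=; first by rewrite mem_index_enum.
by exists Y => //; rewrite setTI.
Qed.

Lemma measurable_fun_rVP d (T : measurableType d) n (f : T -> 'rV[R]_n) :
  measurable_fun [set: T] f <->
  forall i, measurable_fun [set: T] (fun x => f x ord0 i : measurableTypeR R).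
Proof.
split=> [mf i|mf].
  exact: (measurableT_comp (measurable_rV_coord i)).
move=> _ A mA; rewrite setTI.
suff /(_ _ mA) : measurable `<=` image_set_system setT f measurable.
  by rewrite /image_set_system/= setTI.
apply: smallest_sub; first exact/sigma_algebra_image/sigma_algebra_measurable.
move=> X; rewrite -bigcup_seq => -[i _ [B mB <-]].
rewrite /image_set_system/= !setTI.
by have := mf i measurableT _ mB; rewrite setTI.
Qed.

End measurable_fun_rV.

Section lebesgue_rV.
Context {R : realType}.

Definition cons_rV n (p : measurableTypeR R * 'rV[R]_n) : 'rV[R]_n.+1 :=
  \row_i if unlift ord0 i is Some j then p.2 ord0 j else p.1.

Lemma measurable_cons_rV n : measurable_fun setT (@cons_rV n).
Proof.
apply/measurable_fun_rVP => i; rewrite /cons_rV.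
under eq_fun do rewrite mxE.
case: (unlift ord0 i) => [j|]; last exact: measurable_fst.
exact: (measurableT_comp (measurable_rV_coord j) measurable_snd).
Qed.

Section step.
Variables (n : nat) (mu : {sigma_finite_measure set 'rV[R]_n -> \bar R}).

Definition cons_measure : set 'rV[R]_n.+1 -> \bar R :=
  pushforward (@lebesgue_measure R \x mu)%E (@cons_rV n).

Let m_cons := @measurable_cons_rV n.

Let cons_measure0 : cons_measure set0 = 0%E.
Proof. exact: measure0. Qed.

Let cons_measure_ge0 A : (0 <= cons_measure A)%E.
Proof. exact: measure_ge0. Qed.

Let cons_measure_sigma_additive : semi_sigma_additive cons_measure.
Proof. exact: measure_semi_sigma_additive. Qed.

HB.instance Definition _ := isMeasure.Build _ _ _ cons_measure
  cons_measure0 cons_measure_ge0 cons_measure_sigma_additive.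

Lemma cons_measure_sigma_finite : sigma_finite setT cons_measure.
Proof.
have /sigma_finiteP[F [TF ndF Foo]] :=
  sigma_finiteT (@lebesgue_measure R : {sigma_finite_measure set _ -> \bar R}).
have /sigma_finiteP[G [TG ndG Goo]] := sigma_finiteT mu.
pose uncons (x : 'rV[R]_n.+1) : measurableTypeR R * 'rV[R]_n :=
  (x ord0 ord0, \row_i x ord0 (lift ord0 i)).
have unconsK : cancel (@cons_rV n) uncons.
  move=> [a v]; rewrite /uncons /cons_rV/= mxE unlift_none; congr pair.
  by apply/rowP => i; rewrite !mxE liftK.
have muncons : measurable_fun setT uncons.
  apply: measurable_fun_pair; first exact: measurable_rV_coord.
  apply/measurable_fun_rVP => i; under eq_fun do rewrite mxE.
  exact: measurable_rV_coord.
exists (fun k => uncons @^-1` (F k `*` G k)).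
  apply/esym/seteqP; split=> // x _.
  have : [set: measurableTypeR R] (uncons x).1 by [].
  have : [set: 'rV[R]_n] (uncons x).2 by [].
  rewrite TF TG => -[k _ Gk] [l _ Fl]; exists (maxn l k) => //; split.
  - by apply: subsetPset Fl; exact/ndF/leq_maxl.
  - by apply: subsetPset Gk; exact/ndG/leq_maxr.
move=> k; have [mF Fk] := Foo k; have [mG Gk] := Goo k; split.
  by rewrite -[X in measurable X]setTI; apply: muncons => //; exact: measurableX.
rewrite /cons_measure /pushforward -comp_preimage.
rewrite (_ : uncons \o _ = id) ?preimage_id; last exact/funext.
by rewrite product_measure1E// lte_mul_pinfty// ge0_fin_numE.
Qed.

HB.instance Definition _ :=
  @Measure_isSigmaFinite.Build _ _ _ cons_measure cons_measure_sigma_finite.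

End step.

Fixpoint lebesgue_rV n : {sigma_finite_measure set 'rV[R]_n -> \bar R} :=
  match n with
  | 0 => dirac (0 : 'rV[R]_0)
  | n'.+1 => cons_measure (lebesgue_rV n')
  end.

End lebesgue_rV.

Lemma lebesgue_rV_box (R : realType) n (A : 'I_n -> set (measurableTypeR R)) :
  (forall i, measurable (A i)) ->
  lebesgue_rV n [set x : 'rV[R]_n | forall i, A i (x ord0 i)] =
  (\prod_(i < n) lebesgue_measure (A i))%E.
Proof.
elim: n A => [|n IHn] A mA.
  rewrite big_ord0 /= diracE.
  suff -> : (0 : 'rV[R]_0) \in [set x : 'rV[R]_0 | forall i, A i (x ord0 i)].
    by [].
  by rewrite inE => -[].
rewrite big_ord_recl -IHn//= /cons_measure /pushforward.
have mB : measurable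
    [set x : 'rV[R]_n | forall i, A (lift ord0 i) (x ord0 i)].
  rewrite (_ : [set x | _] =
    \big[setI/setT]_(i < n)
      ((fun x : 'rV[R]_n => x ord0 i) @^-1` A (lift ord0 i))).
    apply: bigsetI_measurable => i _.
    by rewrite -[X in measurable X]setTI; exact: measurable_rV_coord.
  rewrite -bigcap_seq; apply/seteqP; split=> x /= Ax i.
    by move=> _; exact: Ax.
  by apply: (Ax i); rewrite /= mem_index_enum.
rewrite -product_measure1E//; congr (product_measure1 _ _ _).
apply/seteqP; split=> -[a v] /=; rewrite /cons_rV => H.
  split=> [|i]; first by have := H ord0; rewrite mxE unlift_none.
  by have := H (lift ord0 i); rewrite mxE liftK.
by move=> i; rewrite mxE; case: unliftP => [j ->|->]; case: H.
Qed.

Local Notation normc := ComplexField.Normc.normc.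

Section sobolev.
Context {R : realType} {d : nat}.
Implicit Types (D : set 'rV[R]_d) (f g h : 'rV[R]_d -> R[i])
  (phi : 'rV[R]_d -> R).

Definition L2norm D f : \bar R :=
  ((\int[lebesgue_rV d]_(x in D) (normc (f x) ^+ 2)%:E) `^ 2^-1)%E.

Definition cmeasurable D f :=
  measurable_fun D (@complex.Re R \o f) /\ measurable_fun D (@complex.Im R \o f).

Definition L2 D f := cmeasurable D f /\ (L2norm D f < +oo)%E.

Definition weighted_L2norm (omega : 'rV[R]_d -> R) h : \bar R :=
  ((\int[lebesgue_rV d]_y (normc (h y) ^+ 2 * omega y)%:E) `^ 2^-1)%E.

Definition weighted_L2 (omega : 'rV[R]_d -> R) h :=
  L2 setT h /\ (weighted_L2norm omega h < +oo)%E.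

Definition partial (i : 'I_d) phi : 'rV[R]_d -> R :=
  fun x => 'D_(delta_mx ord0 i) phi x.

Definition multi_partial (alpha : 'I_d -> nat) phi : 'rV[R]_d -> R :=
  foldr (fun i u => iter (alpha i) (partial i) u) phi (enum 'I_d).

Definition smooth phi := forall s : seq 'I_d,
  continuous (foldr partial phi s) /\
  forall i x, derivable (foldr partial phi s) x (delta_mx ord0 i).

Definition compactly_supported phi := compact (closure [set x | phi x != 0]).

Definition periodic1 phi := forall i x, phi (x + delta_mx ord0 i) = phi x.

Definition Cintegral D f : R[i] :=
  Complex (\int[lebesgue_rV d]_(x in D) complex.Re (f x))
          (\int[lebesgue_rV d]_(x in D) complex.Im (f x)).

(* Real test functions suffice: both sides are linear in [phi]. *)
Definition weak_derivative D (test : set ('rV[R]_d -> R))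
    (alpha : 'I_d -> nat) f g :=
  forall phi, test phi ->
    Cintegral D (fun x => f x * (multi_partial alpha phi x)%:C%C) =
    (-1) ^+ (\sum_i alpha i)%N * Cintegral D (fun x => g x * (phi x)%:C%C).

(* The multi-indices of l_oo-norm at most m are the functions 'I_d -> 'I_m.+1. *)
Definition mix_norm m D (Df : {ffun 'I_d -> 'I_m.+1} -> 'rV[R]_d -> R[i]) :
    \bar R :=
  ((\sum_(alpha : {ffun 'I_d -> 'I_m.+1}) L2norm D (Df alpha) ^+ 2) `^ 2^-1)%E.

(* The family [Df] of weak derivatives is unique up to null sets, so the norm
   does not depend on it. *)
Definition Hmix m D (test : set ('rV[R]_d -> R)) f :=
  L2 D f /\
  exists Df : {ffun 'I_d -> 'I_m.+1} -> 'rV[R]_d -> R[i],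
    (forall alpha, cmeasurable D (Df alpha) /\
       weak_derivative D test (fun i => nat_of_ord (alpha i)) f (Df alpha)) /\
    (mix_norm D Df < +oo)%E.

Definition Hmix_Rd m f :=
  Hmix m setT [set phi | smooth phi /\ compactly_supported phi] f.

(* A function on the torus is given by its values on the cube [-1/2, 1/2)^d,
   and its distributional derivatives are tested against the smooth functions
   on the torus, i.e. the smooth 1-periodic ones. *)
Definition cube : set 'rV[R]_d :=
  [set x | forall i, x ord0 i \in `[- 2^-1, 2^-1[].

Definition Hmix_torus m f :=
  Hmix m cube [set phi | smooth phi /\ periodic1 phi] f.

End sobolev.

Section univariate.
Context {R : realType}.
Implicit Types (psi rho omega u : R -> R).

Definition Ihalf : interval R := `]- 2^-1, 2^-1[.

(* [derive1n] is total: [derive1n n u] is the n-th derivative of [u] on A only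
   under this condition. *)
Definition differentiable_upto (A : set R) n u :=
  forall k, (k < n)%N -> forall x, A x -> derivable (derive1n k u) x 1.

Definition univariate_transformation psi :=
  ({in Ihalf, forall x, derivable psi x 1} /\ {in Ihalf, continuous (derive1 psi)}) /\
  {in Ihalf &, {homo psi : x y / x < y}} /\
  {in Ihalf, forall x, psi (- x) = - psi x} /\
  psi x @[x --> (- 2^-1 : R)^'+] --> -oo /\
  psi x @[x --> (2^-1 : R)^'-] --> +oo.

(* This includes the existence of the derivative of psi^-1, i.e. psi' > 0, which
   makes both expressions (psi^-1)' and 1 / psi' \o psi^-1 of rho meaningful. *)
Definition density psi rho :=
  forall y : R, is_derive y 1 ('pinv_(fun=> 0) [set` Ihalf] psi) (rho y).

Definition weight_function omega :=
  measurable_fun setT omega /\ forall y, 0 <= omega y.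

Definition C0_line u :=
  continuous u /\ u x @[x --> +oo] --> 0 /\ u x @[x --> -oo] --> 0.

Definition Linfty_torus u : \bar R :=
  'N[@lebesgue_measure R]_+oo[EFin \o patch (fun=> 0) `[- 2^-1, 2^-1[ u].

Definition sqrt_factor psi omega : R -> R :=
  fun x => Num.sqrt (omega (psi x) * derive1 psi x).

End univariate.

Section transformed.
Context {R : realType} {d : nat}.

Definition product_weight (omega : 'I_d -> R -> R) : 'rV[R]_d -> R :=
  fun y => \prod_(j < d) omega j (y ord0 j).

Definition transformed (psi omega : 'I_d -> R -> R) (h : 'rV[R]_d -> R[i]) :
    'rV[R]_d -> R[i] :=
  fun x => h (\row_j psi j (x ord0 j)) *
    (\prod_(k < d) sqrt_factor (psi k) (omega k) (x ord0 k))%:C%C.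

End transformed.

(* Main.v *)
(** Write [chi_l] for the inverse of [psi_l].  The substitution [y = psi x] turns
    integrals over the open cube into integrals over R^d against the density
    [J = \prod_l rho_l].  In the variable [y], every derivative of the transformed
    function is a finite sum of products [D^g h * \prod_l a_l(y_l)], where [a_l]
    combines terms [F^(i)(chi_l y) * rho_l^(1-2n) * q] with [q] a bounded
    function; taking a derivative off the test function replaces [a_l] by
    [a_l' / rho_l], or replaces it by [a_l / rho_l] while raising [g_l].  The
    L_oo hypotheses say that [a_l^2 rho_l] stays bounded.  Hence
    [\prod_l a_l * J] times a bounded test function is dominated by [sqrt J],
    which is square integrable, and [\prod_l a_l * sqrt J] is bounded, so the
    sums are in L_2 of the cube.

    These weights are neither smooth nor compactly supported, so the weak
    derivatives of [h] must be tested against more general functions.  If [v] is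
    the weak derivative of [u] in direction [e_i], then products of bump
    functions show that [u(y) - u(y + t e_i) + \int_0^t v(y + s e_i) ds] vanishes
    almost everywhere; integrating this against the weight, translating, and
    letting [t] tend to 0 gives the integration by parts.

    The L_oo bounds hold almost everywhere, and the highest derivative of the
    factor need not be continuous.  A mean value inequality for everywhere
    differentiable functions whose derivative is bounded almost everywhere turns
    them into bounds that hold everywhere. *)

From HB Require Import structures.
Require Import Defs.
From mathcomp Require Import all_boot all_order all_algebra.
From mathcomp Require Import all_classical all_reals all_analysis.
From mathcomp Require Import complex measurable_realfun ess_sup_inf.
From mathcomp Require Import ring lra zify.
Set Implicit Arguments.
Unset Strict Implicit.
Unset Printing Implicit Defensive.
Import Order.TTheory GRing.Theory Num.Theory.
Import numFieldNormedType.Exports.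
Local Open Scope classical_set_scope.
Local Open Scope ring_scope.

(** * A mean value inequality with an almost everywhere bound *)

(** Test functions on the torus do not vanish on the faces of the cube, so integrating by parts
    could leave boundary terms. None arise, because after the substitution the weight and its
    derivative are at most a constant times [sqrt J]. Replacing [sqrt rho_i] by a constant gives a
    majorant independent of [y_i]; it is no longer square integrable in that direction, which a
    cutoff in [y_i] repairs. The exponents come from D_x = rho^-1 D_y. The first derivative that
    does not fall on the factor produces rho^-1; each later one adds two to the exponent, one by
    differentiating rho^-k and one by the new rho^-1. After n > 0 of them the power is rho^(1-2n),
    and its square times rho is rho^-(4n-3), the square of psi'^(2n-3/2). For n = 0 only psi'^(-1/2)
    occurs. The coefficients do not depend on h, so the same sums serve its real and imaginary
    parts, which are treated as real functions. For m = 0 the factor may be merely measurable and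
    everywhere bounds are out of reach; there the L_2 norm over the cube is the weighted norm of
    h. *)

Section gen_mvt.
Context {R : realType}.
Local Notation mu := (@lebesgue_measure R).

Lemma near_slope_le (g : R -> R) (c L : R) : derivable g c 1 -> derive1 g c < L ->
  \forall y \near c, (c <= y -> g y - g c <= L * (y - c)) /\
                     (y <= c -> g c - g y <= L * (c - y)).
Proof.
move=> dg gL.
have : h^-1 *: (g (h + c) - g c) @[h --> 0^'] --> derive1 g c.
  rewrite derive1E; move: dg; rewrite /derivable /derive /=.
  rewrite (_ : (fun h => _ *: (g (h *: 1 + c) - _)) = fun h => h^-1 *: (g (h + c) - g c)) //.
  by apply/funext => h; rewrite [h *: 1]mulr1.
move=> /cvgr_lt/(_ _ gL); rewrite near_withinE near_simpl => H.
have : \forall y \near c, y - c != 0 -> (y - c)^-1 *: (g (y - c + c) - g c) < L.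
  rewrite -(subr0 c) in H *.
  near=> y; near: y.
  rewrite subr0 in H *.
  case: H => e /= e0 He; exists e => //= y cy yc.
  by apply: He => //=; rewrite sub0r normrN distrC.
apply: filterS => y; rewrite subrK; have [->|yc] := eqVneq y c.
  by rewrite !subrr !mulr0.
rewrite subr_eq0 yc => /(_ isT); rewrite /GRing.scale/= => Hy; split => cy.
  have yc0 : 0 < y - c by rewrite subr_gt0 lt_neqAle eq_sym yc.
  by apply: ltW; move: Hy; rewrite mulrC ltr_pdivrMr.
have yc0 : 0 < c - y by rewrite subr_gt0 lt_neqAle yc.
apply: ltW; move: Hy; rewrite -(opprB c y) invrN mulNr -mulrN opprB mulrC.
by rewrite ltr_pdivrMr.
Unshelve. all: end_near. Qed.

(** Supremum argument on the points where [w] has not risen above [w a]: the left half of the local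
    condition puts the supremum into this set, and the right half moves beyond it unless it is [b].
    The two-sided local condition stands in for continuity. *)
Lemma nincr_near (w : R -> R) (a b : R) : a <= b ->
  (forall c, a <= c <= b -> \forall y \near c,
     (c <= y <= b -> w y <= w c) /\ (a <= y <= c -> w c <= w y)) ->
  w b <= w a.
Proof.
move=> ab H; pose S := [set x | a <= x <= b /\ w x <= w a].
have Sa : S a by split; rewrite ?lexx.
have hS : has_sup S.
  by split; [exists a | exists b => x [/andP[]]].
pose c := sup S.
have ac : a <= c by apply: ub_le_sup => //; exact: hS.2.
have cb : c <= b by apply: ge_sup; [exists a | move=> x [/andP[]]].
have [e /= e0 He] := H c (introT andP (conj ac cb)).
have Sc : S c.
  split; first by rewrite ac.
  have [x Sx cx] := sup_adherent e0 hS.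
  have xc : x <= c by apply: ub_le_sup => //; exact: hS.2.
  have [ax xb] := andP Sx.1.
  apply: le_trans Sx.2; apply: (He x _).2; last by rewrite ax.
  by rewrite /ball/= ger0_norm ?subr_ge0// ltrBlDr addrC -ltrBlDr.
have [cb'|bc] := ltP c b; last first.
  by have <- : c = b by [apply/eqP; rewrite eq_le cb bc]; exact: Sc.2.
pose y := Num.min b (c + e / 2).
have cy : c < y by rewrite lt_min cb' ltrDl divr_gt0.
have Sy : S y.
  split; first by rewrite (le_trans ac (ltW cy))/= ge_min lexx.
  apply: le_trans Sc.2; apply: (He y _).1; last by rewrite (ltW cy)/= ge_min lexx.
  rewrite /ball/= distrC ger0_norm ?subr_ge0 ?(ltW cy)// ltrBlDl.
  by rewrite gt_min ltrD2l [e / 2 < e]ltr_pdivrMr// ltr_pMr// ltr1n orbT.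
have : y <= c by apply: ub_le_sup => //; exact: hS.2.
by rewrite leNgt cy.
Qed.

(* A null set [N] is swallowed by open sets of total measure [e]; the increasing
   function [fun x => \sum_k mu (U k `&` [a, x[)] has slope [+oo] on [N]. *)
Lemma null_steep_function (N : set R) (a b e : R) :
  measurable N -> mu N = 0%E -> 0 < e ->
  exists v : R -> R, [/\ {in `[a, b] &, {homo v : x y / x <= y}},
    forall x, x \in `[a, b] -> 0 <= v x <= e &
    forall c (K : nat), c \in `[a, b] -> N c -> \forall y \near c,
      (c <= y <= b -> v y - v c >= K%:R * (y - c)) /\
      (a <= y <= c -> v c - v y >= K%:R * (c - y))].
Proof.
move=> mN N0 e0.
have /choice[U HU] : forall k : nat, exists U : set R,
    [/\ open U, N `<=` U & (mu U < (e / (2 ^ k.+1)%:R)%:E)%E].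
  move=> k; have ek : 0 < e / (2 ^ k.+1)%:R by rewrite divr_gt0// ltr0n expn_gt0.
  have [|U [oU NU mUN]] := lebesgue_regularity_outer mN _ ek.
    by rewrite [X in (X < _)%E]N0.
  exists U; split=> //.
  rewrite -(setDUK NU); apply: (le_lt_trans (measureU2 _ _ _)) => //.
    by apply: measurableD => //; exact: open_measurable.
  by rewrite [X in (X + _ < _)%E](_ : _ = 0%E) ?add0e.
pose s x k := mu (U k `&` `[a, x[%classic).
have mU k : measurable (U k) by apply: open_measurable; case: (HU k).
have mUI k x y : measurable (U k `&` `[x, y[%classic).
  by apply: measurableI; [exact: mU|exact: measurable_itv].
have s0 x k : (0 <= s x k)%E by exact: measure_ge0.
pose u x := (\sum_(k <oo) s x k)%E.
have u0 x : (0 <= u x)%E by exact: nneseries_ge0.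
have ue x : (u x <= e%:E)%E.
  apply: (@le_trans _ _ (\sum_(k <oo) (e / (2 ^ k.+1)%:R)%:E)%E).
    apply: lee_nneseries => // k _; apply: (@le_trans _ _ (mu (U k))).
      by apply: le_measure; rewrite ?inE; [exact: mUI|exact: mU|exact: subIsetl].
    by apply: ltW; case: (HU k).
  have := epsilon_trick0 xpredT (ltW e0). exact.
have ufin x : u x \is a fin_num.
  by rewrite ge0_fin_numE// (le_lt_trans (ue x))// ltry.
have uD x y : a <= x -> x <= y ->
    u y = (u x + \sum_(k <oo) mu (U k `&` `[x, y[%classic))%E.
  move=> ax xy; rewrite -nneseriesD//; apply: eq_eseriesr => k _.
  rewrite /s -measureU//; last 3 first.
    exact: mUI.
    exact: mUI.
    apply/seteqP; split=> // t [[_ /=]]; rewrite in_itv/= => /andP[_ tx] [_ /=].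
    by rewrite in_itv/= leNgt tx.
  rewrite -setIUr; congr (mu (_ `&` _)).
  by apply/seteqP; split=> t /=; rewrite !in_itv/=; 
     [case: (ltP t x) => tx /andP[-> ?]; [left|right] => //
     | move=> [/andP[at1 tx]|/andP[xt ty]]; [rewrite at1 (lt_le_trans tx)|
         rewrite ty (le_trans ax)]].
exists (fun x => fine (u x)); split.
- move=> x y; rewrite !in_itv/= => /andP[ax _] /andP[ay yb] xy.
  rewrite fine_le// (uD x y)// leeDl//.
  by apply: nneseries_ge0 => k _ _; exact: measure_ge0.
- by move=> x _; rewrite fine_ge0//= -lee_fin fineK.
- move=> c K; rewrite in_itv/= => /andP[ac cb] Nc.
  (* If the first [K] open sets all contain the interval, each of the first [K] terms of the series
     contributes its full length. *)
  have key x y : a <= x -> x <= y -> (forall k, (k < K)%N -> `[x, y[%classic `<=` U k) ->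
      K%:R * (y - x) <= fine (u y) - fine (u x).
    move=> ax xy HK; rewrite -lee_fin EFinB !fineK// (uD x y)// addeAC subee// add0e.
    have := @nneseries_lim_ge _ (fun k => mu (U k `&` `[x, y[%classic)) xpredT 0 K
        (fun k _ _ => measure_ge0 _ _).
    apply: le_trans; rewrite (_ : (\sum_(0 <= k < K | _) _)%E = (\sum_(0 <= k < K) (y - x)%:E)%E).
      by rewrite sumEFin big_const_nat subn0 iter_addr_0 mulr_natl.
    apply: eq_big_nat => k /andP[_ kK]; rewrite (setIidr (HK k kK)).
    by rewrite lebesgue_measure_itv/= lte_fin; move: xy; rewrite le_eqVlt => /orP[/eqP->|->//]; rewrite ltxx subrr.
  have : \forall y \near c, forall k, (k < K)%N -> U k y.
    elim: K {key} => [|K IH]; first by exists 1 => //= y _ k; rewrite ltn0.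
    have [oU /(_ _ Nc) Ukc _] := HU K.
    have := open_nbhs_nbhs (conj oU Ukc).
    apply: filterS2 IH => y Hy Uy k; rewrite ltnS leq_eqVlt => /orP[/eqP->//|]; exact: Hy.
  case=> r /= r0 Hr; exists r => // y /= cy; split => /andP[h1 h2].
    apply: key => // k kK t; rewrite /= in_itv/= => /andP[ct ty]; apply: Hr => //=.
    move: cy; rewrite distrC ger0_norm ?subr_ge0// distrC ger0_norm ?subr_ge0//.
    by apply: le_lt_trans; rewrite lerB// ltW.
  apply: key => // k kK t; rewrite /= in_itv/= => /andP[yt tc]; apply: Hr => //=.
  move: cy; rewrite ger0_norm ?subr_ge0// ger0_norm ?subr_ge0 ?(ltW tc)//.
  by apply: le_lt_trans; rewrite lerB.
Qed.

(** Subtracting a line of slope [M + e] and the steep function [v] makes [g] locally nonincreasing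
    at every point: off the null set the line suffices, on it the steepness of [v] beats the
    derivative of [g]. The correction [v] costs at most [e] in total. *)
Lemma derive1_le_ae (g : R -> R) (a b M : R) : a <= b ->
  (forall x, x \in `[a, b] -> derivable g x 1) ->
  {ae mu, forall x, x \in `[a, b] -> derive1 g x <= M} ->
  g b - g a <= M * (b - a).
Proof.
move=> ab dg [N [mN N0 HN]].
suff H e : 0 < e -> g b - g a <= M * (b - a) + e * (b - a) + e.
  apply/ler_addgt0Pr => e e0.
  have eb : 0 < e / (b - a + 1) by rewrite divr_gt0// ltr_wpDl// subr_ge0.
  apply: le_trans (H _ eb) _; rewrite -addrA lerD2l -[X in _ + X]mulr1 -mulrDr.
  by rewrite divfK// gt_eqF// ltr_wpDl// subr_ge0.
move=> e0; have [v [ndv v0e vK]] := null_steep_function a b mN N0 e0.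
pose w x := g x - (M + e) * x - v x.
have : w b <= w a.
  apply: nincr_near => // c /[dup] cab.
  rewrite -[a <= c <= b]/(c \in `[a, b]) => cI; have [Nc|Nc] := pselect (N c).
    (* At a point of the null set the derivative is unbounded by [M] but finite, so some integer
       slope [K] of [v] exceeds the excess. *)
    pose K := (Num.truncn (`|derive1 g c - (M + e)|)).+1.
    have gK : derive1 g c < M + e + K%:R.
      rewrite -ltrBlDl; apply: le_lt_trans (ler_norm _) _.
      exact: truncnS_gt.
    have := near_slope_le (dg _ cI) gK.
    apply: filterS2 (vK c K cI Nc) => y [v1 v2] [g1 g2].
    split=> /andP[h1 h2].
      have := v1 (introT andP (conj h1 h2)); have := g1 h1.
      rewrite /w; lra.
    have := v2 (introT andP (conj h1 h2)); have := g2 h2.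
    rewrite /w; lra.
  have gK : derive1 g c < M + e.
    suff : derive1 g c <= M by move=> /le_lt_trans; apply; rewrite ltrDl.
    by apply: contrapT => nM; apply: Nc; apply: HN => /=; tauto.
  apply: filterS (near_slope_le (dg _ cI) gK) => y [g1 g2].
  have [ac cb] := andP cab.
  split=> /andP[h1 h2].
    have : v c <= v y.
      apply: ndv => //; rewrite in_itv/=; apply/andP; split => //; exact: le_trans h1.
    have := g1 h1; rewrite /w; lra.
  have : v y <= v c.
    apply: ndv => //; rewrite in_itv/=; apply/andP; split => //; exact: le_trans cb.
  have := g2 h2; rewrite /w; lra.
have /andP[? ?] : 0 <= v a <= e by apply: v0e; rewrite in_itv/= lexx.
have /andP[? ?] : 0 <= v b <= e by apply: v0e; rewrite in_itv/= ab lexx.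
rewrite /w; lra.
Qed.

End gen_mvt.

(** * Lebesgue measure on row vectors *)

Section rV_measurable.
Context {R : realType}.

Definition boxes n (H : set (set (measurableTypeR R))) : set (set 'rV[R]_n) :=
  [set B | exists A : 'I_n -> set (measurableTypeR R), (forall i, H (A i)) /\
     B = [set x : 'rV[R]_n | forall i, A i (x ord0 i)]].

Arguments boxes n H : clear implicits.

Lemma setI_closed_boxes n H : setI_closed H -> setI_closed (boxes n H).
Proof.
move=> HI _ _ [A [HA ->]] [B [HB ->]]; exists (fun i => A i `&` B i).
split=> [i|]; first exact: HI.
by apply/seteqP; split=> x /=; [move=> [h1 h2] i; split|move=> h; split => i; case: (h i)].
Qed.

Lemma measurable_box n (A : 'I_n -> set (measurableTypeR R)) :
  (forall i, measurable (A i)) ->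
  measurable [set x : 'rV[R]_n | forall i, A i (x ord0 i)].
Proof.
move=> mA; rewrite (_ : [set x | _] =
    \big[setI/setT]_(i < n) ((fun x : 'rV[R]_n => x ord0 i) @^-1` A i)).
  apply: bigsetI_measurable => i _.
  by rewrite -[X in measurable X]setTI; exact: measurable_rV_coord.
rewrite -bigcap_seq; apply/seteqP; split=> x /= Ax i.
  by move=> _; exact: Ax.
by apply: (Ax i); rewrite /= mem_index_enum.
Qed.

(** The sigma-algebra on row vectors is generated by conditions on single coordinates; boxes are the
    intersection-stable generator that uniqueness of measures and Dynkin induction require. A
    condition on one coordinate is a box whose other sides are [setT], hence [H setT]. *)
Lemma measurable_rV_boxes n (H : set (set (measurableTypeR R))) :
  H setT -> measurable = <<s H >> ->
  @measurable _ 'rV[R]_n = <<s boxes n H >>.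
Proof.
move=> HT mH; apply/seteqP; split; last first.
  apply: smallest_sub; first exact: sigma_algebra_measurable.
  move=> _ [A [HA ->]]; apply: measurable_box => i; rewrite mH.
  exact: sub_sigma_algebra.
apply: smallest_sub; first exact: smallest_sigma_algebra.
move=> X; rewrite -bigcup_seq => -[i _ [B mB <-]].
suff : measurable `<=` image_set_system setT (fun x : g_sigma_algebraType (boxes n H) =>
    x ord0 i : measurableTypeR R) <<s boxes n H >>.
  by move=> /(_ _ mB); rewrite /image_set_system/=.
rewrite mH; apply: smallest_sub.
  by apply: sigma_algebra_image; exact: smallest_sigma_algebra.
move=> A HA; rewrite /image_set_system/= setTI; apply: sub_sigma_algebra.
exists (fun j => if j == i then A else setT); split=> [j|].
  by case: ifP.
apply/seteqP; split=> x /= => [Ax j|/(_ i)]; last by rewrite eqxx.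
by case: eqP => // ->.
Qed.

(** The topology and the product sigma-algebra are defined independently. An open set is the union
    of the countably many cubes with rational centre and radius 1/(k+1) that it contains. *)
Lemma open_measurable_rV n (U : set 'rV[R]_n) : open U -> measurable U.
Proof.
move=> oU; pose I : countType := ('rV[rat]_n * nat)%type.
pose box (p : I) : set 'rV[R]_n := [set x | forall i,
  (ball (ratr (p.1 ord0 i) : R) (p.2.+1%:R^-1)) (x ord0 i)].
rewrite (_ : U = \bigcup_(p in [set p | box p `<=` U]) box p); last first.
  apply/seteqP; split=> [x Ux|x [p /=]]; last exact.
  have /nbhs_ballP[e /= e0 He] : nbhs x U by exact: open_nbhs_nbhs.
  have [k _ /(_ _ (leqnn _)) /= ke] := near_infty_natSinv_lt (PosNum (divr_gt0 e0 (ltr0n _ 2))).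
  have /choice[q Hq] : forall i : 'I_n, exists q : rat, ball (x ord0 i) (k.+1%:R^-1) (ratr q : R).
    move=> i; have [||y [/= xq [q _ qy]]] := dense_rat (O := ball (x ord0 i) (k.+1%:R^-1 : R)).
      by exists (x ord0 i); exact: ballxx.
      exact: ball_open.
    by exists q; rewrite qy.
  exists (\row_i q i, k) => /=; last first.
    by move=> i; rewrite mxE /=; exact/ball_sym.
  move=> y /= Hy; apply: He; split => // i j; rewrite (ord1 i).
  rewrite (splitr e).  apply: (@ball_triangle _ _ (ratr (q j) : R)).
    by apply: le_ball (Hq j); exact: ltW.
  by have := Hy j; rewrite mxE => h; apply: le_ball h; exact: ltW.
rewrite bigcup_mkcond; apply: countable_bigcupT_measurable => [|p]; first exact: countableP.
case: ifPn => // _; apply: (@measurable_box _ (fun i => ball (ratr (p.1 ord0 i) : R) (p.2.+1%:R^-1))) => i.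
  apply: open_measurable.
exact: ball_open.
Qed.

Lemma continuous_measurable_rV n (f : 'rV[R]_n -> R) :
  continuous f -> measurable_fun setT (f : _ -> measurableTypeR R).
Proof.
move=> cf; apply: (measurability _ (RGenOpens.measurableE R)).
move=> _ [_ [a [b ->]] <-]; rewrite setTI; apply: open_measurable_rV.
by apply: open_comp => //; exact: interval_open.
Qed.

End rV_measurable.
Arguments boxes {R} n H.

Section rV_translation.
Context {R : realType}.
Local Notation lam := (@lebesgue_rV R).

Lemma lebesgue_measure_shift (s : R) (A : set (measurableTypeR R)) : measurable A ->
  lebesgue_measure ((fun x : R => x + s) @^-1` A) = lebesgue_measure A.
Proof.
move=> mA.
rewrite -[LHS]/(pushforward lebesgue_measure ((fun x => x + s) : _ -> measurableTypeR R) A).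
apply/esym/lebesgue_measure_unique => //= [|_ _ [[a b]] _ <-].
  by apply: measurable_funD => //; exact: measurable_id.
rewrite /pushforward (_ : _ @^-1` _ = `]a - s, b - s]%classic).
  by rewrite !lebesgue_measure_itv/= !lte_fin ltrD2r -!EFinB opprB addrA subrK.
by apply/seteqP; split=> x /=; rewrite !in_itv/= ltrBlDr lerBrDr.
Qed.

Lemma measurable_shift n (v : 'rV[R]_n) : measurable_fun setT (fun y : 'rV[R]_n => y + v).
Proof.
apply/measurable_fun_rVP => i; under eq_fun do rewrite mxE.
by apply: measurable_funD => //; exact: measurable_rV_coord.
Qed.

Lemma lebesgue_rV_fin_box n (A : 'I_n -> set (measurableTypeR R)) :
  (forall i, measurable (A i)) -> (forall i, lebesgue_measure (A i) < +oo)%E ->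
  (lam n [set x | forall i, A i (x ord0 i)] < +oo)%E.
Proof.
move=> mA Aoo; rewrite lebesgue_rV_box//.
suff : (0 <= \prod_(i < n) lebesgue_measure (A i) < +oo)%E by move=> /andP[].
apply: (big_ind (fun x : \bar R => 0 <= x < +oo)%E) => //.
- by rewrite lee_fin ltry ler01.
- move=> x y /andP[x0 xoo] /andP[y0 yoo]; rewrite mule_ge0//=.
  by rewrite lte_mul_pinfty// ge0_fin_numE.
- by move=> i _; rewrite measure_ge0 Aoo.
Qed.

(** The measure and its translate agree on boxes by the one-dimensional case, and the cubes [g k]
    exhaust the space with finite measure. *)
Lemma lebesgue_rV_shift n (v : 'rV[R]_n) A : measurable A ->
  lam n ((fun y : 'rV[R]_n => y + v) @^-1` A) = lam n A.
Proof.
move=> mA; rewrite -[LHS]/(pushforward (lam n) (fun y : 'rV[R]_n => y + v) A).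
have mT : @measurable _ (measurableTypeR R) = <<s measurable >>.
  by rewrite sigma_algebra_id//; exact: sigma_algebra_measurable.
pose g (k : nat) := [set x : 'rV[R]_n | forall i, `]- k%:R, k%:R[%classic (x ord0 i)].
have mg : forall k i, @measurable _ (measurableTypeR R) ((fun _ : 'I_n => `]- (k%:R : R), k%:R[%classic) i).
  by move=> k i; exact: measurable_itv.
have key : forall B, boxes n measurable B -> pushforward (lam n) (fun y : 'rV[R]_n => y + v) B = lam n B.
  move=> _ [B [mB ->]]; rewrite /pushforward [RHS]lebesgue_rV_box//.
  rewrite (_ : _ @^-1` _ = [set x : 'rV[R]_n | forall i, ((fun t => t + v ord0 i) @^-1` B i) (x ord0 i)]).
    etransitivity; last by apply: eq_bigr => i _; exact: (lebesgue_measure_shift (v ord0 i) (mB i)).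
    apply: lebesgue_rV_box => i; rewrite -[X in measurable X]setTI.
    have : measurable_fun setT ((fun t => t + v ord0 i) : measurableTypeR R -> measurableTypeR R).
      by apply: measurable_funD => //; exact: measurable_id.
    exact.
  by apply/seteqP; split=> x /= + i => /(_ i); rewrite mxE.
apply: (measure_unique (boxes n measurable) g) => //.
- apply: measurable_rV_boxes => //.
- by apply: setI_closed_boxes => A' B; exact: measurableI.
- by move=> k; exists (fun=> `]- k%:R, k%:R[%classic).
- apply/seteqP; split=> // x _.
  exists (\sum_i (Num.truncn `|x ord0 i|).+1)%N => // i /=.
  rewrite in_itv/= -ltr_norml; apply: lt_le_trans (truncnS_gt _) _.
  by rewrite ler_nat (bigD1 i)//= leq_addr.
- exact: measurable_shift.
- move=> mv k; rewrite [X in (X < _)%E](_ : _ = lam n (g k)); last first.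
    by apply: key; exists (fun=> `]- k%:R, k%:R[%classic).
  apply: (@lebesgue_rV_fin_box n (fun=> `]- k%:R, k%:R[%classic)) => // i.
  by rewrite lebesgue_measure_itv/=; case: ifP => _; rewrite ?ltry.
Qed.

Lemma ge0_integral_shift n (v : 'rV[R]_n) (f : 'rV[R]_n -> \bar R) :
  measurable_fun setT f -> (forall y, 0 <= f y)%E ->
  (\int[lam n]_y f (y + v)%R = \int[lam n]_y f y)%E.
Proof.
move=> mf f0.
rewrite -[LHS](ge0_integral_pushforward (measurable_shift v) (lam n) (D := setT) (f := f))//.
by apply: eq_measure_integral => [|mv A mA _]; [exact: measurable_shift|exact: lebesgue_rV_shift].
Qed.

Lemma integral_shift n (v : 'rV[R]_n) (f : 'rV[R]_n -> \bar R) :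
  measurable_fun setT f ->
  (\int[lam n]_y f (y + v)%R = \int[lam n]_y f y)%E.
Proof.
move=> mf; rewrite [LHS]integralE [RHS]integralE.
congr (_ - _)%E.
  rewrite -(ge0_integral_shift v (measurable_funepos mf) (funepos_ge0 f)).
  by apply: eq_integral => y _; rewrite !funeposE.
rewrite -(ge0_integral_shift v (measurable_funeneg mf) (funeneg_ge0 f)).
by apply: eq_integral => y _; rewrite !funenegE.
Qed.

Lemma integrable_shift n (v : 'rV[R]_n) (f : 'rV[R]_n -> \bar R) :
  (lam n).-integrable setT f -> (lam n).-integrable setT (fun y => f (y + v)).
Proof.
move=> /integrableP[mf foo]; apply/integrableP; split.
  exact: (measurableT_comp mf (measurable_shift v)).
rewrite (ge0_integral_shift v (f := fun y => `|f y|%E))//.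
exact: measurableT_comp.
Qed.

End rV_translation.

(** * Measures given by a density *)

Section density_measure.
Local Open Scope ereal_scope.
Context d (T : measurableType d) (R : realType).
Variables (mu : {measure set T -> \bar R}) (f : T -> R).
Hypotheses (mf : measurable_fun setT f) (f0 : forall x, (0 <= f x)%R).

(** The proofs [mf] and [f0] are arguments so that the measure structure can be inferred from the
    term itself. *)
Definition density_measure (mf : measurable_fun setT f) (f0 : forall x, (0 <= f x)%R)
  (A : set T) : \bar R := \int[mu]_(x in A) (f x)%:E.

Local Notation nu := (density_measure mf f0).

Let nu0 : nu set0 = 0.
Proof. exact: integral_set0. Qed.

Let nu_ge0 A : 0 <= nu A.
Proof. by apply: integral_ge0 => x _; rewrite lee_fin. Qed.

Let nu_sigma_additive : semi_sigma_additive nu.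
Proof.
move=> /= F mF tF mUF; rewrite /density_measure; apply: cvg_toP.
  apply: ereal_nondecreasing_is_cvgn => m n mn.
  by apply: lee_sum_nneg_natr => // k _ _; apply: integral_ge0 => x _; rewrite lee_fin.
rewrite ge0_integral_bigcup//=.
  by apply: measurable_funTS; exact/measurable_EFinP.
by move=> x _; rewrite lee_fin.
Qed.

HB.instance Definition _ := isMeasure.Build _ _ _ nu nu0 nu_ge0 nu_sigma_additive.

Import HBNNSimple.

(** Monotone convergence on both sides reduces the claim to simple functions, and linearity to
    indicators, where it is the definition of the measure. *)
Lemma ge0_integral_density (g : T -> \bar R) : measurable_fun setT g ->
  (forall x, 0 <= g x) -> \int[nu]_x g x = \int[mu]_x (g x * (f x)%:E).
Proof.
move=> mg g0; pose g_ := nnsfun_approx measurableT mg.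
have mgf n : measurable_fun setT (fun x => (g_ n x)%:E * (f x)%:E).
  by apply: emeasurable_funM => //; exact/measurable_EFinP.
transitivity (limn (fun n => \int[nu]_x (g_ n x)%:E)).
  rewrite -monotone_convergence//.
  - apply: eq_integral => y _; apply/esym/cvg_lim => //.
    by apply: cvg_nnsfun_approx.
  - by move=> n; exact/measurable_EFinP.
  - by move=> n y _; rewrite lee_fin.
  - by move=> y _ m n mn; rewrite lee_fin; exact/lefP/nd_nnsfun_approx.
transitivity (limn (fun n => \int[mu]_x ((g_ n x)%:E * (f x)%:E))); last first.
  rewrite -monotone_convergence//.
  - apply: eq_integral => y _; apply/cvg_lim => //.
    by apply: cvgeZr => //; exact: cvg_nnsfun_approx.
  - by move=> n y _; rewrite mule_ge0// lee_fin.
  - move=> y _ m n mn; apply: lee_wpmul2r; rewrite lee_fin//; exact/lefP/nd_nnsfun_approx.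
congr (limn _); apply/funext => n.
under [LHS]eq_integral do rewrite fimfunE -fsumEFin//.
rewrite ge0_integral_fsum//; last 2 first.
- by move=> y; exact/measurable_EFinP/measurable_funM.
- by move=> y x _; rewrite nnfun_muleindic_ge0.
under [RHS]eq_integral.
  move=> x _; rewrite fimfunE -fsumEFin// ge0_mule_fsuml; last first.
    by move=> r; rewrite nnfun_muleindic_ge0.
  over.
rewrite [RHS]ge0_integral_fsum//; last 2 first.
- move=> y; apply: emeasurable_funM; [exact/measurable_EFinP/measurable_funM|exact/measurable_EFinP].
- by move=> y x _; apply: mule_ge0; rewrite ?nnfun_muleindic_ge0// lee_fin.
apply: eq_fsbigr => r _; rewrite integralZl_indic_nnsfun// integral_indic//=.
rewrite setIT.
(* A negative [r] is not a value of a nonnegative simple function, so both sides vanish; for the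
   others the constant can be pulled out of the integral. *)
have [r0|r0] := ltP r 0%R.
  rewrite preimage_nnfun0//= measure0 mule0.
  by rewrite integral0_eq// => x _; rewrite indic0 mulr0 mul0e.
under [RHS]eq_integral do rewrite EFinM -muleA.
rewrite ge0_integralZl//; last 2 first.
- apply: emeasurable_funM => //; exact/measurable_EFinP.
- by move=> x _; rewrite mule_ge0// lee_fin.
congr (_ * _); rewrite /density_measure integral_mkcond.
apply: eq_integral => x _; rewrite /patch indicE.
by case: ifP => _; rewrite ?mul1e ?mul0e.
Qed.

End density_measure.

(** * Change of variables on the line *)

Section change_of_variables1.
Context {R : realType}.
Variables (chi psi rho : R -> R) (a b : R).
Local Notation mu := (@lebesgue_measure R).
Hypothesis (dchi : forall y : R, is_derive y 1 chi (rho y)).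
Hypotheses (crho : continuous rho) (rho0 : forall y, 0 < rho y).
Hypothesis chiab : forall y, chi y \in `]a, b[.
Hypotheses (chiK : cancel chi psi) (psiK : {in `]a, b[, cancel psi chi}).
Hypothesis mpsi : measurable_fun `]a, b[ psi.

Lemma chi_incr : {homo chi : x y / x < y}.
Proof.
move=> x y xy.
have dc z : derivable chi z 1 by case: (dchi z).
apply: (@gtr0_derive1_lt_cc _ chi x y) => //.
- by move=> z _; rewrite derive1E; have := dchi z => /@derive_val ->.
- apply: continuous_subspaceT => z; apply: differentiable_continuous.
  exact/derivable1_diffP.
- by rewrite in_itv/= lexx ltW.
- by rewrite in_itv/= lexx ltW.
Qed.

(** The measure with density [rho] is the image under [psi] of Lebesgue measure on []a, b[]: on an
    open interval from p to q both give [chi q - chi p], one by the fundamental theorem of calculus,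
    the other because [psi] and [chi] are inverse and increasing. *)
Lemma ge0_integral_chi (K : R -> \bar R) : measurable_fun `]a, b[ K ->
  (forall x, x \in `]a, b[ -> 0 <= K x)%E ->
  (\int[mu]_y (K (chi y) * (rho y)%:E) = \int[mu]_(x in `]a, b[) K x)%E.
Proof.
move=> mK K0; pose D := `]a, b[%classic : set (measurableTypeR R).
have mD : measurable D by exact: measurable_itv.
have mrho : measurable_fun setT (rho : measurableTypeR R -> measurableTypeR R).
  exact: continuous_measurable_fun.
have rho0' y : 0 <= rho y by exact: ltW.
have cchi : continuous chi.
  move=> y; apply: differentiable_continuous; apply/derivable1_diffP.
  by case: (dchi y).
have mchi : measurable_fun setT (chi : measurableTypeR R -> measurableTypeR R).
  exact: continuous_measurable_fun.
pose phi : measurableTypeR R -> measurableTypeR R := psi \_ D.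
have phiE x : x \in `]a, b[ -> phi x = psi x.
  by move=> xD; rewrite /phi/= patchE ifT//; exact/mem_set.
have mphi : measurable_fun setT phi by apply/(measurable_restrictT _ mD).
have mI : measurable_fun setT (\1_D : measurableTypeR R -> R) by exact: measurable_indic.
have I0 x : 0 <= \1_D x :> R by [].
pose m1 : {measure set (measurableTypeR R) -> \bar R} := density_measure mu mrho rho0'.
pose m0 : {measure set (measurableTypeR R) -> \bar R} := density_measure mu mI I0.
have m1itv p q : p < q -> m1 `]p, q[%classic = (chi q - chi p)%:E.
  move=> pq; transitivity (\int[mu]_(x in `]p, q[) (rho x)%:E)%E; first by [].
  rewrite integral_itv_bndo_bndc; last by apply/measurable_EFinP; exact: measurable_funTS.
  rewrite integral_itv_obnd_cbnd; last by apply/measurable_EFinP; exact: measurable_funTS.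
  rewrite (@continuous_FTC2 _ rho chi)//.
  - exact: continuous_subspaceT.
  - split=> [x _||]; first by case: (dchi x).
      by apply: cvg_at_right_filter; exact: cchi.
    by apply: cvg_at_left_filter; exact: cchi.
  - by move=> x _; rewrite derive1E; have := dchi x => /@derive_val ->.
have itv0 (p q : R) : q <= p -> `]p, q[%classic = set0 :> set R.
  by move=> qp; rewrite set_itv_ge ?bnd_simp// -leNgt.
have m12 A : measurable A -> m1 A = pushforward m0 phi A.
  pose m2 := measure_function_pushforward__canonical__measure_function_Measure m0 mphi.
  apply: (fun h1 h2 h3 => @measure_unique _ R (measurableTypeR R) (@RGenOpens.G R)
    (fun k => `]- k%:R, k%:R[%classic) (RGenOpens.measurableE R) h1 h2 h3 m1 m2).
  - move=> _ _ [x [y ->]] [x' [y' ->]]; exists (Num.max x x'), (Num.min y y').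
    apply/seteqP; split=> t /=; rewrite !in_itv/= gt_max lt_min.
      by move=> [/andP[-> ->] /andP[-> ->]].
    by move=> /andP[/andP[-> ->] /andP[-> ->]].
  - by move=> k; exists (- k%:R), k%:R.
  - apply/seteqP; split=> // x _; exists (Num.truncn `|x|).+1 => //=.
    by rewrite in_itv/= -ltr_norml truncnS_gt.
  - move=> _ [p [q ->]].
    have [pq|qp] := ltP p q; last by rewrite itv0// !measure0.
    rewrite m1itv//; transitivity (\int[mu]_(x in phi @^-1` `]p, q[) (\1_D x)%:E)%E; last by [].
    rewrite integral_indic//; last first.
      by rewrite -[X in measurable X]setTI; exact: (mphi measurableT _ (measurable_itv _)).
    rewrite (_ : _ `&` _ = `]chi p, chi q[%classic); last first.
      apply/seteqP; split=> x /=.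
        move=> [xD]; rewrite phiE// !in_itv/= => /andP[px xq].
        by rewrite -(psiK xD) !chi_incr.
      rewrite in_itv/= => /andP[px xq].
      have xD : x \in `]a, b[.
        move: (chiab p) (chiab q); rewrite !in_itv/= => /andP[ap _] /andP[_ qb].
        by rewrite (lt_trans ap)//= (lt_trans xq).
      split=> //; rewrite phiE//.
      have chi_le : {mono chi : x y / x < y} by apply: leW_mono; apply: le_mono; exact: chi_incr.
      by rewrite in_itv/= -chi_le psiK// px -chi_le psiK.
    transitivity (lebesgue_measure (`]chi p, chi q[%classic : set R)); last by [].
    by rewrite lebesgue_measure_itv/= lte_fin chi_incr.
  - move=> k; have [k0|k0] := ltP (- k%:R : R) k%:R; last by rewrite itv0// measure0.
    by rewrite m1itv// ltry.
have mKchi : measurable_fun setT (K \o chi).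
  apply: (measurable_comp mD _ mK mchi) => _ [y _ <-]; exact: chiab.
have Kchi0 y : (0 <= K (chi y))%E by apply: K0; exact: chiab.
rewrite -[LHS](@ge0_integral_density _ _ _ mu _ mrho rho0' (K \o chi))//.
transitivity (\int[pushforward m0 phi]_y (K (chi y)))%E.
  by apply: eq_measure_integral => A mA _; exact: m12.
rewrite (ge0_integral_pushforward mphi m0 (D := setT) (f := K \o chi))//; last by move=> y _; exact: Kchi0.
rewrite preimage_setT ge0_integral_density; last 2 first.
- exact: (measurableT_comp mKchi mphi).
- by move=> x; exact: Kchi0.
rewrite [RHS]integral_mkcond; apply: eq_integral => x _.
rewrite /= patchE indicE; case: ifP => xD; last by rewrite mule0.
by rewrite phiE ?psiK ?mule1//; exact/set_mem.
Qed.

End change_of_variables1.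

(** * Change of variables in several coordinates *)

Section change_of_variables.
Context {R : realType}.
Local Notation lam := (@lebesgue_rV R).
Local Notation mu := (@lebesgue_measure R).

Lemma ge0_integral_cons n (f : 'rV[R]_n.+1 -> \bar R) : measurable_fun setT f ->
  (forall x, 0 <= f x)%E ->
  (\int[lam n.+1]_x f x = \int[mu]_a \int[lam n]_v f (cons_rV (a, v)))%E.
Proof.
move=> mf f0.
rewrite [LHS](ge0_integral_pushforward (@measurable_cons_rV R n) (mu \x lam n)%E (D := setT) (f := f))//.
rewrite preimage_setT fubini_tonelli1//; last by move=> p; exact: f0.
exact: (measurableT_comp mf (@measurable_cons_rV R n)).
Qed.

Lemma measurable_fun_cons_section n (f : 'rV[R]_n.+1 -> \bar R) a :
  measurable_fun setT f -> measurable_fun setT (fun v => f (cons_rV (a, v))).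
Proof.
move=> mf; apply: (measurableT_comp mf).
exact: (measurableT_comp (@measurable_cons_rV R n) (measurable_pair1 a)).
Qed.

Definition open_box n (a b : R) : set 'rV[R]_n := [set x | forall i, x ord0 i \in `]a, b[].

Arguments open_box n a b : clear implicits.

Definition rV_map n (chi : 'I_n -> R -> R) (y : 'rV[R]_n) : 'rV[R]_n :=
  \row_i chi i (y ord0 i).

Lemma measurable_rV_map n (chi : 'I_n -> R -> R) :
  (forall i, measurable_fun setT (chi i : measurableTypeR R -> measurableTypeR R)) ->
  measurable_fun setT (rV_map chi).
Proof.
move=> mchi; apply/measurable_fun_rVP => i; under eq_fun do rewrite mxE.
exact: (measurableT_comp (mchi i) (measurable_rV_coord i)).
Qed.

Lemma measurable_prod_rV n (rho : 'I_n -> R -> R) :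
  (forall i, measurable_fun setT (rho i : measurableTypeR R -> measurableTypeR R)) ->
  measurable_fun setT (fun y : 'rV[R]_n => \prod_i rho i (y ord0 i)).
Proof.
move=> mrho; apply: measurable_prod => i _.
exact: (measurableT_comp (mrho i) (measurable_rV_coord i)).
Qed.

Lemma measurable_open_box n (a b : R) : measurable (open_box n a b).
Proof.
apply: (@measurable_box _ _ (fun=> `]a, b[%classic)) => i; exact: measurable_itv.
Qed.

Arguments measurable_open_box n a b : clear implicits.

(** Induction on the number of coordinates by Tonelli: the induction hypothesis substitutes in the
    tail for a fixed first coordinate, then the one-dimensional formula is applied to the resulting
    function of that coordinate. *)
Lemma ge0_integral_rV_map n (chi rho : 'I_n -> R -> R) (a b : R) (G : 'rV[R]_n -> \bar R) :
  (forall i, measurable_fun setT (chi i : measurableTypeR R -> measurableTypeR R)) ->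
  (forall i, measurable_fun setT (rho i : measurableTypeR R -> measurableTypeR R)) ->
  (forall i y, 0 <= rho i y) ->
  (forall i (K : R -> \bar R), measurable_fun setT K -> (forall x, 0 <= K x)%E ->
    (\int[mu]_y (K (chi i y) * (rho i y)%:E) = \int[mu]_(x in `]a, b[) K x)%E) ->
  measurable_fun setT G -> (forall x, 0 <= G x)%E ->
  (\int[lam n]_y (G (rV_map chi y) * (\prod_i rho i (y ord0 i))%:E) =
   \int[lam n]_(x in open_box n a b) G x)%E.
Proof.
elim: n chi rho G => [|n IH] chi rho G mchi mrho rho0 cov mG G0.
  rewrite integral_dirac//; last first.
    apply: emeasurable_funM.
      by apply: (measurableT_comp mG); exact: measurable_rV_map.
    by apply/measurable_EFinP; exact: measurable_prod_rV.
  rewrite big_ord0 mule1 integral_dirac//; last 2 first.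
  - exact: measurable_open_box.
  - exact: measurable_funTS.
  rewrite !diracE !mem_set//; last by case.
  by congr (_ * G _)%E; apply/rowP; case.
pose chi' i := chi (lift ord0 i); pose rho' i := rho (lift ord0 i).
have mGmap : measurable_fun setT (fun y => (G (rV_map chi y) * (\prod_i rho i (y ord0 i))%:E)%E).
  apply: emeasurable_funM.
    by apply: (measurableT_comp mG); exact: measurable_rV_map.
  by apply/measurable_EFinP; exact: measurable_prod_rV.
have prod0 m (r : 'I_m -> R -> R) (y : 'rV[R]_m) : (forall i y, 0 <= r i y) -> (0 <= (\prod_i r i (y ord0 i))%:E)%E.
  by move=> r0; rewrite lee_fin; apply: prodr_ge0.
rewrite ge0_integral_cons//; last by move=> x; rewrite mule_ge0// prod0.
have mGr : measurable_fun setT (G \_ (open_box n.+1 a b)).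
  apply/(measurable_restrictT _ (measurable_open_box n.+1 a b)).
  exact: measurable_funTS.
have Gr0 x : (0 <= (G \_ (open_box n.+1 a b)) x)%E by rewrite erestrict_ge0.
rewrite [RHS]integral_mkcond ge0_integral_cons//.
have consE s v : rV_map chi (cons_rV (s, v)) = cons_rV (chi ord0 s, rV_map chi' v).
  apply/rowP => i; rewrite !mxE; case: unliftP => [j ->|->] //; by rewrite mxE.
(* The tail integral after substitution, as a function of the first coordinate already expressed in
   the new variable. *)
pose K t := (\int[lam n]_(x in open_box n a b) G (cons_rV (t, x)))%E.
transitivity (\int[mu]_s (K (chi ord0 s) * (rho ord0 s)%:E))%E.
  apply: eq_integral => s _.
  transitivity (\int[lam n]_v ((rho ord0 s)%:E * (G (cons_rV (chi ord0 s, rV_map chi' v)) * (\prod_i rho' i (v ord0 i))%:E)))%E.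
    apply: eq_integral => v _; rewrite consE big_ord_recl EFinM muleCA.
    rewrite mxE unlift_none; congr (_ * (_ * _%:E))%E.
    by apply: eq_bigr => i _; rewrite mxE liftK.
  rewrite ge0_integralZl//; last 3 first.
  - apply: emeasurable_funM.
      apply: (measurableT_comp (measurable_fun_cons_section _ mG)).
      by apply: measurable_rV_map => i; exact: mchi.
    by apply/measurable_EFinP; apply: measurable_prod_rV => i; exact: mrho.
  - by move=> v _; rewrite mule_ge0// prod0// => i y; exact: rho0.
  - by rewrite lee_fin.
  rewrite muleC /K -(IH chi' rho')//.
  - by move=> i; exact: mchi.
  - by move=> i; exact: mrho.
  - by move=> i y; exact: rho0.
  - by move=> i; exact: cov.
  - exact: measurable_fun_cons_section.
have mK : measurable_fun setT K.
  rewrite /K; under eq_fun do rewrite integral_mkcond.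
  pose H (p : measurableTypeR R * 'rV[R]_n) := ((fun x => G (cons_rV (p.1, x))) \_ (open_box n a b)) p.2.
  apply: (@measurable_fun_fubini_tonelli_F _ _ _ _ _ _ H).
    pose E := [set: measurableTypeR R] `*` open_box n a b.
    have mE : measurable E by apply: measurableX => //; exact: measurable_open_box.
    rewrite (_ : H = (G \o @cons_rV R n) \_ E); last first.
      apply/funext => -[s v]; rewrite /H /= !patchE; congr (if _ then _ else _).
      by apply/idP/idP; rewrite !inE => //= -[].
    apply/(measurable_restrictT _ mE); apply: measurable_funTS.
    exact: (measurableT_comp mG (@measurable_cons_rV R n)).
  by move=> p; rewrite /H erestrict_ge0.
rewrite cov//; last by move=> t; apply: integral_ge0.
rewrite integral_mkcond; apply: eq_integral => s _.
rewrite patchE; case: ifPn => [sab|sab].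
  rewrite /K integral_mkcond; apply: eq_integral => v _; rewrite !patchE.
  congr (if _ then _ else _); apply/idP/idP; rewrite !inE => H.
    move=> i; rewrite mxE; case: unliftP => [j _|_]; first exact: H.
    by move: sab; rewrite inE.
  by move=> i; have := H (lift ord0 i); rewrite mxE liftK.
rewrite integral0_eq// => v _; rewrite patchE ifN//.
apply: contra sab; rewrite !inE => /(_ ord0).
by rewrite mxE unlift_none.
Qed.

End change_of_variables.
Arguments open_box {R} n a b.
Arguments measurable_open_box {R} n a b.

(** * Square-integrable functions and integrals along segments *)

Section square_integrable.
Context {R : realType} {n : nat}.
Local Notation lam := (@lebesgue_rV R n).
Local Notation mu := (@lebesgue_measure R).
Implicit Types (u v : 'rV[R]_n -> R).

Definition sq_integrable u := measurable_fun setT u /\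
  lam.-integrable setT (fun y => (u y ^+ 2)%:E).

Lemma normM_le_sqr (a b : R) : `|a * b| <= a ^+ 2 + b ^+ 2.
Proof.
rewrite normrM -(real_normK (num_real a)) -(real_normK (num_real b)).
have xy := mulr_ge0 (normr_ge0 a) (normr_ge0 b).
have := sqr_ge0 (`|a| - `|b|); rewrite sqrrB -mulr_natr; lra.
Qed.

Lemma sq_integrable_le u v : measurable_fun setT u -> sq_integrable v ->
  (forall y, `|u y| <= `|v y|) -> sq_integrable u.
Proof.
move=> mu [mv iv] uv; split => //; apply: le_integrable iv => //.
  by apply/measurable_EFinP; exact: measurable_funX.
move=> y _; rewrite !abse_EFin lee_fin !normrX.
by rewrite ler_pXn2r ?nnegrE.
Qed.

Lemma sq_integrableM u v : sq_integrable u -> sq_integrable v ->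
  lam.-integrable setT (fun y => (u y * v y)%:E).
Proof.
move=> [mu iu] [mv iv].
apply: (le_integrable _ _ _ (integrableD measurableT iu iv)) => //.
  by apply/measurable_EFinP; exact: measurable_funM.
move=> y _ /=; rewrite lee_fin [leRHS]ger0_norm ?normM_le_sqr//.
by rewrite addr_ge0// sqr_ge0.
Qed.

Lemma sq_integrableD u v : sq_integrable u -> sq_integrable v ->
  sq_integrable (fun y => u y + v y).
Proof.
move=> [mu iu] [mv iv]; split; first exact: measurable_funD.
have i2 := integrableD measurableT (integrableD measurableT iu iv) (integrableD measurableT iu iv).
apply: (le_integrable _ _ _ i2) => //.
  by apply/measurable_EFinP; apply: measurable_funX; exact: measurable_funD.
move=> y _ /=; rewrite lee_fin ger0_norm ?sqr_ge0// ger0_norm; last first.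
  by rewrite !addr_ge0// sqr_ge0.
have := sqr_ge0 (u y - v y); nra.
Qed.

Lemma sq_integrable_shift u w : sq_integrable u -> sq_integrable (fun y => u (y + w)).
Proof.
move=> [mu iu]; split; first exact: (measurableT_comp mu (measurable_shift w)).
exact: (integrable_shift w iu).
Qed.

Lemma Rdominated_convergence (f_ : nat -> 'rV[R]_n -> R) (f g : 'rV[R]_n -> R) :
  (forall k, measurable_fun setT (f_ k)) -> measurable_fun setT f ->
  (forall y, f_ k y @[k --> \oo] --> f y) ->
  lam.-integrable setT (EFin \o g) -> (forall k y, `|f_ k y| <= g y) ->
  lam.-integrable setT (EFin \o f) /\
  \int[lam]_y f_ k y @[k --> \oo] --> \int[lam]_y f y.
Proof.
move=> mf_ mf ff ig fg.
have [|||||] := @dominated_convergence _ _ _ lam setT measurableT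
  (fun k => EFin \o f_ k) (EFin \o f) (EFin \o g).
- by move=> k; exact/measurable_EFinP.
- exact/measurable_EFinP.
- by apply: aeW => y _; apply: cvg_EFin; [exact: nearW|exact: ff].
- by [].
- by apply: aeW => y k _; rewrite /= lee_fin.
move=> i_f _ cf; split => //; apply: fine_cvg.
by rewrite [X in _ --> X]fineK//; exact: integrable_fin_num.
Qed.

Definition seg_int (w : 'rV[R]_n) (t : R) v (y : 'rV[R]_n) : R :=
  \int[mu]_(s in `[0, t]) v (y + s *: w).

Lemma measurable_line (w : 'rV[R]_n) :
  measurable_fun setT (fun p : 'rV[R]_n * measurableTypeR R => p.1 + p.2 *: w).
Proof.
apply/measurable_fun_rVP => i; under eq_fun do rewrite !mxE.
apply: measurable_funD; first exact: (measurableT_comp (measurable_rV_coord i) measurable_fst).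
by apply: measurable_funM => //; exact: measurable_snd.
Qed.

(** Neither function need be integrable by itself. Fubini applies because |ab| <= a^2 + b^2 bounds
    each slice at fixed [s] by the sum of the two squared norms, which by translation invariance
    does not depend on [s], and [s] ranges over a set of finite measure. *)
Lemma seg_int_Fubini (w : 'rV[R]_n) (t : R) v psi : 0 <= t ->
  sq_integrable v -> sq_integrable psi ->
  [/\ measurable_fun setT (seg_int w t v),
     lam.-integrable setT (fun y => (seg_int w t v y * psi y)%:E) &
     \int[lam]_y (seg_int w t v y * psi y) =
     \int[mu]_(s in `[0, t]) \int[lam]_y (v (y + s *: w) * psi y)].
Proof.
move=> t0 hv hpsi; have [mv iv] := hv; have [mpsi ipsi] := hpsi.
pose D : set (measurableTypeR R) := `[0, t]%classic.
have mD : measurable D by exact: measurable_itv.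
have muD : (mu D < +oo)%E.
  by rewrite /D lebesgue_measure_itv/=; case: ifP => _; rewrite ?ltry// -EFinB ltry.
have mvl : measurable_fun setT (fun p : 'rV[R]_n * measurableTypeR R => v (p.1 + p.2 *: w)).
  exact: (measurableT_comp mv (measurable_line w)).
have mvD : measurable_fun setT (fun p : 'rV[R]_n * measurableTypeR R => v (p.1 + p.2 *: w) * \1_D p.2).
  apply: measurable_funM => //; apply: (measurableT_comp _ measurable_snd) => //.
have mseg : measurable_fun setT (seg_int w t v).
  rewrite (_ : seg_int w t v = fine \o (fun y =>
     \int[mu]_s ((fun p : 'rV[R]_n * measurableTypeR R => (v (p.1 + p.2 *: w) * \1_D p.2)%:E)^\+ (y, s)) -
     \int[mu]_s ((fun p : 'rV[R]_n * measurableTypeR R => (v (p.1 + p.2 *: w) * \1_D p.2)%:E)^\- (y, s)))%E); last first.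
    apply/funext => y; rewrite /seg_int /Rintegral /=; congr fine.
    have E s : ((fun s => (v (y + s *: w))%:E) \_ `[0, t]) s = (v (y + s *: w) * \1_D s)%:E.
      by rewrite patchE indicE -/D; case: (s \in D); rewrite ?mulr1 ?mulr0.
    rewrite integral_mkcond; under eq_integral do rewrite E.
    rewrite integralE.
    by congr (_ - _)%E; apply: eq_integral => s _; rewrite ?funeposE ?funenegE.
  have mE : measurable_fun setT (fun p : 'rV[R]_n * measurableTypeR R => (v (p.1 + p.2 *: w) * \1_D p.2)%:E).
    exact/measurable_EFinP.
  apply: (measurableT_comp (fine_measurable measurableT)).
  apply: emeasurable_funB.
    exact: (@measurable_fun_fubini_tonelli_F _ _ _ _ _ mu _ (measurable_funepos mE) (funepos_ge0 _)).
  exact: (@measurable_fun_fubini_tonelli_F _ _ _ _ _ mu _ (measurable_funeneg mE) (funeneg_ge0 _)).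
pose H (p : 'rV[R]_n * measurableTypeR R) : \bar R := (v (p.1 + p.2 *: w) * \1_D p.2 * psi p.1)%:E.
have mH : measurable_fun setT H.
  apply/measurable_EFinP; apply: measurable_funM => //.
  exact: (measurableT_comp mpsi measurable_fst).
have iH : (lam \x mu)%E.-integrable setT H.
  apply/integrable21ltyP => //.
  pose C := (\int[lam]_y (v y ^+ 2)%:E + \int[lam]_y (psi y ^+ 2)%:E)%E.
  have C0 : (0 <= C)%E by rewrite adde_ge0// integral_ge0// => y _; rewrite lee_fin sqr_ge0.
  have Coo : (C < +oo)%E.
    apply: lte_add_pinfty.
      by move/integrableP: iv => [_]; under eq_integral do rewrite abse_EFin ger0_norm ?sqr_ge0//.
    by move/integrableP: ipsi => [_]; under eq_integral do rewrite abse_EFin ger0_norm ?sqr_ge0//.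
  apply: (@le_lt_trans _ _ (\int[mu]_s (C * (\1_D s)%:E))%E); last first.
    rewrite ge0_integralZl//; last exact/measurable_EFinP.
    rewrite integral_indic// setIT.
    by apply: lte_mul_pinfty => //; rewrite ge0_fin_numE.
  apply: ge0_le_integral => //.
  - by move=> s _; exact: integral_ge0.
  - have mabs : measurable_fun setT (abse \o H) by exact: measurableT_comp.
    exact: (@measurable_fun_fubini_tonelli_G _ _ _ _ _ lam (abse \o H) mabs (fun p => abse_ge0 _)).
  - by apply: emeasurable_funM => //; exact/measurable_EFinP.
  - move=> s _; rewrite /H/= indicE; case: (s \in D) => /=; last first.
      by rewrite mule0; under eq_integral do rewrite mulr0 mul0r normr0; rewrite integral0.
    pose sw : 'rV[R]_n := (s : R) *: w.
    rewrite mule1 /C -(@integral_shift _ _ sw (fun y => (v y ^+ 2)%:E)); last first.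
      exact: measurable_int iv.
    have mvs : measurable_fun setT (fun y : 'rV[R]_n => (v (y + sw) ^+ 2)%:E).
      have := measurable_int _ (integrable_shift sw iv); exact.
    rewrite -ge0_integralD//; last 3 first.
    + by move=> y _; rewrite lee_fin sqr_ge0.
    + by move=> y _; rewrite lee_fin sqr_ge0.
    + exact: measurable_int ipsi.
    apply: ge0_le_integral => //.
    + by apply/measurable_EFinP; apply: measurableT_comp => //; apply: measurable_funM => //;
         apply: measurable_funM => //; apply: (measurableT_comp mv (measurable_shift _)).
    + by apply: emeasurable_funD => //; exact: measurable_int ipsi.
    + by move=> y _; rewrite -EFinD lee_fin mulr1 normM_le_sqr.
have HE : ae_eq lam setT (fun y => (seg_int w t v y * psi y)%:E) (fubini_F mu H).
  have := ae_integrable1 iH; apply: filterS => y iHy _.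
  rewrite /fubini_F /seg_int /H/=.
  (* Where [psi y] is 0, integrability of the slice of [H] says nothing about [v] along the segment,
     but both sides are 0. Elsewhere dividing by [psi y] recovers the integrability of [v] on the
     segment. *)
  have [psi0|psi0] := eqVneq (psi y) 0.
    by rewrite psi0 mulr0; under eq_integral do rewrite mulr0; rewrite integral0.
  have iv1 : mu.-integrable D (fun s => (v (y + s *: w))%:E).
    apply/(integrable_mkcond _ mD).
    apply: eq_integrable (integrableZr measurableT (psi y)^-1 iHy) => // s _.
    rewrite /H/= patchE indicE -EFinM mulfK//.
    by case: (s \in D); rewrite ?mulr1 ?mulr0.
  transitivity (\int[mu]_(s in D) (v (y + s *: w) * psi y)%:E)%E.
    rewrite /Rintegral EFinM fineK; last exact: integrable_fin_num.
    by rewrite -integralZr.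
  rewrite integral_mkcond; apply: eq_integral => s _.
  by rewrite patchE indicE; case: (s \in D); rewrite ?mulr1 ?mulr0 ?mul0r.
have iF := integrable_fubini_F iH.
have mF := measurable_int _ iF.
have mseg' : measurable_fun setT (fun y => (seg_int w t v y * psi y)%:E).
  by apply/measurable_EFinP; exact: measurable_funM.
have iseg : lam.-integrable setT (fun y => (seg_int w t v y * psi y)%:E).
  apply/integrableP; split => //.
  rewrite (ae_eq_integral (fun y => `|fubini_F mu H y|)%E)//.
  - by case/integrableP : iF.
  - exact: measurableT_comp.
  - exact: measurableT_comp.
  - by apply: filterS HE => y Hy _; rewrite Hy.
split => //.
rewrite /Rintegral; congr fine.
rewrite (ae_eq_integral (fubini_F mu H))// integral12_prod_meas1// -integral21_prod_meas1//.
rewrite [RHS]integral_mkcond; apply: eq_integral => s _; rewrite /fubini_G /H/= patchE indicE -/D.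
case: (s \in D) => /=; last first.
  by under eq_integral do rewrite mulr0 mul0r; rewrite integral0.
rewrite fineK; first by under eq_integral do rewrite mulr1.
apply: integrable_fin_num => //.
exact: (sq_integrableM (sq_integrable_shift _ hv) hpsi).
Qed.

End square_integrable.

(** * Smooth bump functions *)

Section derive_rules.
Context {R : realType}.
Implicit Types (f g : R -> R) (x : R).

Lemma is_derive1M f g x a b : is_derive x 1 f a -> is_derive x 1 g b ->
  is_derive x 1 (fun t => f t * g t) (a * g x + f x * b).
Proof.
move=> fa gb; apply: (@is_derive_eq _ _ _ (f * g)); rewrite /GRing.scale/=.
by rewrite addrC [g x * a]mulrC.
Qed.

Lemma is_derive1D f g x a b : is_derive x 1 f a -> is_derive x 1 g b ->
  is_derive x 1 (fun t => f t + g t) (a + b).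
Proof. by move=> fa gb; exact: is_deriveD. Qed.

Lemma is_derive1_affine f x a k c : is_derive (k * x + c) 1 f a ->
  is_derive x 1 (fun t => f (k * t + c)) (a * k).
Proof.
move=> fa; apply: (@is_derive1_comp _ f (fun t => k * t + c) x a k fa).
have h1 : is_derive x 1 (fun t => k * t) k.
  apply: is_derive_eq (is_derive1M (is_derive_cst k x 1) (is_derive_id x 1)) _.
  by rewrite mul0r add0r mulr1.
apply: is_derive_eq (is_derive1D h1 (is_derive_cst c x 1)) _.
by rewrite addr0.
Qed.

Lemma is_derive1P f x : derivable f x 1 <-> is_derive x 1 f (derive1 f x).
Proof.
split=> [df|[]//]; rewrite derive1E; exact: DeriveDef.
Qed.

Lemma is_derive1E f x a : is_derive x 1 f a -> derive1 f x = a.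
Proof. by move=> fa; rewrite derive1E; exact: derive_val. Qed.

Lemma is_derive1_continuous f x a : is_derive x 1 f a -> {for x, continuous f}.
Proof. by case=> df _; apply: differentiable_continuous; exact/derivable1_diffP. Qed.

(** Serves at the gluing point 0 of [exp_inv], where no differentiation rule applies. *)
Lemma is_derive0_sqr f C : (forall h, `|f h| <= C * h ^+ 2) -> is_derive (0 : R) 1 f 0.
Proof.
move=> fC; have f0 : f 0 = 0.
  by apply/eqP; rewrite -normr_le0; apply: le_trans (fC 0) _; rewrite expr0n mulr0.
suff H : h^-1 *: (f (h *: 1 + 0) - f 0) @[h --> 0^'] --> (0 : R).
  apply: DeriveDef; first by apply/cvg_ex; exists 0.
  exact/cvg_lim.
apply/cvgr0Pnorm_le => e e0; rewrite near_withinE.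
have C1 : 0 < `|C| + 1 by rewrite ltr_wpDl.
near=> h => h0.
rewrite f0 subr0 addr0 [h *: 1]mulr1 [_ *: _]mulrC normrM normfV.
have h0' : 0 < `|h| by rewrite normr_gt0.
rewrite ler_pdivrMr//; apply: le_trans (fC h) _.
rewrite -(real_normK (num_real h)) expr2 mulrA ler_wpM2r//.
apply: (@le_trans _ _ ((`|C| + 1) * `|h|)).
  by rewrite ler_wpM2r// (le_trans (ler_norm C))// lerDl.
rewrite mulrC -ler_pdivlMr//.
near: h; apply/nbhs_ballP; exists (e / (`|C| + 1)); first by rewrite /= divr_gt0.
by move=> y; rewrite /ball/= sub0r normrN => /ltW.
Unshelve. all: end_near. Qed.

End derive_rules.

Section smooth1.
Context {R : realType}.
Implicit Types (f g : R -> R).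

Inductive smooth1 f : Prop :=
  Smooth1 of forall n (x : R), derivable (derive1n n f) x 1.

(** Coinduction principle: smoothness follows by exhibiting a class of functions closed under
    differentiation, without any formula for the higher derivatives. *)
Lemma smooth1_coind (C : set (R -> R)) :
  (forall f, C f -> (forall x, derivable f x 1) /\ C (derive1 f)) ->
  forall f, C f -> smooth1 f.
Proof.
move=> HC f Cf; split=> n; elim: n f Cf => [|n IH] f Cf x; first exact: (HC f Cf).1.
by rewrite derive1Sn; apply: IH; exact: (HC f Cf).2.
Qed.

Lemma smooth1_derive f : smooth1 f -> smooth1 (derive1 f).
Proof. by case=> sf; split=> n x; rewrite -derive1Sn. Qed.

Lemma smooth1_is_derive f (x : R) : smooth1 f -> is_derive x 1 f (derive1 f x).
Proof. by case=> /(_ 0%N x); rewrite derive1n0 => /is_derive1P. Qed.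

Lemma smooth1_continuous f : smooth1 f -> continuous f.
Proof. by move=> sf x; exact: is_derive1_continuous (smooth1_is_derive x sf). Qed.

Lemma smooth1_antiderivative f g : smooth1 g -> (forall x : R, is_derive x 1 f (g x)) -> smooth1 f.
Proof.
move=> [sg] dfg; split=> -[|n] x; first by case: (dfg x).
rewrite derive1Sn (_ : derive1 f = g); first exact: sg.
by apply/funext => y; exact: is_derive1E.
Qed.

Lemma smooth1M f g : smooth1 f -> smooth1 g -> smooth1 (fun x => f x * g x).
Proof.
move=> sf sg.
(* Products alone are not closed under differentiation; finite sums of products of smooth functions
   are, by the product rule. *)
pose C := [set F : R -> R | exists s : seq ((R -> R) * (R -> R)),
  (forall p, List.In p s -> smooth1 p.1 /\ smooth1 p.2) /\
  F = fun x => \sum_(p <- s) p.1 x * p.2 x].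
apply: (@smooth1_coind C); last first.
  exists [:: (f, g)]; split=> [p [<-//|[]]|].
  by apply/funext => x; rewrite big_seq1.
move=> _ [s [hs ->]].
pose ds := flatten [seq [:: (derive1 p.1, p.2); (p.1, derive1 p.2)] | p <- s].
have H (x : R) : is_derive x 1 (fun x => \sum_(p <- s) p.1 x * p.2 x)
    (\sum_(p <- ds) p.1 x * p.2 x).
  rewrite /ds; elim: s hs {ds} => [|p s IH] hs /=.
    by under eq_fun do rewrite big_nil; rewrite big_nil; exact: is_derive_cst.
  under eq_fun do rewrite big_cons.
  rewrite !big_cons /= addrA; apply: is_derive1D; last first.
    by apply: IH => q qs; apply: hs; right.
  have [s1 s2] := hs p (or_introl erefl).
  by apply: is_derive1M; exact: smooth1_is_derive.
split=> [x|]; first by case: (H x).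
exists ds; split; last by apply/funext => x; exact: is_derive1E.
rewrite /ds; elim: s hs {H ds} => [|p s IH] hs //= q.
have [s1 s2] := hs p (or_introl erefl).
case=> [<-|[<-|]]/=.
- by split=> //; exact: smooth1_derive.
- by split=> //; exact: smooth1_derive.
- by apply: IH => r rs; apply: hs; right.
Qed.

Lemma smooth1_affine f k c : smooth1 f -> smooth1 (fun t => f (k * t + c)).
Proof.
move=> sf.
pose C := [set F : R -> R | exists g a, smooth1 g /\ F = fun t => a * g (k * t + c)].
apply: (@smooth1_coind C); last first.
  by exists f, 1; split => //; apply/funext => x; rewrite mul1r.
move=> _ [g [a [sg ->]]].
have H (x : R) : is_derive x 1 (fun t => a * g (k * t + c)) (a * k * derive1 g (k * x + c)).
  have h := is_derive1M (is_derive_cst a x 1) (is_derive1_affine (smooth1_is_derive (k * x + c) sg)).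
  by apply: is_derive_eq h _; rewrite mul0r add0r /cst; ring.
split=> [x|]; first by case: (H x).
exists (derive1 g), (a * k); split; first exact: smooth1_derive.
by apply/funext => x; exact: is_derive1E.
Qed.

End smooth1.

Section bump.
Context {R : realType}.
Implicit Types (p : {poly R}).

(** Each monomial satisfies s^k <= k! exp(s), since its quotient by k! is one term of the
    exponential series. *)
Lemma poly_expRN_bounded p : exists2 C, 0 <= C &
  forall s, 0 < s -> `|p.[s]| * expR (- s) <= C.
Proof.
exists (\sum_(i < size p) `|p`_i| * (i`!)%:R).
  by apply: sumr_ge0 => i _; rewrite mulr_ge0.
move=> s s0; rewrite expRN ler_pdivrMr ?expR_gt0// horner_coef.
apply: le_trans (ler_norm_sum _ _ _) _; rewrite mulr_suml; apply: ler_sum => i _.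
rewrite normrM -mulrA ler_wpM2l// normrX gtr0_norm//.
case: (nat_of_ord i) => [|k].
  by rewrite expr0 fact0 mul1r -[leLHS]expR0 ler_expR ltW.
rewrite mulrC -ler_pdivrMr ?ltr0n ?fact_gt0//.
by apply: le_trans (expR_ge1Dxn k (ltW s0)); rewrite lerDr.
Qed.

Definition exp_inv p (t : R) : R := if 0 < t then p.[t^-1] * expR (- t^-1) else 0.

Lemma is_derive_exp_inv p (t : R) :
  is_derive t 1 (exp_inv p) (exp_inv ('X^2 * (p - p^`())) t).
Proof.
have [t0|t0|->] := ltgtP t 0.
- rewrite [X in is_derive _ _ _ X]/exp_inv lt_gtF//.
  apply: near_eq_is_derive (is_derive_cst 0 t 1).
  near=> y; rewrite /exp_inv ifN// -leNgt ltW//.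
  by near: y; apply: open_nbhs_nbhs; split => //; exact: open_lt.
- have hV : is_derive t 1 (fun t => t^-1) (- t ^- 2).
    apply: is_derive_eq (@is_deriveV _ id t 1 1 _ (is_derive_id _ _)) _; first by rewrite gt_eqF.
    by rewrite /GRing.scale/= mulr1.
  have hN : is_derive t 1 (fun t => - t^-1) (t ^- 2).
    by apply: is_derive_eq (is_deriveN hV) _; rewrite opprK.
  have hp := is_derive1_comp (is_derive_poly p t^-1) hV.
  have he := @is_derive1_comp _ expR (fun t => - t^-1) t _ _ (is_derive_expR (- t^-1)) hN.
  have := is_derive1M hp he.
  rewrite [X in _ -> is_derive _ _ _ X]/exp_inv t0 => h.
  apply: near_eq_is_derive (is_derive_eq h _).
    near=> y; rewrite /exp_inv ifT//=.
    by near: y; apply: open_nbhs_nbhs; split => //; exact: open_gt.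
  rewrite /= hornerM hornerXn hornerD hornerN exprVn.
  by ring.
- rewrite [X in is_derive _ _ _ X]/exp_inv ltxx.
  (* With s = 1/h, boundedness of s^2 p(s) exp(-s) says that [exp_inv p h] is O(h^2), so the
     derivative at 0 is 0. *)
  have [C C0 HC] := poly_expRN_bounded ('X^2 * p).
  apply: (@is_derive0_sqr _ _ C) => h; rewrite /exp_inv; case: ifPn => [h0|_]; last first.
    by rewrite normr0 mulr_ge0// sqr_ge0.
  have := HC _ (_ : 0 < h^-1); rewrite invr_gt0 => /(_ h0).
  rewrite hornerM hornerXn normrM -mulrA normrX ger0_norm ?invr_ge0 ?(ltW h0)//.
  rewrite exprVn mulrC ler_pdivrMr ?exprn_gt0//.
  by rewrite normrM (ger0_norm (expR_ge0 _)).
Unshelve. all: end_near. Qed.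

Lemma smooth1_exp_inv p : smooth1 (exp_inv p).
Proof.
apply: (@smooth1_coind _ [set exp_inv p | p in setT]); last by exists p.
move=> _ [q _ <-]; split=> [x|]; first by case: (is_derive_exp_inv q x).
exists ('X^2 * (q - q^`())) => //.
by apply/funext => x; apply/esym/is_derive1E/is_derive_exp_inv.
Qed.

(** The two factors are [exp_inv 1] at (n+1)(t-p) and at (n+1)(q-t). As [n] grows they tend to the
    indicators of t > p and t < q. The arguments are spelled as affine functions of [t] to suit
    [smooth1_affine]. *)
Definition bump (p q : R) (n : nat) (t : R) : R :=
  exp_inv 1 (n.+1%:R * t + - (n.+1%:R * p)) * exp_inv 1 (- n.+1%:R * t + n.+1%:R * q).

Lemma exp_inv1_le1 (t : R) : 0 <= exp_inv 1 t <= 1.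
Proof.
rewrite /exp_inv; case: ifPn => [t0|_]; last by rewrite lexx ler01.
rewrite hornerC mul1r expR_ge0 -[leRHS]expR0 ler_expR.
by rewrite oppr_le0 invr_ge0 ltW.
Qed.

Lemma smooth1_bump (p q : R) n : smooth1 (bump p q n).
Proof. by apply: smooth1M; apply: smooth1_affine; exact: smooth1_exp_inv. Qed.

Lemma bump_ge0 (p q : R) n t : 0 <= bump p q n t.
Proof.
by apply: mulr_ge0; [have /andP[] := exp_inv1_le1 (n.+1%:R * t + - (n.+1%:R * p))|
  have /andP[] := exp_inv1_le1 (- n.+1%:R * t + n.+1%:R * q)].
Qed.

Lemma bump_le_indic (p q : R) n t : bump p q n t <= \1_(`]p, q[%classic) t.
Proof.
rewrite indicE; case: (boolP (t \in _)) => [|tpq].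
  move=> _; apply: mulr_ile1.
  - by have /andP[] := exp_inv1_le1 (n.+1%:R * t + - (n.+1%:R * p)).
  - by have /andP[] := exp_inv1_le1 (- n.+1%:R * t + n.+1%:R * q).
  - by have /andP[] := exp_inv1_le1 (n.+1%:R * t + - (n.+1%:R * p)).
  - by have /andP[] := exp_inv1_le1 (- n.+1%:R * t + n.+1%:R * q).
move: tpq; rewrite notin_setE/= in_itv/= => /negP; rewrite negb_and -!leNgt.
have n0 : 0 < n.+1%:R :> R by [].
case/orP => h.
  rewrite /bump {1}/exp_inv ifN ?mul0r// -leNgt.
  by rewrite -mulrN -mulrDr pmulr_rle0// subr_le0.
rewrite /bump {2}/exp_inv ifN ?mulr0// -leNgt.
by rewrite mulNr addrC -mulrN -mulrDr pmulr_rle0// subr_le0.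
Qed.

Lemma cvg_exp_inv (t : R) :
  exp_inv 1 (n.+1%:R * t) @[n --> \oo] --> ((0 < t)%R%:R : R).
Proof.
have [t0|t0] := ltP 0 t; last first.
  apply: cvg_near_cst; apply: nearW => n.
  by rewrite /exp_inv ifN// -leNgt pmulr_rle0.
rewrite (_ : (fun n => _) = expR \o (fun n : nat => - (harmonic n * t^-1 : R))); last first.
  apply/funext => n /=; rewrite /exp_inv pmulr_rgt0// t0 hornerC mul1r.
  by rewrite invfM.
have -> : true%:R = expR (- (0 * t^-1)) :> R by rewrite mul0r oppr0 expR0.
have h : - (harmonic n * t^-1 : R) @[n --> \oo] --> - (0 * t^-1).
  by apply: cvgN; apply: cvgMl; exact: cvg_harmonic.
exact: (cvg_comp _ _ h (@continuous_expR R _)).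
Qed.

Lemma cvg_bump (p q t : R) : bump p q n t @[n --> \oo] --> (\1_(`]p, q[%classic) t : R).
Proof.
have -> : \1_(`]p, q[%classic) t = (0 < t - p)%R%:R * (0 < q - t)%R%:R :> R.
  rewrite !subr_gt0 indicE -natrM mulnb; congr (nat_of_bool _)%:R.
  by apply/idP/idP; rewrite inE/= in_itv.
rewrite (_ : (fun n => _) = (fun n => exp_inv 1 (n.+1%:R * (t - p)) * exp_inv 1 (n.+1%:R * (q - t)))).
  by apply: cvgM; exact: cvg_exp_inv.
by apply/funext => n; rewrite /bump !mulrBr mulNr [- _ + _]addrC.
Qed.

End bump.

(** * Functions whose integrals over all boxes vanish *)

Section ae_zero.
Context {R : realType} {n : nat}.
Local Notation lam := (@lebesgue_rV R n).

Definition obox (p q : 'I_n -> R) : set 'rV[R]_n :=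
  [set x | forall i, `]p i, q i[%classic (x ord0 i)].

Lemma measurable_obox p q : measurable (obox p q).
Proof. by apply: (@measurable_box _ _ (fun i => `]p i, q i[%classic)) => i; exact: measurable_itv. Qed.

(** Inside a fixed cube, Dynkin induction extends the vanishing of the integral from boxes to all
    measurable sets, which forces [g] to vanish almost everywhere there; countably many cubes cover
    the space. *)
Lemma ae_eq0_obox (g : 'rV[R]_n -> R) : measurable_fun setT g ->
  (forall p q, lam.-integrable (obox p q) (EFin \o g)) ->
  (forall p q, \int[lam]_(y in obox p q) (g y)%:E = 0)%E ->
  {ae lam, forall y, g y = 0}.
Proof.
move=> mg ig g0.
pose D (N : nat) := obox (fun=> - N%:R) (fun=> N%:R).
have mD N : measurable (D N) by exact: measurable_obox.
have HD N : forall E, measurable E -> (\int[lam]_(y in D N `&` E) (g y)%:E = 0)%E.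
  (* Open half-lines generate the Borel sets, and cut by a side of the cube they are again open
     intervals, so the hypothesis on open boxes applies. *)
  pose H := [set A : set (measurableTypeR R) | A = setT \/ exists p, A = `]p, +oo[%classic].
  have HI : setI_closed H.
    move=> A B [->|[p ->]]; first by rewrite setTI.
    move=> [->|[q ->]]; first by rewrite setIT; right; exists p.
    right; exists (Num.max p q); apply/seteqP; split=> t /=; rewrite !in_itv/= !andbT gt_max.
      by move=> [-> ->].
    by move=> /andP[].
  have mH : measurable = <<s H >>.
    apply/seteqP; split.
      rewrite [X in X `<=` _](RGenOInfty.measurableE R).
      apply: smallest_sub; first exact: smallest_sigma_algebra.
      by move=> _ [p ->]; apply: sub_sigma_algebra; right; exists p.
    apply: smallest_sub; first exact: sigma_algebra_measurable.
    by move=> _ [->|[p ->]]; [exact: measurableT | exact: measurable_itv].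
  have mbH : @measurable _ 'rV[R]_n = <<s boxes n H >>.
    by apply: measurable_rV_boxes => //; left.
  move=> E mE; rewrite mbH in mE.
  apply: (@dynkin_induction _ 'rV[R]_n (boxes n H) (fun E => (\int[lam]_(y in D N `&` E) (g y)%:E = 0)%E)) => //.
  - exact: setI_closed_boxes.
  - by rewrite setIT; exact: g0.
  - move=> _ [A [HA ->]].
    have /choice[a Ha] : forall i, exists a : R, `]- N%:R, N%:R[%classic `&` A i = `]a, N%:R[%classic.
      move=> i; case: (HA i) => [->|[p ->]]; first by exists (- N%:R); rewrite setIT.
      exists (Num.max (- N%:R) p); apply/seteqP; split=> t /=; rewrite !in_itv/= gt_max ?andbT.
        by move=> [/andP[-> ->] ->].
      by move=> /andP[/andP[-> ->] ->].
    rewrite (_ : _ `&` _ = obox a (fun=> N%:R)); first exact: g0.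
    apply/seteqP; split=> x.
      by move=> [Dx Ax] i; rewrite -Ha; split; [exact: Dx|exact: Ax].
    move=> ax; have h i : (`]- N%:R, N%:R[%classic `&` A i) (x ord0 i) by rewrite Ha; exact: ax.
    by split=> i; case: (h i).
  - move=> S mS S0; have iD := ig (fun=> - N%:R) (fun=> N%:R).
    have := g0 (fun=> - N%:R) (fun=> N%:R).
    rewrite -/(D N) -{1}(setIT (D N)) -(setUv S) setIUr.
    rewrite integral_setU//.
    + by rewrite S0 add0e.
    + exact: measurableI.
    + by apply: measurableI => //; exact: measurableC.
    + exact/measurable_EFinP/measurable_funTS.
    + by apply/disj_setPS => x [[_ Sx] [_]].
  - move=> F mF tF F0; rewrite setI_bigcupr integral_bigcup//.
    + by apply: eseries0 => k _ _; exact: F0.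
    + exact: trivIset_setIl.
    + by move=> k; exact: measurableI.
    + apply: (integrableS (measurable_obox _ _) _ _ (ig (fun=> - N%:R) (fun=> N%:R))).
        by apply: bigcup_measurable => k _; exact: measurableI.
      by rewrite -setI_bigcupr; exact: subIsetl.
have aeN N : ae_eq lam (D N) (EFin \o g) (cst 0%E).
  apply: integral_ae_eq => //; first exact: ig.
  move=> E ED mE; rewrite integral0 -(HD N E mE); congr (integral _ _ _).
  by rewrite setIidr.
have : {ae lam, forall y, forall N, D N y -> (g y)%:E = 0%E} by apply: ae_foralln.
apply: filterS => y Hy.
suff [N DN] : exists N, D N y by have := Hy N DN => -[].
exists (\sum_i (Num.truncn `|y ord0 i|).+1)%N => i /=.
rewrite in_itv/= -ltr_norml; apply: lt_le_trans (truncnS_gt _) _.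
by rewrite ler_nat (bigD1 i)//= leq_addr.
Qed.

End ae_zero.

(** * Sliding-window integrals of test functions *)

Section translation_window.
Context {R : realType}.
Local Notation mu := (@lebesgue_measure R).

Lemma integrable_continuous_itv (f : R -> R) (a b : R) : continuous f ->
  mu.-integrable `[a, b] (EFin \o f).
Proof.
move=> cf; apply: continuous_compact_integrable; first exact: segment_compact.
exact: continuous_subspaceT.
Qed.

Lemma antiderivative (f : R -> R) (M : R) : continuous f ->
  (forall t, M <= `|t| -> f t = 0) -> exists F, forall x : R, is_derive x 1 F (f x).
Proof.
move=> cf fM.
have iT : mu.-integrable setT (EFin \o f).
  have mM : measurable (`[- M, M]%classic : set (measurableTypeR R)) by exact: measurable_itv.
  have iM : mu.-integrable setT ((EFin \o f) \_ `[- M, M]).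
    by apply/(integrable_mkcond _ mM); exact: integrable_continuous_itv.
  apply: eq_integrable iM => // x _; rewrite /= patchE; case: ifPn => //.
  rewrite notin_setE/= in_itv/= -ler_norml => /negP; rewrite -ltNge => /ltW h.
  by rewrite fM.
exists (fun x => \int[mu]_(t in `]-oo, x]) f t) => x.
have [||||dF EF] := @continuous_FTC1 R f -oo%O x (x + 1).
- by rewrite ltrDl.
- by apply: integrableS iT => //; exact: measurable_itv.
- by rewrite ltNyr.
- exact: cf.
- by apply: DeriveDef dF _; rewrite -derive1E.
Qed.

Lemma smooth1_window (f : R -> R) (M tau : R) : 0 <= tau -> smooth1 f ->
  (forall t, M <= `|t| -> f t = 0) ->
  exists h, [/\ smooth1 h, forall t, M + tau <= `|t| -> h t = 0,
    forall t, derive1 h t = f t - f (t - tau) &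
    forall t, h t = \int[mu]_(s in `[0, tau]) f (t - s)].
Proof.
move=> tau0 sf fM; have cf := smooth1_continuous sf.
have [F dF] := antiderivative cf fM.
(* The window integral as the difference of an antiderivative and its translate; the coefficients
   [- 1] and [1] fit the product and affine rules. The integral form, proved next as [hE], gives the
   support. *)
pose h t := F t + - 1 * F (1 * t - tau).
have dh (t : R) : is_derive t 1 h (f t - f (t - tau)).
  have h1 := is_derive1M (is_derive_cst (- 1 : R) t 1) (is_derive1_affine (dF (1 * t - tau))).
  apply: is_derive_eq (is_derive1D (dF t) h1) _.
  by rewrite mul0r add0r mulr1 /cst mulN1r mul1r.
have hE t : h t = \int[mu]_(s in `[0, tau]) f (t - s).
  have [E0|tn0] := eqVneq tau 0.
    by rewrite /h E0 set_itv1 Rintegral_set1 mul1r subr0 mulN1r subrr.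
  have tau0' : 0 < tau by rewrite lt_neqAle eq_sym tn0.
  have dG (s : R) : is_derive s 1 (fun s => - 1 * F (- 1 * s + t)) (f (t - s)).
    have h1 := is_derive1M (is_derive_cst (- 1 : R) s 1) (is_derive1_affine (dF (- 1 * s + t))).
    by apply: is_derive_eq h1 _; rewrite mul0r add0r /cst; rewrite mulN1r addrC; ring.
  rewrite /Rintegral (@continuous_FTC2 _ (fun s => f (t - s)) (fun s => - 1 * F (- 1 * s + t)))//.
  - rewrite -EFinB /= /h; rewrite mulr0 add0r !mulN1r opprK addrC mul1r.
    by rewrite [- tau + t]addrC.
  - apply: continuous_subspaceT => s.
    apply: (continuous_comp (f := fun s => t - s) (g := f)); last exact: cf.
    by apply: cvgB; [exact: cvg_cst|exact: cvg_id].
  - split=> [s _||]; first by case: (dG s).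
      by apply: cvg_at_right_filter; exact: is_derive1_continuous (dG _).
    by apply: cvg_at_left_filter; exact: is_derive1_continuous (dG _).
  - by move=> s _; exact: is_derive1E.
exists h; split => //.
- apply: smooth1_antiderivative dh.
  have -> : (fun t => f t - f (t - tau)) = (fun t => f t - f (1 * t + - tau)).
    by apply/funext => t; rewrite mul1r.
  pose C := [set g : R -> R | exists a b, [/\ smooth1 a, smooth1 b & g = fun t => a t - b t]].
  apply: (@smooth1_coind _ C).
    move=> _ [a [b [sa sb ->]]].
    have H (x : R) : is_derive x 1 (fun t => a t - b t) (derive1 a x - derive1 b x).
      by apply: is_deriveB; exact: smooth1_is_derive.
    split=> [x|]; first by case: (H x).
    exists (derive1 a), (derive1 b); split; [exact: smooth1_derive..|].
    by apply/funext => x; exact: is_derive1E.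
  by exists f, (fun t => f (1 * t + - tau)); split => //; exact: smooth1_affine.
- move=> t Mt; rewrite hE /Rintegral integral0_eq// => s; rewrite /= in_itv/= => /andP[s0 st].
  congr EFin; apply: fM; have := ler_normD (t - s) s; rewrite subrK [`|s|]ger0_norm// => h1.
  by rewrite -(lerD2r tau); apply: le_trans Mt _; apply: le_trans h1 _; rewrite lerD2l.
- by move=> t; exact: is_derive1E.
Qed.

End translation_window.

(** * Testing weak derivatives against general functions *)

Section weak.
Context {R : realType} {n : nat}.
Local Notation lam := (@lebesgue_rV R n).
Local Notation mu := (@lebesgue_measure R).
Implicit Types (u v psi : 'rV[R]_n -> R).

Definition prod_fun (al : 'I_n -> R -> R) (y : 'rV[R]_n) : R :=
  \prod_l al l (y ord0 l).

Definition upd (i : 'I_n) (f : R -> R) (al : 'I_n -> R -> R) : 'I_n -> R -> R :=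
  fun l => if l == i then f else al l.

(* Product test functions suffice, and for them mixed partial derivatives commute
   without appeal to the Schwarz theorem. *)
Definition weak_partial (i : 'I_n) u v := forall al : 'I_n -> R -> R,
  (forall l, smooth1 (al l)) -> (exists M : R, forall l t, M <= `|t| -> al l t = 0) ->
  \int[lam]_y (u y * prod_fun (upd i (derive1 (al i)) al) y) =
  - \int[lam]_y (v y * prod_fun al y).

Local Notation e i := (delta_mx ord0 i : 'rV[R]_n).

Lemma shiftE i (y : 'rV[R]_n) (s : R) l :
  (y + s *: e i) ord0 l = y ord0 l + s * (l == i)%:R.
Proof. by rewrite !mxE. Qed.

Lemma prod_fun_upd i f al y :
  prod_fun (upd i f al) y = f (y ord0 i) * \prod_(l | l != i) al l (y ord0 l).
Proof.
rewrite /prod_fun (bigD1 i)//= /upd eqxx; congr (_ * _).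
by apply: eq_bigr => l /negbTE ->.
Qed.

Lemma prod_fun_D1 i al y :
  prod_fun al y = al i (y ord0 i) * \prod_(l | l != i) al l (y ord0 l).
Proof. by rewrite /prod_fun (bigD1 i). Qed.

Lemma prod_fun_shift i al y (s : R) : prod_fun al (y + s *: e i) =
  al i (y ord0 i + s) * \prod_(l | l != i) al l (y ord0 l).
Proof.
rewrite (prod_fun_D1 i) shiftE eqxx mulr1; congr (_ * _).
by apply: eq_bigr => l /negbTE li; rewrite shiftE li mulr0 addr0.
Qed.

Lemma measurable_prod_fun al : (forall l, continuous (al l)) ->
  measurable_fun setT (prod_fun al).
Proof.
move=> cal; apply: measurable_prod => l _.
apply: (measurableT_comp _ (measurable_rV_coord l)).
exact: continuous_measurable_fun.
Qed.

Lemma cvg_bigprod (T : Type) (r : seq T) (f : nat -> T -> R) (l : T -> R) :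
  (forall x, f k x @[k --> \oo] --> l x) ->
  \prod_(x <- r) f k x @[k --> \oo] --> \prod_(x <- r) l x.
Proof.
move=> fl; elim: r => [|x r IH].
  by under eq_fun do rewrite big_nil; rewrite big_nil; exact: cvg_cst.
by under eq_fun do rewrite big_cons; rewrite big_cons; exact: cvgM.
Qed.

Lemma sq_integrable_indic (A : set 'rV[R]_n) : measurable A -> (lam A < +oo)%E ->
  sq_integrable (\1_A : 'rV[R]_n -> R).
Proof.
move=> mA Aoo; split; first exact: measurable_indic.
rewrite (_ : (fun y => _) = EFin \o \1_A); last first.
  by apply/funext => y; rewrite /= indicE; case: (y \in A); rewrite ?expr1n ?expr0n.
apply/integrableP; split; first exact/measurable_EFinP/measurable_indic.
under eq_integral do rewrite /= ger0_norm//.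
by rewrite integral_indic// setIT.
Qed.

Lemma obox_lty p q : (lam (@obox R n p q) < +oo)%E.
Proof.
apply: (@lebesgue_rV_fin_box R n (fun i => `]p i, q i[%classic)) => i.
  exact: measurable_itv.
by rewrite lebesgue_measure_itv/=; case: ifP => _; rewrite ?ltry// -EFinB ltry.
Qed.

Definition shift_defect i u v (t : R) (y : 'rV[R]_n) : R :=
  u y - u (y + t *: e i) + seg_int (e i) t v y.

(** By translation invariance all translations pass from [u] and [v] to [psi], with the direction
    reversed; [psi] can then be built from test functions. *)
Lemma integral_shift_defect i u v t psi : 0 <= t ->
  sq_integrable u -> sq_integrable v -> sq_integrable psi ->
  [/\ measurable_fun setT (shift_defect i u v t),
    lam.-integrable setT (fun y => (shift_defect i u v t y * psi y)%:E) &
    \int[lam]_y (shift_defect i u v t y * psi y) =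
    \int[lam]_y (u y * (psi y - psi (y - t *: e i))) +
    \int[lam]_y (seg_int (- e i) t psi y * v y)].
Proof.
move=> t0 hu hv hpsi.
have [ms iseg segE] := seg_int_Fubini (e i) t0 hv hpsi.
have [_ _ segE'] := seg_int_Fubini (- e i) t0 hpsi hv.
have iu := sq_integrableM hu hpsi.
have ius := sq_integrableM (sq_integrable_shift (t *: e i) hu) hpsi.
have ius' := sq_integrableM hu (sq_integrable_shift (- (t *: e i)) hpsi).
have mdef : measurable_fun setT (shift_defect i u v t).
  apply: measurable_funD => //; apply: measurable_funB; first by case: hu.
  by case: (sq_integrable_shift (t *: e i) hu).
have E y : shift_defect i u v t y * psi y =
    u y * psi y - u (y + t *: e i) * psi y + seg_int (e i) t v y * psi y.
  by rewrite /shift_defect; ring.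
have iB : lam.-integrable setT (EFin \o (fun y => u y * psi y - u (y + t *: e i) * psi y)).
  exact: (integrableB measurableT iu ius).
split => //.
  under eq_fun do rewrite E.
  exact: (integrableD measurableT iB iseg).
under eq_Rintegral do rewrite E.
rewrite RintegralD// RintegralB//; congr (_ + _).
  have -> : \int[lam]_y (u (y + t *: e i) * psi y) = \int[lam]_y (u y * psi (y - t *: e i)).
    rewrite /Rintegral; congr fine.
    rewrite -(@integral_shift _ _ (t *: e i) (fun y => (u y * psi (y - t *: e i))%:E)).
      by apply: eq_integral => y _; rewrite addrK.
    exact: measurable_int ius'.
  rewrite -RintegralB//; apply: eq_Rintegral => y _; by rewrite mulrBr.
rewrite segE segE'; apply: eq_Rintegral => s _.
rewrite /Rintegral; congr fine.
pose w : 'rV[R]_n := s *: e i.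
rewrite -(@integral_shift _ _ w (fun y => (psi (y + s *: - e i) * v y)%:E)).
  by apply: eq_integral => y _; rewrite scalerN addrK mulrC.
exact: measurable_int (sq_integrableM (sq_integrable_shift _ hpsi) hv).
Qed.

(* The difference of a bump and its translate is the derivative of a compactly
   supported smooth function, and bumps converge to the indicators of boxes. *)
Lemma weak_shift_defect i u v t : 0 <= t -> sq_integrable u -> sq_integrable v ->
  weak_partial i u v -> {ae lam, forall y, shift_defect i u v t y = 0}.
Proof.
move=> t0 hu hv huv.
have sq1 p q := sq_integrable_indic (measurable_obox p q) (obox_lty p q).
have [mdef _ _] := integral_shift_defect i t0 hu hv (sq1 (fun=> 0) (fun=> 0)).
have i1 p q : lam.-integrable setT (fun y => (shift_defect i u v t y * \1_(obox p q) y)%:E).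
  by have [] := integral_shift_defect i t0 hu hv (sq1 p q).
have E p q y : (shift_defect i u v t y * \1_(obox p q) y)%:E =
    ((EFin \o shift_defect i u v t) \_ (obox p q)) y.
  by rewrite patchE indicE; case: (y \in _); rewrite ?mulr1 ?mulr0.
apply: ae_eq0_obox => // p q.
  apply/(integrable_mkcond _ (measurable_obox p q)).
  by apply: eq_integrable (i1 p q) => // y _; rewrite E.
rewrite integral_mkcond.
rewrite -(eq_integral _ _ (fun y _ => E p q y)).
pose be k l : R -> R := bump (p l) (q l) k.
pose Psi k := prod_fun (be k).
have Psi01 k y : 0 <= Psi k y <= \1_(obox p q) y.
  rewrite /Psi /prod_fun; apply/andP; split.
    by apply: prodr_ge0 => l _; exact: bump_ge0.
  rewrite indicE; case: (boolP (y \in _)) => ybox.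
    rewrite -[leRHS](@big1_eq _ 1 *%R _ (index_enum 'I_n) xpredT).
    apply: ler_prod => l _; rewrite bump_ge0/=; apply: le_trans (bump_le_indic _ _ _ _) _.
    by rewrite indicE; case: (_ \in _).
  move: ybox; rewrite notin_setE => /existsNP[l yl].
  rewrite (bigD1 l)//=; have := bump_le_indic (p l) (q l) k (y ord0 l).
  rewrite indicE memNset// => b0; have := bump_ge0 (p l) (q l) k (y ord0 l) => b1.
  by rewrite (_ : be k l (y ord0 l) = 0) ?mul0r//; apply/eqP; rewrite eq_le b0.
have hPsi k : sq_integrable (Psi k).
  apply: sq_integrable_le (sq1 p q) _.
    by apply: measurable_prod_fun => l; apply: smooth1_continuous; exact: smooth1_bump.
  move=> y; have /andP[h0 h1] := Psi01 k y.
  by rewrite ger0_norm// (le_trans h1)// ler_norm.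
have cvg_Psi y : Psi k y @[k --> \oo] --> (\1_(obox p q) y : R).
  have -> : \1_(obox p q) y = \prod_l \1_(`]p l, q l[%classic) (y ord0 l) :> R.
    rewrite indicE; case: (boolP (y \in _)) => ybox.
      rewrite big1// => l _; rewrite indicE mem_set//.
      by move: ybox; rewrite inE; exact.
    move: ybox; rewrite notin_setE => /existsNP[l yl].
    by rewrite (bigD1 l)//= indicE memNset// mul0r.
  by apply: cvg_bigprod => l; exact: cvg_bump.
have Hdom k y : `|shift_defect i u v t y * Psi k y| <= `|shift_defect i u v t y * \1_(obox p q) y|.
  have /andP[h0 h1] := Psi01 k y.
  by rewrite !normrM ler_wpM2l// ger0_norm// ger0_norm// (le_trans h0).
have Psi0 k : \int[lam]_y (shift_defect i u v t y * Psi k y) = 0.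
  have [_ _ ->] := integral_shift_defect i t0 hu hv (hPsi k).
  (* The sum dominates every end point, so one radius bounds the supports of the bumps in all
     coordinates. *)
  pose M := \sum_l (`|p l| + `|q l|).
  have beM l s : M <= `|s| -> be k l s = 0.
    move=> Ms; have := bump_le_indic (p l) (q l) k s.
    have := bump_ge0 (p l) (q l) k s; rewrite -/(be k l s) => b0 b1.
    apply/eqP; rewrite eq_le b0 andbT; apply: le_trans b1 _.
    rewrite indicE memNset// /= in_itv/= => /andP[ps sq].
    have : `|p l| + `|q l| <= M.
      by rewrite /M (bigD1 l)//= lerDl sumr_ge0// => j _; rewrite addr_ge0.
    move=> /le_trans/(_ Ms); apply/negP; rewrite -ltNge.
    have [s0|s0] := leP 0 s.
      by rewrite (ger0_norm s0) (lt_le_trans sq)// (le_trans (ler_norm _))// lerDr.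
    rewrite (ltr0_norm s0); have : - s < - p l by rewrite ltrN2.
    by move=> /lt_le_trans; apply; rewrite (le_trans (ler_norm _))// normrN lerDl.
  have [h [sh hM dh hE]] := smooth1_window t0 (smooth1_bump (p i) (q i) k) (beM i).
  (* With the window [h] in coordinate [i], the two integrals of [integral_shift_defect] become the
     two sides of [weak_partial] for this product and cancel. *)
  pose al := upd i h (be k).
  have HT := huv al.
  have -> : \int[lam]_y (u y * (Psi k y - Psi k (y - t *: e i))) =
            \int[lam]_y (u y * prod_fun (upd i (derive1 (al i)) al) y).
    apply: eq_Rintegral => y _; congr (_ * _).
    rewrite /Psi -scaleNr prod_fun_shift (prod_fun_D1 i) prod_fun_upd -mulrBl.
    rewrite {1}/al /upd eqxx dh; congr (_ * _).
    by apply: eq_bigr => l /negbTE; rewrite /al /upd => ->.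
  rewrite HT.
  - have -> : \int[lam]_y (v y * prod_fun al y) = \int[lam]_y (seg_int (- e i) t (Psi k) y * v y).
      apply: eq_Rintegral => y _; rewrite mulrC; congr (_ * _).
      rewrite /seg_int /Psi prod_fun_upd hE -RintegralZr//; last first.
        apply: integrable_continuous_itv => s.
        apply: (continuous_comp (f := fun s => y ord0 i - s) (g := be k i)).
          by apply: cvgB; [exact: cvg_cst|exact: cvg_id].
        by apply: smooth1_continuous; exact: smooth1_bump.
      by apply: eq_Rintegral => s _; rewrite scalerN -scaleNr prod_fun_shift.
    by rewrite addNr.
  - by move=> l; rewrite /al /upd; case: ifP => // _; exact: smooth1_bump.
  - exists (M + t) => l s Ms; rewrite /al /upd; case: ifP => _; first exact: hM.
    by apply: beM; apply: le_trans Ms; rewrite lerDl.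
have [|||||_ cv] := @Rdominated_convergence R n (fun k y => shift_defect i u v t y * Psi k y)
  (fun y => shift_defect i u v t y * \1_(obox p q) y)
  (fun y => `|shift_defect i u v t y * \1_(obox p q) y|).
- by move=> k; apply: measurable_funM => //; case: (hPsi k).
- by apply: measurable_funM => //; case: (sq1 p q).
- by move=> y; apply: cvgMr; exact: cvg_Psi.
- exact: (integrable_abse (i1 p q)).
- exact: Hdom.
have : (fun k : nat => \int[lam]_y (shift_defect i u v t y * Psi k y)) @ \oo --> (0 : R).
  by under eq_fun do rewrite Psi0; exact: cvg_cst.
move=> /(cvg_unique _ cv) E0; rewrite -[LHS]fineK; last exact: integrable_fin_num.
by congr EFin; exact: E0.
Qed.

Lemma Rintegral_near_cst (f : R -> R) (c t B : R) : 0 <= t ->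
  measurable_fun setT (f : measurableTypeR R -> R) ->
  (forall s, 0 <= s <= t -> `|f s - c| <= B) ->
  `|\int[mu]_(s in `[0, t]) f s - t * c| <= t * B.
Proof.
move=> t0 mf fB.
have mu0t : mu `[0, t]%classic = t%:E.
  rewrite lebesgue_measure_itv/= lte_fin; have [t1|t1] := ltP 0 t; first by rewrite -EFinB subr0.
  by congr EFin; apply/eqP; rewrite eq_le t0.
have mI : measurable (`[0, t]%classic : set (measurableTypeR R)) by exact: measurable_itv.
have icst r : mu.-integrable `[0, t] (fun=> r%:E).
  apply/integrableP; split; first exact: measurable_cst.
  by rewrite integral_cst//= mu0t ltry.
have iD : mu.-integrable `[0, t] (EFin \o (fun s => f s - c)).
  apply: le_integrable (icst B) => //.
    by apply/measurable_EFinP; apply: measurable_funTS; apply: measurable_funB.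
  by move=> s /=; rewrite in_itv/= => /fB h; rewrite lee_fin (le_trans h)// ler_norm.
have i_f : mu.-integrable `[0, t] (EFin \o f).
  apply: eq_integrable (integrableD mI iD (icst c)) => // s _ /=.
  by rewrite -EFinD subrK.
have Rc (r : R) : t * r = \int[mu]_(s in `[0, t]) r.
  by rewrite Rintegral_cst// mulrC; congr (_ * _); rewrite [X in fine X](_ : _ = t%:E).
rewrite (Rc c).
rewrite -(RintegralB mI i_f (icst c)); apply: le_trans (le_normr_Rintegral mI iD) _.
rewrite (Rc B).
apply: (le_Rintegral mI (integrable_abse iD) (icst B)).
by move=> s /=; rewrite in_itv; exact: fB.
Qed.

(* Integrate the null function [shift_defect] against [psi], divide by [t] and let
   [t] tend to 0. *)
Lemma weak_partial_dominated i u v psi psi' (G : 'rV[R]_n -> R) :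
  sq_integrable u -> sq_integrable v -> weak_partial i u v ->
  sq_integrable psi -> sq_integrable G -> measurable_fun setT psi' ->
  (forall y s, 0 <= s <= 1 -> `|psi (y - s *: e i) - psi y| <= s * G y) ->
  (forall y, k.+1%:R * (psi y - psi (y - k.+1%:R^-1 *: e i)) @[k --> \oo] --> psi' y) ->
  \int[lam]_y (u y * psi' y) = - \int[lam]_y (v y * psi y).
Proof.
move=> hu hv huv hpsi hG mpsi' psiG dpsi.
have t0 k : 0 <= k.+1%:R^-1 :> R by [].
have t1 k : k.+1%:R^-1 <= 1 :> R by rewrite invf_le1 ?ler1n.
have kK k : k.+1%:R * k.+1%:R^-1 = 1 :> R by rewrite divff.
have G0 y : 0 <= G y by have := psiG y 1; rewrite ler01 lexx mul1r => /(_ isT); exact: le_trans.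
(* Step length t = 1/(k+1). The sequence [a] tends to the left side, and [b], built from averages of
   [psi] over a short backward segment, to the integral on the right. *)
pose a k := \int[lam]_y (u y * (k.+1%:R * (psi y - psi (y - k.+1%:R^-1 *: e i)))).
pose b k := \int[lam]_y (v y * (k.+1%:R * seg_int (- e i) k.+1%:R^-1 psi y)).
have mseg k : measurable_fun setT (seg_int (- e i) k.+1%:R^-1 psi).
  by have [] := seg_int_Fubini (- e i) (t0 k) hpsi hv.
have hshift w := sq_integrable_shift w hpsi.
have mdiff k : measurable_fun setT (fun y => psi y - psi (y - k.+1%:R^-1 *: e i)).
  apply: measurable_funB; first by case: hpsi.
  by case: (hshift (- (k.+1%:R^-1 *: e i))).
have ab k : a k = - b k.
  have hdef := weak_shift_defect (t0 k) hu hv huv.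
  have [mdef idef Edef] := integral_shift_defect i (t0 k) hu hv hpsi.
  have : \int[lam]_y (shift_defect i u v k.+1%:R^-1 y * psi y) = 0.
    rewrite /Rintegral (ae_eq_integral (cst 0%E))//.
    - by rewrite integral0.
    - by apply: measurable_int idef.
    - by apply: filterS hdef => y Hy _; rewrite Hy mul0r.
  rewrite Edef => /eqP; rewrite addr_eq0 => /eqP E0.
  have -> : a k = k.+1%:R * \int[lam]_y (u y * (psi y - psi (y - k.+1%:R^-1 *: e i))).
    rewrite -RintegralZl//.
      by apply: eq_Rintegral => y _; rewrite mulrCA.
    have hd : sq_integrable (fun y => psi y + - 1 * psi (y - k.+1%:R^-1 *: e i)).
      apply: sq_integrableD => //.
      apply: sq_integrable_le (hshift (- (k.+1%:R^-1 *: e i))) _.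
        by apply: measurable_funM => //; case: (hshift (- (k.+1%:R^-1 *: e i))).
      by move=> y; rewrite mulN1r normrN.
    apply: eq_integrable (sq_integrableM hu hd) => // y _ /=.
    by rewrite mulN1r.
  rewrite E0 mulrN; congr (- _); rewrite -RintegralZl//.
    by apply: eq_Rintegral => y _; rewrite mulrA mulrC.
  by have [] := seg_int_Fubini (- e i) (t0 k) hpsi hv.
have ca : a k @[k --> \oo] --> \int[lam]_y (u y * psi' y).
  have [|||||//] := @Rdominated_convergence R n
    (fun k y => u y * (k.+1%:R * (psi y - psi (y - k.+1%:R^-1 *: e i))))
    (fun y => u y * psi' y) (fun y => `|u y * G y|).
  - by move=> k; apply: measurable_funM; [case: hu|exact: measurable_funM].
  - by apply: measurable_funM => //; case: hu.
  - by move=> y; apply: cvgMr; exact: dpsi.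
  - exact: (integrable_abse (sq_integrableM hu hG)).
  - move=> k y; rewrite !normrM ler_wpM2l// normr_nat distrC (ger0_norm (G0 y)).
    have H : `|psi (y - k.+1%:R^-1 *: e i) - psi y| <= k.+1%:R^-1 * G y.
      by apply: psiG; rewrite t0 t1.
    apply: le_trans (ler_wpM2l (ler0n _ _) H) _.
    by rewrite mulrA kK mul1r.
have segB k y : `|k.+1%:R * seg_int (- e i) k.+1%:R^-1 psi y - psi y| <= k.+1%:R^-1 * G y.
  have := @Rintegral_near_cst (fun s => psi (y + s *: - e i)) (psi y) k.+1%:R^-1
     (k.+1%:R^-1 * G y) (t0 k).
  have ml : measurable_fun setT (fun s : measurableTypeR R => psi (y + s *: - e i)).
    have mpsi : measurable_fun setT psi by case: hpsi.
    apply: (measurableT_comp mpsi).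
    apply: (measurableT_comp (measurable_line (- e i))) (measurable_pair1 y).
  move=> /(_ ml); rewrite -/(seg_int _ _ _ y) => H.
  have {}H : `|seg_int (- e i) k.+1%:R^-1 psi y - k.+1%:R^-1 * psi y| <=
      k.+1%:R^-1 * (k.+1%:R^-1 * G y).
    apply: H => s /andP[s0 st]; rewrite scalerN.
    apply: le_trans (psiG y s _) _; first by rewrite s0 (le_trans st).
    by rewrite ler_wpM2r.
  have -> : k.+1%:R * seg_int (- e i) k.+1%:R^-1 psi y - psi y =
      k.+1%:R * (seg_int (- e i) k.+1%:R^-1 psi y - k.+1%:R^-1 * psi y).
    by rewrite mulrBr mulrA kK mul1r.
  rewrite normrM normr_nat.
  apply: le_trans (ler_wpM2l (ler0n _ _) H) _.
  by rewrite [leLHS]mulrA kK mul1r.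
have cb : b k @[k --> \oo] --> \int[lam]_y (v y * psi y).
  have hGpsi : sq_integrable (fun y => `|psi y| + G y).
    apply: sq_integrableD => //; apply: (sq_integrable_le _ hpsi).
      by apply: measurableT_comp => //; exact: hpsi.1.
    by move=> y; rewrite normr_id.
  have [|||||//] := @Rdominated_convergence R n
    (fun k y => v y * (k.+1%:R * seg_int (- e i) k.+1%:R^-1 psi y))
    (fun y => v y * psi y) (fun y => `|v y * (`|psi y| + G y)|).
  - by move=> k; apply: measurable_funM; [case: hv|exact: measurable_funM].
  - by apply: measurable_funM; [case: hv|case: hpsi].
  - move=> y; apply: cvgMr; apply/cvgrPdist_le => eps eps0.
    have := @cvg_harmonic R => /cvgrPdist_le/(_ (eps / (G y + 1)))[].
      by rewrite divr_gt0// ltr_wpDl.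
    move=> N _ HN; exists N => // k Nk /=; rewrite distrC.
    apply: le_trans (segB k y) _.
    have := HN k Nk; rewrite /= sub0r normrN ger0_norm// => h.
    apply: (@le_trans _ _ (k.+1%:R^-1 * (G y + 1))).
      by rewrite ler_wpM2l// lerDl.
    by rewrite -ler_pdivlMr// ltr_wpDl.
  - exact: (integrable_abse (sq_integrableM hv hGpsi)).
  - move=> k y; rewrite [leLHS]normrM [leRHS]normrM ler_wpM2l//.
    rewrite [leRHS]ger0_norm ?addr_ge0// addrC -lerBlDr.
    apply: le_trans (lerB_dist _ _) _.
    apply: le_trans (segB k y) _.
    by rewrite ler_piMl.
apply: (cvg_unique _ ca) => //.
by rewrite (_ : a = fun k => - b k); [exact: cvgN|exact/funext].
Qed.

End weak.

Section derive_lines.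
Context {R : realType}.

(** Backward quotients, since moving a translation of [u] onto the weight shifts the weight by
    -t. *)
Lemma cvg_derive_backward (f : R -> R) l : is_derive (0 : R) 1 f l ->
  k.+1%:R * (f 0 - f (- k.+1%:R^-1)) @[k --> \oo] --> l.
Proof.
move=> [df dfl].
have H : h^-1 *: (f (h *: 1 + 0) - f 0) @[h --> 0^'] --> l by rewrite -dfl.
have hN : - (k.+1%:R^-1 : R) @[k --> \oo] --> (0 : R)^'.
  move=> A [e /= e0 HA].
  have [N _ HN] : \forall k \near \oo, `|k.+1%:R^-1 : R| < e.
    have := @cvg_harmonic R => /cvgr0Pnorm_lt/(_ e e0); exact.
  exists N => // k Nk /=; apply: HA => /=.
    by rewrite sub0r opprK; exact: HN.
  by rewrite oppr_eq0 invr_eq0.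
have := cvg_comp _ _ hN H; apply: cvg_trans; apply: near_eq_cvg.
apply: nearW => k /=.
rewrite addr0 [_ *: 1]mulr1 invrN invrK scaleNr -scalerN opprB.
by [].
Qed.

Lemma derive1_support (f : R -> R) (M t : R) : (forall x, M <= `|x| -> f x = 0) ->
  M < `|t| -> is_derive t 1 f 0.
Proof.
move=> fM Mt; apply: near_eq_is_derive (is_derive_cst 0 t 1).
near=> x; rewrite fM// ltW//; near: x.
by apply: (cvgr_gt _ (@norm_continuous _ _ t)).
Unshelve. all: end_near. Qed.

Lemma derive1_support_bounded (f : R -> R) (M : R) : 0 <= M -> smooth1 f ->
  (forall x, M <= `|x| -> f x = 0) -> exists2 K, 0 <= K & forall x, `|derive1 f x| <= K.
Proof.
move=> M0 sf fM; have cf := smooth1_continuous (smooth1_derive sf).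
have [||c _ Hc] := @EVT_max _ (fun x => `|derive1 f x|) (- M) M.
- by rewrite ge0_cp.
- apply: continuous_subspaceT => x.
  exact: (continuous_comp (cf x) (@norm_continuous _ _ _)).
exists `|derive1 f c| => // x; have [xM|xM] := leP `|x| M.
  by apply: Hc; rewrite in_itv/= -ler_norml.
by rewrite (is_derive1E (derive1_support fM xM)) normr0.
Qed.

End derive_lines.

(** * Integration by parts without compact support *)

Section weak_extend.
Context {R : realType} {n : nat}.
Local Notation lam := (@lebesgue_rV R n).
Local Notation e i := (delta_mx ord0 i : 'rV[R]_n).

(* As the bound [B] does not depend on [y_i], a cutoff in the variable [y_i] alone
   reduces this to [weak_partial_dominated]. *)
Lemma weak_partial_extend i (u v Phi Phi' B : 'rV[R]_n -> R) :
  sq_integrable u -> sq_integrable v -> weak_partial i u v ->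
  sq_integrable Phi -> sq_integrable Phi' ->
  (forall y, is_derive (0 : R) 1 (fun t => Phi (y + t *: e i)) (Phi' y)) ->
  (forall y (t : R), B (y + t *: e i) = B y) ->
  (forall y, `|Phi y| <= B y) -> (forall y, `|Phi' y| <= B y) ->
  (forall N : R, sq_integrable (fun y => B y * \1_(`[- N, N]%classic) (y ord0 i))) ->
  \int[lam]_y (u y * Phi' y) = - \int[lam]_y (v y * Phi y).
Proof.
move=> hu hv huv hPhi hPhi' dPhi Be PhiB Phi'B hB.
have B0 y : 0 <= B y by apply: le_trans (PhiB y).
(* Cutoff profile, not normalized: the rescaled cutoffs tend to [ka 0], which is only known to be
   positive and is cancelled at the end. *)
pose ka : R -> R := bump (- 1) 1 0.
have ska : smooth1 ka by exact: smooth1_bump.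
have ka01 t : 0 <= ka t <= 1.
  rewrite bump_ge0/=; apply: le_trans (bump_le_indic _ _ _ _) _.
  by rewrite indicE; case: (_ \in _).
have kaS t : 1 <= `|t| -> ka t = 0.
  move=> t1; apply/eqP; rewrite eq_le bump_ge0 andbT.
  apply: le_trans (bump_le_indic _ _ _ _) _.
  by rewrite indicE memNset// /= in_itv/= -ltr_norml; apply/negP; rewrite -leNgt.
have ka0 : 0 < ka 0.
  rewrite /ka /bump !mulr0 !add0r mulrN !mulr1 opprK /exp_inv ltr01 hornerC.
  by rewrite mulr_gt0// mul1r expR_gt0.
have [K K0 HK] := derive1_support_bounded ler01 ska kaS.
pose k (N : nat) : R := N.+1%:R^-1.
have k0 N : 0 < k N by rewrite invr_gt0.
have k1 N : k N <= 1 by rewrite invf_le1 ?ler1n.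
pose kan N t := ka (k N * t + 0).
pose kan' N t := derive1 ka (k N * t + 0) * k N.
have dkan N (t : R) : is_derive t 1 (kan N) (kan' N t).
  by apply: is_derive1_affine; exact: smooth1_is_derive.
have kanS N t : N.+1%:R <= `|t| -> kan N t = 0.
  move=> Nt; apply: kaS; rewrite addr0 normrM (ger0_norm (ltW (k0 N))).
  by rewrite /k mulrC ler_pdivlMr ?mul1r.
have kan'S N t : N.+1%:R < `|t| -> kan' N t = 0.
  by move=> Nt; rewrite -(is_derive1E (dkan N t)); exact: is_derive1E (derive1_support (kanS N) Nt).
have kan'K N t : `|kan' N t| <= K.
  rewrite /kan' normrM (ger0_norm (ltW (k0 N))) -[leRHS]mulr1.
  by apply: ler_pM => //; exact: ltW.
have ckan N : continuous (kan N) by move=> t; exact: is_derive1_continuous (dkan N t).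
have ckan' N : continuous (kan' N).
  move=> t; apply: cvgMl.
  apply: (continuous_comp (f := fun t => k N * t + 0) (g := derive1 ka)).
    by apply: cvgD; [apply: cvgMr; exact: cvg_id|exact: cvg_cst].
  exact: (smooth1_continuous (smooth1_derive ska)).
have mkan N : measurable_fun setT (fun y : 'rV[R]_n => kan N (y ord0 i)).
  apply: (measurableT_comp _ (measurable_rV_coord i)).
  exact: continuous_measurable_fun.
have mkan' N : measurable_fun setT (fun y : 'rV[R]_n => kan' N (y ord0 i)).
  apply: (measurableT_comp _ (measurable_rV_coord i)).
  exact: continuous_measurable_fun.
have kan01 N t : `|kan N t| <= 1.
  by have /andP[h0 h1] := ka01 (k N * t + 0); rewrite ger0_norm.
pose Psi N y := Phi y * kan N (y ord0 i).
pose Psi' N y := Phi' y * kan N (y ord0 i) + Phi y * kan' N (y ord0 i).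
have mPsi N : measurable_fun setT (Psi N) by apply: measurable_funM => //; exact: hPhi.1.
have mPsi' N : measurable_fun setT (Psi' N).
  by apply: measurable_funD; apply: measurable_funM => //; [exact: hPhi'.1|exact: hPhi.1].
have PsiPhi N y : `|Psi N y| <= `|Phi y| by rewrite normrM ler_piMr.
have hPsi N : sq_integrable (Psi N) by exact: (sq_integrable_le (mPsi N) hPhi (PsiPhi N)).
have Psi'PhiK N y : `|Psi' N y| <= `|Phi' y| + K * `|Phi y|.
  apply: le_trans (ler_normD _ _) _; rewrite [X in X + _]normrM [X in _ + X]normrM; apply: lerD; first by rewrite ler_piMr.
  by rewrite mulrC ler_wpM2r.
have dline (y : 'rV[R]_n) (t : R) N : is_derive t 1 (fun t => Psi N (y + t *: e i)) (Psi' N (y + t *: e i)).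
  have h1 : is_derive t 1 (fun t => Phi (y + t *: e i)) (Phi' (y + t *: e i)).
    have h : is_derive (1 * t - t) 1 (fun s => Phi (y + t *: e i + s *: e i)) (Phi' (y + t *: e i)).
      by rewrite mul1r subrr; exact: dPhi.
    have := is_derive1_affine h; rewrite mulr1.
    rewrite (_ : (fun x => _) = (fun x => Phi (y + x *: e i)))//.
    by apply/funext => x; rewrite -addrA -scalerDl mul1r addrCA subrr addr0.
  have h2 : is_derive t 1 (fun t => kan N ((y + t *: e i) ord0 i)) (kan' N ((y + t *: e i) ord0 i)).
    have h : is_derive (1 * t + y ord0 i) 1 (kan N) (kan' N ((y + t *: e i) ord0 i)).
      by rewrite shiftE eqxx mulr1 mul1r addrC; exact: dkan.
    have := is_derive1_affine h; rewrite mulr1.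
    rewrite (_ : (fun x => _) = (fun x => kan N ((y + x *: e i) ord0 i)))//.
    by apply/funext => x; rewrite shiftE eqxx mulr1 mul1r addrC.
  exact: is_derive1M h1 h2.
have IN N : \int[lam]_y (u y * Psi' N y) = - \int[lam]_y (v y * Psi N y).
  (* The cutoff lives on |y_i| <= N+1; the intermediate point of the mean value theorem is within
     distance 1 of [y_i], hence N+2. In the factor, 1 pays for [Phi'] and [K] for the derivative of
     the cutoff. *)
  pose G y := (1 + K) * (B y * \1_(`[- N.+2%:R, N.+2%:R]%classic) (y ord0 i)).
  have hG : sq_integrable G.
    have [mB iB] := hB N.+2%:R; split; first exact: measurable_funM.
    apply: eq_integrable (integrableZl measurableT ((1 + K) ^+ 2) iB) => // y _.
    by rewrite -EFinM; congr EFin; rewrite /G [RHS]exprMn.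
  apply: (@weak_partial_dominated _ _ _ u v (Psi N) (Psi' N) G hu hv huv (hPsi N) hG (mPsi' N)).
  - move=> y s /andP[s0 s1].
    have [->|sn0] := eqVneq s 0.
      by rewrite scale0r subr0 subrr normr0 mul0r.
    have s0' : 0 < s by rewrite lt_neqAle eq_sym sn0.
    have s0N : - s <= 0 by rewrite oppr_le0.
    have cont : {within `[- s, 0], continuous (fun t => Psi N (y + t *: e i))}.
      by apply: continuous_subspaceT => t; exact: is_derive1_continuous (dline y t N).
    have [c cs] := MVT_segment s0N (fun t _ => dline y t N) cont.
    rewrite scale0r addr0 scaleNr sub0r opprK => E.
    rewrite distrC E normrM (ger0_norm s0) mulrC ler_wpM2l//.
    move: cs; rewrite in_itv/= => /andP[sc c0].
    have cn : `|c| <= 1 by rewrite ler0_norm// lerNl (le_trans _ sc)// lerN2.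
    rewrite /G indicE; case: (boolP (_ \in _)) => yN; last first.
      rewrite mulr0 mulr0 normr_le0 /Psi' shiftE eqxx mulr1.
      have Ny : N.+1%:R < `|y ord0 i + c|.
        move: yN; rewrite notin_setE/= in_itv/= -ler_norml => /negP; rewrite -ltNge => yN.
        have := ler_normB (y ord0 i + c) c; rewrite addrK => h.
        rewrite -(ltrD2r 1) -natr1 natr1 in h *.
        by rewrite natr1 (lt_le_trans yN)// (le_trans h)// lerD2l.
      by rewrite kan'S// kanS ?ltW// !mulr0 addr0.
    rewrite mulr1; apply: le_trans (ler_normD _ _) _.
    rewrite [X in X + _]normrM [X in _ + X]normrM mulrDl mul1r; apply: lerD.
      apply: (@le_trans _ _ (B (y + c *: e i) * 1)); last by rewrite mulr1 Be.
      by apply: ler_pM.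
    rewrite mulrC; apply: ler_pM => //.
    by rewrite -(Be y c).
  - move=> y.
    have d0 : is_derive (0 : R) 1 (fun t => Psi N (y + t *: e i)) (Psi' N y).
      by have := dline y 0 N; rewrite scale0r addr0.
    have := cvg_derive_backward d0; rewrite scale0r addr0.
    apply: cvg_trans; apply: near_eq_cvg; apply: nearW => k' /=.
    by rewrite scaleNr.
have hPK : sq_integrable (fun y => `|Phi' y| + K * `|Phi y|).
  have hK : sq_integrable (fun y => K * Phi y).
    have [mP iP] := hPhi; split; first exact: measurable_funM.
    apply: eq_integrable (integrableZl measurableT (K ^+ 2) iP) => // y _.
    by rewrite -EFinM exprMn.
  apply: sq_integrableD.
    apply: (sq_integrable_le _ hPhi') => [|y]; last by rewrite normr_id.
    by apply: measurableT_comp => //; exact: hPhi'.1.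
  apply: (sq_integrable_le _ hK) => [|y].
    by apply: measurable_funM => //; apply: measurableT_comp => //; exact: hPhi.1.
  by rewrite !normrM normr_id.
have cka t : kan N t @[N --> \oo] --> ka 0.
  have h : k N * t + 0 @[N --> \oo] --> (0 : R).
    rewrite -[X in _ --> X](mul0r t) -[X in _ --> X]addr0.
    by apply: cvgD; [apply: cvgMl; exact: cvg_harmonic|exact: cvg_cst].
  have c0 : ka z @[z --> (0 : R)] --> ka 0 by exact: smooth1_continuous.
  have := cvg_comp _ _ h c0; exact.
(* Rescaling by 1/(N+1) makes the derivative of the cutoff O(1/(N+1)), so the extra term of the
   product rule disappears in the limit. *)
have cka' t : kan' N t @[N --> \oo] --> (0 : R).
  apply/cvgr0Pnorm_le => eps eps0.
  have := @cvg_harmonic R => /cvgr0Pnorm_le/(_ (eps / (K + 1)))[].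
    by rewrite divr_gt0// ltr_wpDl.
  move=> N _ HN; exists N => // j Nj /=.
  rewrite /kan' normrM; apply: (@le_trans _ _ ((K + 1) * `|k j|)).
    by rewrite ler_wpM2r// (le_trans (HK _))// lerDl.
  rewrite mulrC -ler_pdivlMr ?ltr_wpDl//; exact: HN.
have c1 : \int[lam]_y (u y * Psi' N y) @[N --> \oo] --> ka 0 * \int[lam]_y (u y * Phi' y).
  have -> : ka 0 * \int[lam]_y (u y * Phi' y) = \int[lam]_y (u y * (Phi' y * ka 0)).
    rewrite -RintegralZl//; last exact: sq_integrableM.
    by apply: eq_Rintegral => y _; rewrite mulrC mulrA.
  have [|||||//] := @Rdominated_convergence R n (fun N y => u y * Psi' N y)
    (fun y => u y * (Phi' y * ka 0)) (fun y => `|u y * (`|Phi' y| + K * `|Phi y|)|).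
  - by move=> N; apply: measurable_funM => //; exact: hu.1.
  - by apply: measurable_funM; [exact: hu.1|apply: measurable_funM => //; exact: hPhi'.1].
  - move=> y; apply: cvgMr; rewrite -[X in _ --> X]addr0 -[X in _ --> _ + X](mulr0 (Phi y)).
    by apply: cvgD; apply: cvgMr; [exact: cka|exact: cka'].
  - exact: (integrable_abse (sq_integrableM hu hPK)).
  - move=> N y; rewrite [leLHS]normrM [leRHS]normrM ler_wpM2l//.
    by apply: le_trans (Psi'PhiK N y) _; rewrite ler_norm.
have c2 : \int[lam]_y (v y * Psi N y) @[N --> \oo] --> ka 0 * \int[lam]_y (v y * Phi y).
  have -> : ka 0 * \int[lam]_y (v y * Phi y) = \int[lam]_y (v y * (Phi y * ka 0)).
    rewrite -RintegralZl//; last exact: sq_integrableM.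
    by apply: eq_Rintegral => y _; rewrite mulrC mulrA.
  have [|||||//] := @Rdominated_convergence R n (fun N y => v y * Psi N y)
    (fun y => v y * (Phi y * ka 0)) (fun y => `|v y * Phi y|).
  - by move=> N; apply: measurable_funM => //; exact: hv.1.
  - by apply: measurable_funM; [exact: hv.1|apply: measurable_funM => //; exact: hPhi.1].
  - by move=> y; apply: cvgMr; apply: cvgMr; exact: cka.
  - exact: (integrable_abse (sq_integrableM hv hPhi)).
  - by move=> N y; rewrite [leLHS]normrM [leRHS]normrM ler_wpM2l.
have ka0' : ka 0 != 0 by rewrite gt_eqF.
apply: (mulfI ka0'); rewrite mulrN; apply: (cvg_unique _ c1) => //.
by rewrite (funext IN); exact: cvgN.
Qed.

End weak_extend.

(** * Coefficients of the derivatives *)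

Section bounded_derivatives.
Context {R : realType}.
Implicit Types (f g q : R -> R).

Definition bounded_fun f := exists C : R, forall x, `|f x| <= C.

(** The functions of class C^r whose derivatives up to order r are bounded. *)
Fixpoint Cb (r : nat) q : Prop :=
  bounded_fun q /\
  if r is r'.+1 then (forall x : R, derivable q x 1) /\ Cb r' (derive1 q)
  else continuous q.

Lemma bounded_funM f g : bounded_fun f -> bounded_fun g -> bounded_fun (fun x => f x * g x).
Proof.
move=> [C fC] [D gD]; exists (C * D) => x; rewrite normrM.
by apply: ler_pM.
Qed.

Lemma bounded_funD f g : bounded_fun f -> bounded_fun g -> bounded_fun (fun x => f x + g x).
Proof.
move=> [C fC] [D gD]; exists (C + D) => x.
by apply: le_trans (ler_normD _ _) _; exact: lerD.
Qed.

Lemma Cb_bounded r q : Cb r q -> bounded_fun q.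
Proof. by case: r => [|r] []. Qed.

Lemma Cb_continuous r q : Cb r q -> continuous q.
Proof.
case: r => [[]//|r] [_ [dq _]] x; apply: differentiable_continuous.
exact/derivable1_diffP.
Qed.

Lemma CbS r q : Cb r.+1 q -> Cb r q.
Proof.
elim: r q => [|r IH] q hq.
  by split; [exact: Cb_bounded hq|exact: Cb_continuous hq].
split; first exact: Cb_bounded hq.
by case: hq => _ [dq hq]; split => //; exact: IH.
Qed.

Lemma Cb_le r s q : (r <= s)%N -> Cb s q -> Cb r q.
Proof.
move=> /subnK <-; elim: (s - r)%N => [//|k IH] hq.
by apply: IH; exact: CbS.
Qed.

Lemma Cb_is_derive r q (x : R) : Cb r.+1 q -> is_derive x 1 q (derive1 q x).
Proof. by move=> [_ [/(_ x) /is_derive1P]]. Qed.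

Lemma CbD r f g : Cb r f -> Cb r g -> Cb r (fun x => f x + g x).
Proof.
elim: r f g => [|r IH] f g hf hg.
  split; first by apply: bounded_funD; [case: hf|case: hg].
  by move=> x; apply: cvgD; [exact: (Cb_continuous hf)|exact: (Cb_continuous hg)].
have H (x : R) : is_derive x 1 (fun x => f x + g x) (derive1 f x + derive1 g x).
  by apply: is_derive1D; [exact: Cb_is_derive hf|exact: Cb_is_derive hg].
split; first by apply: bounded_funD; [exact: Cb_bounded hf|exact: Cb_bounded hg].
split=> [x|]; first by case: (H x).
rewrite (_ : derive1 _ = (fun x => derive1 f x + derive1 g x)); last first.
  by apply/funext => x; exact: is_derive1E.
by apply: IH; [case: hf => _ []|case: hg => _ []].
Qed.

Lemma CbM r f g : Cb r f -> Cb r g -> Cb r (fun x => f x * g x).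
Proof.
elim: r f g => [|r IH] f g hf hg.
  split; first by apply: bounded_funM; [case: hf|case: hg].
  by move=> x; apply: cvgM; [exact: (Cb_continuous hf)|exact: (Cb_continuous hg)].
have H (x : R) : is_derive x 1 (fun x => f x * g x) (derive1 f x * g x + f x * derive1 g x).
  by apply: is_derive1M; [exact: Cb_is_derive hf|exact: Cb_is_derive hg].
split; first by apply: bounded_funM; [exact: Cb_bounded hf|exact: Cb_bounded hg].
split=> [x|]; first by case: (H x).
rewrite (_ : derive1 _ = (fun x => derive1 f x * g x + f x * derive1 g x)); last first.
  by apply/funext => x; exact: is_derive1E.
have [_ [_ hf']] := hf; have [_ [_ hg']] := hg.
by apply: CbD; apply: IH => //; exact: CbS.
Qed.

Lemma Cb_cst r (c : R) : Cb r (fun=> c).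
Proof.
elim: r c => [|r IH] c.
  by split; [exists (`|c|)|move=> x; exact: cvg_cst].
split; first by exists `|c|.
split=> [x|]; first exact: derivable_cst.
rewrite (_ : derive1 _ = fun=> 0); first exact: IH.
by apply/funext => x; apply: is_derive1E; exact: is_derive_cst.
Qed.

End bounded_derivatives.

Section coefficients.
Context {R : realType}.
Variables (m : nat) (rho : R -> R) (F : nat -> R -> R).
Hypotheses (rho_gt0 : forall y, 0 < rho y) (rhoC : Cb m rho).
Hypothesis dF : forall i (y : R), (i < m)%N -> is_derive y 1 (F i) (rho y * F i.+1 y).
Hypothesis mF : forall i, (i <= m)%N -> measurable_fun setT (F i).
Hypothesis F_bound0 : forall b, (b <= m)%N ->
  exists C, forall y, F b y ^+ 2 * rho y <= C.
Hypothesis F_bound : forall i j, (0 < j)%N -> (i + j <= m)%N ->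
  exists C, forall y, F i y ^+ 2 <= C * rho y ^+ (4 * j - 3).

(* For n > 0 the exponent is 2n - 1, because the hypotheses bound
   F_i * rho^(3/2 - 2n) = (F_i * rho^(1 - 2n)) * rho^(1/2). *)
Definition term_exp n := if n is k.+1 then k.*2.+1 else 0%N.

Definition term i n q (y : R) : R := F i y * (rho y ^- term_exp n * q y).

(** The index [b] counts the derivatives spent in this coordinate: [i] on the factor and [n] on the
    power of [rho], on [q] or on h. Accordingly [q] still has [m - b] bounded derivatives. *)
Inductive lincomb b : (R -> R) -> Prop :=
| Lincomb0 : lincomb b (fun=> 0)
| LincombD a i n q : lincomb b a -> (i + n = b)%N -> Cb (m - b) q ->
    lincomb b (fun y => a y + term i n q y).

Lemma lincomb_term b i n q : (i + n = b)%N -> Cb (m - b) q -> lincomb b (term i n q).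
Proof.
move=> inb hq; rewrite (_ : term i n q = fun y => 0 + term i n q y).
  by apply: LincombD => //; exact: Lincomb0.
by apply/funext => y; rewrite add0r.
Qed.

Lemma lincomb_add b a1 a2 : lincomb b a1 -> lincomb b a2 ->
  lincomb b (fun y => a1 y + a2 y).
Proof.
move=> h1; elim=> [|a i n q h IH inb hq].
  by under eq_fun do rewrite addr0.
by under eq_fun do rewrite addrA; exact: LincombD.
Qed.

Let rho_unit y : rho y != 0.
Proof. by rewrite gt_eqF. Qed.

Lemma is_derive_rhoV (y : R) n : (0 < m)%N ->
  is_derive y 1 (fun y => rho y ^- n) (- n%:R * derive1 rho y * rho y ^- n.+1).
Proof.
move=> m0; have dr : is_derive y 1 rho (derive1 rho y).
  by apply: (@Cb_is_derive _ m.-1); rewrite prednK.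
have dX : is_derive y 1 (fun y => rho y ^+ n) (n%:R * rho y ^+ n.-1 * derive1 rho y).
  rewrite (_ : (fun y => _) = rho ^+ n); last by rewrite exprfctE.
  exact: is_deriveX.
have r0 : rho y ^+ n != 0 by rewrite expf_neq0.
have := @is_deriveV _ (fun y => rho y ^+ n) y _ 1 r0 dX.
move=> h; apply: is_derive_eq h _.
rewrite /GRing.scale/=; case: n {dX} r0 => [|n] r0; first by rewrite mulr0n !(mul0r, mulr0, oppr0).
have ry := rho_unit y; have rn : rho y ^+ n != 0 by rewrite expf_neq0.
have E1 : rho y ^+ n.+1 = rho y * rho y ^+ n by rewrite exprS.
have E2 : rho y ^+ n.+2 = rho y * (rho y * rho y ^+ n) by rewrite !exprS.
rewrite /= E2 E1 expr2; move: (n.+1%:R) => k.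
by field; rewrite ry rn.
Qed.

Lemma lincomb_rhoV b a : (b < m)%N -> lincomb b a -> lincomb b.+1 (fun y => (rho y)^-1 * a y).
Proof.
move=> bm; elim=> [|{}a i n q h IH inb hq].
  by under eq_fun do rewrite mulr0; exact: Lincomb0.
under eq_fun do rewrite mulrDr.
apply: lincomb_add => //.
have hq' : Cb (m - b.+1) q by apply: Cb_le hq; rewrite leq_sub2l.
have hr : Cb (m - b.+1) rho by apply: Cb_le rhoC; exact: leq_subr.
case: n inb => [|n] inb.
  rewrite (_ : (fun y => _) = term i 1 q); first by apply: lincomb_term => //; rewrite addn1 -inb addn0.
  by apply/funext => y; rewrite /term /= expr0 invr1 expr1 mul1r mulrCA.
(* Dividing by [rho] raises the exponent by one, whereas [term_exp] grows by two; the surplus [rho]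
   is absorbed into the bounded function. *)
rewrite (_ : (fun y => _) = term i n.+2 (fun y => rho y * q y)).
  by apply: lincomb_term; [rewrite addnS inb|exact: CbM].
apply/funext => y; rewrite /term /= mulrCA; congr (_ * _).
have ry := rho_unit y; have rn : rho y ^+ n.*2 != 0 by rewrite expf_neq0.
by rewrite doubleS !exprS; field; rewrite ry rn.
Qed.

(** The extracted factor [rho y] reflects D_y = rho D_x. For k = [term_exp n] with n > 0, the
    derivative of rho^-k q is rho times rho^-(k+2) (q' rho - k q rho'); for n = 0 there is no power
    to differentiate and rho^-1 q' remains. *)
Lemma is_derive_term i n q (y : R) : (i + n < m)%N -> Cb (m - (i + n)) q ->
  is_derive y 1 (term i n q) (rho y * (term i.+1 n q y +
    (if n is 0%N then term i 1 (derive1 q) y else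
      term i n.+1 (fun y => derive1 q y * rho y +
         - (term_exp n)%:R * (q y * derive1 rho y)) y))).
Proof.
move=> inm hq.
have m0 : (0 < m)%N by apply: leq_ltn_trans inm.
have dq : is_derive y 1 q (derive1 q y).
  by apply: (@Cb_is_derive _ (m - (i + n)).-1); rewrite prednK// subn_gt0.
have im : (i < m)%N by apply: leq_ltn_trans inm; exact: leq_addr.
have h1 := is_derive1M (is_derive_rhoV y (term_exp n) m0) dq.
have := is_derive1M (dF y im) h1; move=> h; apply: is_derive_eq h _.
rewrite /term; case: n {inm hq h1} => [|n] /=.
  rewrite expr0 invr1 expr1; have := rho_unit y => ry.
  by rewrite !mul1r oppr0 !mul0r add0r; field.
rewrite doubleS; have ry := rho_unit y.
have rn : rho y ^+ n.*2 != 0 by rewrite expf_neq0.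
by rewrite !exprS; field; rewrite ry rn.
Qed.

Lemma lincomb_derive b a : (b < m)%N -> lincomb b a ->
  exists2 a', lincomb b.+1 a' & forall y : R, is_derive y 1 a (rho y * a' y).
Proof.
move=> bm; elim=> [|{}a i n q h [a' la' da'] inb hq].
  by exists (fun=> 0); [exact: Lincomb0|move=> y; rewrite mulr0; exact: is_derive_cst].
pose t y := term i.+1 n q y + (if n is 0%N then term i 1 (derive1 q) y else
      term i n.+1 (fun y => derive1 q y * rho y +
         - (term_exp n)%:R * (q y * derive1 rho y)) y).
exists (fun y => a' y + t y).
  apply: lincomb_add => //; apply: lincomb_add.
    apply: lincomb_term; first by rewrite addSn inb.
    by apply: Cb_le hq; rewrite leq_sub2l.
  have hq' : Cb (m - b.+1) (derive1 q).
    have : Cb (m - b.+1).+1 q by rewrite subnSK.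
    by case=> _ [].
  case: n inb {t} => [|n] inb.
    by apply: lincomb_term => //; rewrite addn1 -inb addn0.
  apply: lincomb_term; first by rewrite addnS inb.
  have hr : Cb (m - b.+1).+1 rho by rewrite subnSK//; apply: Cb_le rhoC; exact: leq_subr.
  apply: CbD; first by apply: CbM => //; exact: CbS.
  apply: CbM; first exact: Cb_cst.
  apply: CbM; first by apply: Cb_le hq; rewrite leq_sub2l.
  by case: hr => _ [].
move=> y; rewrite mulrDr; apply: is_derive1D => //.
by apply: is_derive_term; rewrite inb.
Qed.

Let sqrD_le (x y : R) : (x + y) ^+ 2 <= 2 * (x ^+ 2 + y ^+ 2).
Proof. by have := sqr_ge0 (x - y); nra. Qed.

(** Sums are split by (x+y)^2 <= 2(x^2+y^2). A single term is controlled by [F_bound0] if n = 0 and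
    by [F_bound] otherwise, up to the bound on [q]. *)
Lemma lincomb_bound0 b a : (b <= m)%N -> lincomb b a ->
  exists C, forall y, a y ^+ 2 * rho y <= C.
Proof.
move=> bm; elim=> [|{}a i n q h [C HC] inb hq].
  by exists 0 => y; rewrite expr0n mul0r.
suff [D HD] : exists D, forall y, term i n q y ^+ 2 * rho y <= D.
  exists (2 * (C + D)) => y.
  have := ler_wpM2r (ltW (rho_gt0 y)) (sqrD_le (a y) (term i n q y)).
  move=> /le_trans; apply; rewrite -mulrA; apply: ler_wpM2l => //.
  by rewrite [leLHS]mulrDl lerD.
have [Q HQ] := Cb_bounded hq.
have Q0 : 0 <= Q by apply: le_trans (HQ 0).
have qQ y : q y ^+ 2 <= Q ^+ 2.
  by rewrite -(real_normK (num_real (q y))) ler_pXn2r ?nnegrE.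
case: n inb => [|n] inb.
  rewrite addn0 in inb; have [C1 HC1] := F_bound0 bm.
  exists (C1 * Q ^+ 2) => y; rewrite /term /= expr0 invr1 mul1r inb exprMn mulrAC.
  by apply: ler_pM => //; rewrite ?sqr_ge0// mulr_ge0 ?sqr_ge0// ltW.
have [|C1 HC1] := @F_bound i n.+1 isT; first by rewrite inb.
have C10 : 0 <= C1.
  by rewrite -(@pmulr_lge0 _ (rho 0 ^+ (4 * n.+1 - 3))) ?exprn_gt0// (le_trans _ (HC1 0))// sqr_ge0.
exists (C1 * Q ^+ 2) => y; rewrite /term !exprMn /=.
(* The index of the term is [n.+1] here: rho^-(2n+1) squared times rho is rho^-(4n+1), and 4n+1 =
   4(n+1)-3. *)
have -> : F i y ^+ 2 * ((rho y ^- n.*2.+1) ^+ 2 * q y ^+ 2) * rho y =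
    F i y ^+ 2 / rho y ^+ (4 * n.+1 - 3) * q y ^+ 2.
  have -> : (4 * n.+1 - 3 = (n.*2 + n.*2).+1)%N by rewrite -!mul2n; lia.
  have ry := rho_unit y; have rn : rho y ^+ n.*2 != 0 by rewrite expf_neq0.
  by rewrite !exprS exprD; field; rewrite ry rn.
apply: ler_pM => //; rewrite ?sqr_ge0//.
  by rewrite mulr_ge0 ?sqr_ge0// invr_ge0 exprn_ge0// ltW.
by rewrite ler_pdivrMr// exprn_gt0.
Qed.

Lemma measurable_lincomb b a : (b <= m)%N -> lincomb b a -> measurable_fun setT a.
Proof.
move=> bm; elim=> [|{}a i n q h IH inb hq]; first exact: measurable_cst.
have crho := Cb_continuous rhoC.
apply: measurable_funD => //; apply: measurable_funM.
  by apply: mF; apply: leq_trans bm; rewrite -inb leq_addr.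
apply: measurable_funM; last by apply: continuous_measurable_fun; exact: (Cb_continuous hq).
apply: continuous_measurable_fun => y; apply: cvgV; first by rewrite expf_neq0.
exact: (continuous_comp (crho y) (@exprn_continuous R _ (rho y))).
Qed.

End coefficients.

(** * Univariate transformations *)

Section transformation.
Context {R : realType}.
Variables (psi rho : R -> R).
Hypotheses (Ht : univariate_transformation psi) (Hd : density psi rho).
Local Notation I := (@Ihalf R).

Definition inv_transf (psi : R -> R) := 'pinv_(fun=> 0) [set` (@Ihalf R)] psi.
Local Notation chi := (inv_transf psi).

Lemma Ihalf_nbhs x : x \in I -> \forall y \near x, y \in I.
Proof. by move=> xI; exact: near_in_itvoo. Qed.

Lemma psi_is_derive x : x \in I -> is_derive x 1 psi (derive1 psi x).
Proof. by case: Ht => [[/(_ x) dpsi _] _] /dpsi /is_derive1P. Qed.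

Lemma psi_inj : {in I &, injective psi}.
Proof.
case: Ht => _ [inc _] x y xI yI E.
by case: (ltgtP x y) => // /inc; rewrite E ltxx => H; have := H ltac:(done) ltac:(done).
Qed.

Lemma psi_surj y : exists2 x, x \in I & psi x = y.
Proof.
case: Ht => [[dpsi _] [inc [_ [cl cr]]]].
have h2 : - 2^-1 < 0 :> R by rewrite oppr_lt0 invr_gt0.
have h2' : 0 < 2^-1 :> R by rewrite invr_gt0.
have [a [a1 a2 a3]] : exists a, [/\ - 2^-1 < a, a < 0 & psi a <= y].
  near ((- 2^-1 : R)^'+) => a; exists a; split; near: a.
  - exact: nbhs_right_gt.
  - exact: nbhs_right_lt.
  - by move/cvgrNyPle : cl => /(_ y).
have [b [b1 b2 b3]] : exists b, [/\ b < 2^-1, 0 < b & y <= psi b].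
  near ((2^-1 : R)^'-) => b; exists b; split; near: b.
  - exact: nbhs_left_lt.
  - exact: nbhs_left_gt.
  - by move/cvgryPge : cr => /(_ y).
have ab : a <= b by rewrite ltW// (lt_trans a2).
have [||c] := @IVT _ psi a b y ab.
- apply: derivable_within_continuous => x; rewrite in_itv/= => /andP[ax xb].
  by apply: dpsi; rewrite in_itv/= (lt_le_trans a1)//= (le_lt_trans xb).
- by rewrite ge_min a3/= le_max b3 orbT.
rewrite in_itv/= => /andP[ac cb] E; exists c => //.
by rewrite in_itv/= (lt_le_trans a1)//= (le_lt_trans cb).
Unshelve. all: end_near. Qed.

Lemma inv_transfK x : x \in I -> chi (psi x) = x.
Proof.
move=> xI; apply: (@pinvKV _ _ _ [set` I]); last by rewrite inE.
by move=> u v; rewrite !inE; exact: psi_inj.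
Qed.

Lemma inv_transf_in y : chi y \in I.
Proof. by have [x xI <-] := psi_surj y; rewrite inv_transfK. Qed.

Lemma transfK y : psi (chi y) = y.
Proof. by have [x xI <-] := psi_surj y; rewrite inv_transfK. Qed.

Lemma inv_transf_is_derive (y : R) : is_derive y 1 chi (rho y).
Proof. exact: Hd. Qed.

(** Chain rule for the composite of [psi] with its inverse, which is the identity near [x]. *)
Lemma rho_psi x : x \in I -> rho (psi x) * derive1 psi x = 1.
Proof.
move=> xI.
have h := is_derive1_comp (inv_transf_is_derive (psi x)) (psi_is_derive xI).
rewrite -(is_derive1E h); apply: is_derive1E.
apply: near_eq_is_derive (is_derive_id x 1).
by near=> z; rewrite /= inv_transfK//; near: z; exact: Ihalf_nbhs.
Unshelve. all: end_near. Qed.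

(** Strict monotonicity gives only a nonnegative derivative; zero is excluded because the inverse is
    differentiable. *)
Lemma derive1_psi_gt0 x : x \in I -> 0 < derive1 psi x.
Proof.
move=> xI; rewrite lt_neqAle; apply/andP; split.
  apply/eqP => E; have := rho_psi xI; rewrite -E mulr0 => /eqP.
  by rewrite eq_sym oner_eq0.
case: Ht => [[dpsi _] [inc _]].
by apply: (@incr_derive1_ge0_itv _ psi false true (- 2^-1) 2^-1) => // z; rewrite inE; exact: dpsi.
Qed.

Lemma rho_gt0 y : 0 < rho y.
Proof.
have := rho_psi (inv_transf_in y); rewrite transfK => E.
have := derive1_psi_gt0 (inv_transf_in y) => h.
by rewrite -(pmulr_lgt0 _ h) E ltr01.
Qed.

Lemma derive1_psiE x : x \in I -> derive1 psi x = (rho (psi x))^-1.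
Proof.
move=> xI; have := rho_psi xI => E; apply: (@mulfI _ (rho (psi x))).
  by rewrite gt_eqF// rho_gt0.
by rewrite E divff// gt_eqF// rho_gt0.
Qed.

Lemma inv_transf_continuous : continuous chi.
Proof. by move=> y; exact: is_derive1_continuous (inv_transf_is_derive y). Qed.

Lemma measurable_psi : measurable_fun [set` I] psi.
Proof.
apply: open_continuous_measurable_fun; first exact: interval_open.
by move=> x; rewrite inE => xI; exact: is_derive1_continuous (psi_is_derive xI).
Qed.

End transformation.

Section C0.
Context {R : realType}.

Lemma C0_line_bounded (u : R -> R) : C0_line u -> bounded_fun u.
Proof.
move=> [cu [up um]].
have /cvgr0Pnorm_le/(_ 1 ltr01) [a [_ Ha]] := up.
have /cvgr0Pnorm_le/(_ 1 ltr01) [b [_ Hb]] := um.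
pose M := Num.max `|a + 1| `|b - 1|.
have M0 : 0 <= M by rewrite le_max normr_ge0.
have [||c _ Hc] := @EVT_max _ (fun x => `|u x|) (- M) M.
- by rewrite ge0_cp.
- apply: continuous_subspaceT => x.
  exact: (continuous_comp (cu x) (@norm_continuous _ _ _)).
exists (`|u c| + 1) => x; have [xM|xM] := leP `|x| M.
  by apply: ler_wpDr => //; apply: Hc; rewrite in_itv/= -ler_norml.
rewrite ler_wpDl//; have [x0|x0] := leP 0 x.
  apply: Ha; rewrite ger0_norm// in xM.
  apply: le_lt_trans xM; rewrite le_max; apply/orP; left.
  by apply: le_trans (ler_norm _); rewrite lerDl.
apply: Hb; rewrite ltr0_norm// in xM.
rewrite ltrNr in xM; apply: lt_le_trans xM _; rewrite lerNl.
apply: (@le_trans _ _ `|b - 1|); last by rewrite le_max lexx orbT.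
by rewrite distrC; apply: le_trans (ler_norm _); lra.
Qed.

Lemma C0_Cb m (u : R -> R) : (forall j, (j <= m)%N ->
  differentiable_upto setT j u /\ C0_line (derive1n j u)) -> Cb m u.
Proof.
elim: m u => [|m IH] u H.
  have [_ h] := H 0%N (leqnn _); split; first exact: C0_line_bounded h.
  by case: h.
split; first by have [_ h] := H 0%N isT; exact: C0_line_bounded h.
split; first by move=> x; have [h _] := H 1%N isT; exact: (h 0%N).
apply: IH => j jm; have [h1 h2] := H j.+1 jm; split; last by rewrite -derive1Sn.
by move=> k kj x _; rewrite -derive1Sn; apply: h1.
Qed.

End C0.

(** * From almost everywhere bounds to everywhere bounds *)

Section ae_everywhere.
Context {R : realType}.
Local Notation I := (@Ihalf R).
Local Notation mu := (@lebesgue_measure R).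

Lemma Linfty_torus_ae (u : R -> R) : (Linfty_torus u < +oo)%E ->
  exists2 C, 0 <= C & {ae mu, forall x, x \in I -> `|u x| <= C}.
Proof.
(* The norm at exponent [+oo] is an essential supremum only if the whole space has positive measure;
   the unit interval shows this for the line. *)
rewrite /Linfty_torus unlock; case: ifPn => [_|]; last first.
  move=> /negP[]; apply: (@lt_le_trans _ _ (lebesgue_measure (`[0%R, 1%R]%classic : set R))).
    by rewrite lebesgue_measure_itv/= lte_fin ltr01 -EFinB subr0 lte_fin.
  apply: le_measure; rewrite ?inE; [exact: measurable_itv|exact: measurableT|by []].
set f := (f in ess_sup _ f) => ubd.
have /filterS H := ess_sup_ge mu f.
(* Adding the absolute value makes the constant nonnegative whatever the sign of the essential
   supremum. *)
exists (fine (ess_sup mu f) + `|fine (ess_sup mu f)|).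
  by rewrite -[X in X + _]opprK addrC subr_ge0 -normrN ler_norm.
apply: H => x fx xI.
have fxE : f x = `|u x|%:E.
  rewrite /f /= patchE mem_set// /=; move: xI; rewrite !in_itv/= => /andP[h ->].
  by rewrite ltW.
have fin : ess_sup mu f \is a fin_num.
  rewrite fin_numE -ltey ubd andbT; apply/eqP => E; move: fx.
  by rewrite E fxE.
apply: (@le_trans _ _ (fine (ess_sup mu f))); last by rewrite lerDl.
by rewrite -lee_fin fineK// -fxE.
Qed.

Lemma ae_le0_continuous (Q : R -> R) : {ae mu, forall x, x \in I -> Q x <= 0} ->
  {in I, forall x, {for x, continuous Q}} -> {in I, forall x, Q x <= 0}.
Proof.
move=> [N [mN N0 HN]] cQ x xI; rewrite leNgt; apply/negP => Qx.
have : \forall y \near x, 0 < Q y /\ y \in I.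
  near=> y; split; near: y; last exact: Ihalf_nbhs.
  exact: (cvgr_gt _ (cQ x xI)).
move=> [r /= r0 Hr].
have sub : `]x - r, x + r[%classic `<=` N.
  move=> y /=; rewrite in_itv/= => yx; apply: HN => /= H.
  have [|Qy yI] := Hr y.
    rewrite /ball/= distrC ltr_norml; move: yx => /andP[? ?]; apply/andP; split; lra.
  by have := H yI; rewrite leNgt Qy.
have mJ : measurable (`]x - r, x + r[%classic : set (measurableTypeR R)) by exact: measurable_itv.
have : mu `]x - r, x + r[%classic = 0%E by exact: (subset_measure0 mJ mN sub N0).
rewrite lebesgue_measure_itv/= lte_fin ltrD2l (@lt_trans _ _ 0) ?oppr_lt0//.
move=> [E]; clear -r0 E; lra.
Unshelve. all: end_near. Qed.

(** The derivative of [g] need not be continuous, so density of good points is not enough. If the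
    bound failed at [x], then [g] would rise faster than slope [M] just to the right of [x], while
    [derive1_le_ae] on that short interval, where [phi] is below [phi x + eps] < [M], forbids it. *)
Lemma derive1_ae_le (g phi : R -> R) : {in I, forall x, derivable g x 1} ->
  {in I, forall x, {for x, continuous phi}} ->
  {ae mu, forall x, x \in I -> derive1 g x <= phi x} ->
  {in I, forall x, derive1 g x <= phi x}.
Proof.
move=> dg cphi ae x xI; apply/ler_addgt0Pr => eps eps0.
rewrite leNgt; apply/negP => gx.
pose M := (phi x + eps + derive1 g x) / 2.
have M1 : phi x + eps < M by rewrite /M; lra.
have M2 : M < derive1 g x by rewrite /M; lra.
have dNg : is_derive x 1 (fun t => - g t) (- derive1 g x).
  by apply: is_deriveN; have /is_derive1P := dg x xI.
have : \forall y \near x, [/\ phi y < phi x + eps, y \in I &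
    (x <= y -> - g y - - g x <= - M * (y - x))].
  have dNg' : derivable (fun t => - g t) x 1 by case: dNg.
  have := @near_slope_le _ (fun t => - g t) x (- M) dNg'.
  rewrite (is_derive1E dNg) ltrN2 => /(_ M2) H.
  near=> y; split.
  - near: y; apply: (cvgr_lt _ (cphi x xI)); by rewrite ltrDl.
  - near: y; exact: Ihalf_nbhs.
  - by have [] : (x <= y -> - g y - - g x <= - M * (y - x)) /\
         (y <= x -> - g x - - g y <= - M * (x - y)) by near: y.
move=> [r /= r0 Hr].
pose y := x + r / 2.
have xy : x < y by rewrite ltrDl divr_gt0.
have inball t : x <= t <= y -> `|x - t| < r.
  move=> /andP[xt ty]; rewrite distrC ger0_norm ?subr_ge0// ltrBlDl.
  by apply: le_lt_trans ty _; rewrite ltrD2l ltr_pdivrMr// ltr_pMr// ltr1n.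
have [_ _ H3] : [/\ phi y < phi x + eps, y \in I & (x <= y -> - g y - - g x <= - M * (y - x))].
  by apply: Hr; apply: inball; rewrite ltW// lexx.
have := H3 (ltW xy) => h1.
have h2 : g y - g x <= (phi x + eps) * (y - x).
  apply: derive1_le_ae; first exact: ltW.
    move=> t; rewrite in_itv/= => /inball/Hr[_ tI _]; exact: dg.
  apply: (@filterS _ _ (ae_filter_ringOfSetsType mu) _ _ _ ae) => t Ht.
  rewrite in_itv/= => /inball/Hr[h tI _].
  by apply: le_trans (Ht tI) _; exact: ltW.
have yx : 0 < y - x by rewrite subr_gt0.
have := ltr_pM2r yx (phi x + eps) M; rewrite M1 => h3.
have : (phi x + eps) * (y - x) < M * (y - x) by rewrite h3.
by move: h1 h2; rewrite mulNr; lra.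
Unshelve. all: end_near. Qed.

(** A derivative, continuous or not, is a pointwise limit of difference quotients of a continuous
    function. *)
Lemma measurable_derive1 (f df : R -> R) : (forall x : R, is_derive x 1 f (df x)) ->
  measurable_fun setT (df : measurableTypeR R -> R).
Proof.
move=> dfx.
have mf : measurable_fun setT (f : measurableTypeR R -> R).
  by apply: continuous_measurable_fun => x; exact: is_derive1_continuous (dfx x).
apply: (@measurable_fun_cvg _ _ _ _ (fun k x => k.+1%:R * (f x - f (x - k.+1%:R^-1)))).
  move=> k; apply: measurable_funM => //; apply: measurable_funB => //.
  apply: (measurableT_comp mf); apply: measurable_funB => //; exact: measurable_id.
move=> x _.
have h : is_derive (0 : R) 1 (fun t => f (1 * t + x)) (df x).
  have h0 : is_derive (1 * 0 + x) 1 f (df x) by rewrite mulr0 add0r.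
  by have := is_derive1_affine h0; rewrite mulr1.
have := cvg_derive_backward h; rewrite mulr0 add0r.
by under [X in X @ _ --> _ -> _]eq_fun do rewrite mul1r [_ + x]addrC.
Qed.

End ae_everywhere.

(** * Everywhere bounds for the derivatives of the factor *)

Section factor_bounds.
Context {R : realType}.
Variables (m : nat) (psi rho F : R -> R).
Hypotheses (m0 : (0 < m)%N).
Hypotheses (Ht : univariate_transformation psi) (Hd : density psi rho).
Hypothesis HF : differentiable_upto [set` (@Ihalf R)] m F.
Hypothesis HL : forall b, (b <= m)%N -> (\big[maxe/-oo]_(j < b.+1) Linfty_torus (fun x : R =>
        derive1n (b - j) F x *
        derive1 psi x `^ Num.max (- (1 / 2)) (2 * j%:R - 3 / 2))%R < +oo)%E.
Local Notation I := (@Ihalf R).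
Local Notation mu := (@lebesgue_measure R).
Local Notation S := (derive1 psi).
Local Notation chi := (inv_transf psi).

Let HLae b j : (j <= b)%N -> (b <= m)%N -> exists2 C, 0 <= C &
  {ae mu, forall x, x \in I ->
    `|derive1n (b - j) F x * S x `^ Num.max (- (1 / 2)) (2 * j%:R - 3 / 2)| <= C}.
Proof.
move=> jb bm; have /bigmax_ltP[_ H] := HL bm.
have jb' : (j < b.+1)%N by [].
exact: (Linfty_torus_ae (H (Ordinal jb') isT)).
Qed.

Let cS : {in I, forall x, {for x, continuous S}}.
Proof. by case: Ht => [[_ h] _] x xI; exact: h. Qed.

Let dFn i x : (i < m)%N -> x \in I -> is_derive x 1 (derive1n i F) (derive1n i.+1 F x).
Proof. by move=> im xI; have /is_derive1P := HF im xI; rewrite -derive1nS. Qed.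

Let cFn i x : (i < m)%N -> x \in I -> {for x, continuous (derive1n i F)}.
Proof. by move=> im xI; exact: is_derive1_continuous (dFn im xI). Qed.

(** The case j = 0 of the hypothesis reads |F^(b)| <= C sqrt(psi') almost everywhere. For b < m both
    sides are continuous; for b = m the bound is carried over by [derive1_ae_le], applied to F^(m-1)
    and to its negative. *)
Lemma factor_bound0 b : (b <= m)%N -> exists C, forall x, x \in I ->
  derive1n b F x ^+ 2 <= C * S x.
Proof.
move=> bm; have [C C0] := HLae (leq0n b) bm.
rewrite subn0 mulr0 sub0r.
have -> : Num.max (- (1 / 2)) (- (3 / 2)) = - 2^-1 :> R.
  by rewrite max_l ?div1r// lerN2; lra.
move=> aeC.
have {}aeC : {ae mu, forall x, x \in I -> `|derive1n b F x| <= C * Num.sqrt (S x)}.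
  apply: (@filterS _ _ (ae_filter_ringOfSetsType mu) _ _ _ aeC) => x Hx xI; have S0 := derive1_psi_gt0 Ht Hd xI.
  move: (Hx xI); rewrite powRN powR12_sqrt ?(ltW S0)// normrM normfV.
  by rewrite [X in _ / X]ger0_norm ?sqrtr_ge0// ler_pdivrMr// sqrtr_gt0.
exists (C ^+ 2) => x xI.
suff : `|derive1n b F x| <= C * Num.sqrt (S x).
  move=> h; rewrite -(real_normK (num_real _)).
  apply: (@le_trans _ _ ((C * Num.sqrt (S x)) ^+ 2)).
    by rewrite ler_pXn2r// nnegrE// mulr_ge0// sqrtr_ge0.
  by rewrite exprMn sqr_sqrtr// ltW// (derive1_psi_gt0 Ht Hd).
have csq : {in I, forall x, {for x, continuous (fun x => C * Num.sqrt (S x))}}.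
  move=> y yI; apply: cvgMr.
  exact: (continuous_comp (cS yI) (@sqrt_continuous R _)).
move: bm; rewrite leq_eqVlt => /orP[/eqP bm|bm]; last first.
  rewrite -subr_le0; move: x xI; apply: ae_le0_continuous.
    by apply: (@filterS _ _ (ae_filter_ringOfSetsType mu) _ _ _ aeC) => y Hy yI; rewrite subr_le0; exact: Hy.
  move=> y yI; apply: cvgB; last exact: csq.
  exact: (continuous_comp (cFn bm yI) (@norm_continuous _ _ _)).
have bE : b = m.-1.+1 by rewrite prednK.
have m1 : (m.-1 < m)%N by rewrite prednK.
pose g := derive1n m.-1 F.
have gE y : derive1n b F y = derive1 g y by rewrite bE derive1nS.
have dg : {in I, forall y, derivable g y 1} by move=> y yI; case: (dFn m1 yI).
have dNg : {in I, forall y : R, is_derive y 1 (fun t => - g t) (- derive1 g y)}.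
  by move=> y yI; apply: is_deriveN; have /is_derive1P := dg y yI.
have gN : {in I, forall y, derive1 (fun t => - g t) y <= C * Num.sqrt (S y)}.
  apply: derive1_ae_le.
  - by move=> y yI; case: (dNg y yI).
  - exact: csq.
  - apply: (@filterS _ _ (ae_filter_ringOfSetsType mu) _ _ _ aeC) => y Hy yI.
    rewrite (is_derive1E (dNg y yI)).
    by apply: le_trans (Hy yI); rewrite gE -normrN ler_norm.
have gP : {in I, forall y, derive1 g y <= C * Num.sqrt (S y)}.
  apply: derive1_ae_le; [exact: dg|exact: csq|].
  apply: (@filterS _ _ (ae_filter_ringOfSetsType mu) _ _ _ aeC) => y Hy yI.
  by apply: le_trans (Hy yI); rewrite gE ler_norm.
rewrite ler_norml gE; apply/andP; split; last exact: gP.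
by rewrite lerNl; have := gN x xI; rewrite (is_derive1E (dNg x xI)).
Qed.

(** Here j > 0 forces i < m, so F^(i) is continuous and the bound extends by continuity. The
    exponent 4j-3 is twice 2j-3/2; after squaring, only integer powers of psi' are left. *)
Lemma factor_bound i j : (0 < j)%N -> (i + j <= m)%N -> exists C, forall x, x \in I ->
  derive1n i F x ^+ 2 * S x ^+ (4 * j - 3) <= C.
Proof.
move=> j0 ijm; have [C C0] := HLae (leq_addl i j) ijm.
rewrite addnK.
have -> : Num.max (- (1 / 2)) (2 * j%:R - 3 / 2) = 2 * j%:R - 3 / 2 :> R.
  have j1 : 1 <= j%:R :> R by rewrite ler1n.
  by apply: max_r; lra.
move=> aeC; exists (C ^+ 2).
have im : (i < m)%N by apply: leq_trans ijm; rewrite -[X in (X < _)%N]addn0 ltn_add2l.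
suff : {in I, forall x, derive1n i F x ^+ 2 * S x ^+ (4 * j - 3) - C ^+ 2 <= 0}.
  by move=> h x /h; rewrite subr_le0.
apply: ae_le0_continuous.
  apply: (@filterS _ _ (ae_filter_ringOfSetsType mu) _ _ _ aeC) => x Hx xI; rewrite subr_le0.
  have S0 := derive1_psi_gt0 Ht Hd xI.
  have -> : S x ^+ (4 * j - 3) = (S x `^ (2 * j%:R - 3 / 2)) ^+ 2.
    rewrite -powR_mulrn ?powR_ge0// -powRrM -powR_mulrn ?(ltW S0)//; congr (_ `^ _).
    rewrite natrB; last by rewrite (leq_trans (_ : 3 <= 4 * 1)%N)// leq_mul2l.
    by rewrite natrM; field.
  rewrite -exprMn -(real_normK (num_real _)) ler_pXn2r ?nnegrE//; exact: Hx.
move=> x xI; apply: cvgB; last exact: cvg_cst.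
apply: cvgM.
  exact: (continuous_comp (cFn im xI) (@exprn_continuous R _ _)).
exact: (continuous_comp (cS xI) (@exprn_continuous R _ _)).
Qed.

Definition pullback i (y : R) := derive1n i F (chi y).

Lemma is_derive_pullback i (y : R) : (i < m)%N ->
  is_derive y 1 (pullback i) (rho y * pullback i.+1 y).
Proof.
move=> im; rewrite mulrC.
apply: is_derive1_comp (inv_transf_is_derive Hd y).
exact: dFn im (inv_transf_in Ht y).
Qed.

(** Only the top order i = m may be discontinuous; there the function is 1/rho times the derivative
    of the pullback of order m-1. *)
Lemma measurable_pullback i : continuous rho -> (i <= m)%N -> measurable_fun setT (pullback i).
Proof.
move=> crho; rewrite leq_eqVlt => /orP[/eqP ->|im]; last first.
  apply: continuous_measurable_fun => y; exact: is_derive1_continuous (is_derive_pullback y im).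
have m1 : (m.-1 < m)%N by rewrite prednK.
have h := measurable_derive1 (fun y => is_derive_pullback y m1).
have rho0 y : rho y != 0 by rewrite gt_eqF// (rho_gt0 Ht Hd).
rewrite (_ : pullback m = (fun y => (rho y)^-1 * (rho y * pullback m.-1.+1 y))).
  apply: measurable_funM => //; apply: continuous_measurable_fun => y.
  by apply: cvgV => //; exact: crho.
by apply/funext => y; rewrite prednK// mulKf.
Qed.

Lemma pullback_bound0 b : (b <= m)%N -> exists C, forall y, pullback b y ^+ 2 * rho y <= C.
Proof.
move=> bm; have [C HC] := factor_bound0 bm; exists C => y.
have yI := inv_transf_in Ht y; have r0 := rho_gt0 Ht Hd y.
rewrite -ler_pdivlMr//; have := HC _ yI.
by rewrite (derive1_psiE Ht Hd yI) (transfK Ht).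
Qed.

Lemma pullback_bound i j : (0 < j)%N -> (i + j <= m)%N ->
  exists C, forall y, pullback i y ^+ 2 <= C * rho y ^+ (4 * j - 3).
Proof.
move=> j0 ijm; have [C HC] := factor_bound j0 ijm; exists C => y.
have yI := inv_transf_in Ht y; have r0 := rho_gt0 Ht Hd y.
have := HC _ yI; rewrite (derive1_psiE Ht Hd yI) (transfK Ht) exprVn.
by rewrite ler_pdivrMr// exprn_gt0.
Qed.

End factor_bounds.

(** * Integration by parts on the cube *)

Section tests.
Context {R : realType} {d : nat}.
Local Notation e i := (delta_mx ord0 i : 'rV[R]_d).
Implicit Types (phi : 'rV[R]_d -> R) (al : 'I_d -> R -> R).

Lemma line_is_derive i phi (x : 'rV[R]_d) (l : R) :
  is_derive (0 : R) 1 (fun t => phi (x + t *: e i)) l <-> is_derive x (e i) phi l.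
Proof.
have E : (fun h : R => h^-1 *: (phi (x + (h *: 1 + 0) *: e i) - phi (x + 0 *: e i))) =
         (fun h : R => h^-1 *: (phi (h *: e i + x) - phi x)).
  by apply/funext => h; rewrite addr0 [h *: 1]mulr1 scale0r addr0 [x + _]addrC.
have dE : derivable (fun t : R => phi (x + t *: e i)) 0 1 = derivable phi x (e i).
  by rewrite /derivable E.
have DE : 'D_1 (fun t : R => phi (x + t *: e i)) 0 = 'D_(e i) phi x.
  by rewrite /derive E.
split=> h.
  by apply: DeriveDef; [rewrite -dE; exact: ex_derive|rewrite -DE; exact: derive_val].
by apply: DeriveDef; [rewrite dE; exact: ex_derive|rewrite DE; exact: derive_val].
Qed.

Lemma partialE i phi x : derivable phi x (e i) ->
  is_derive (0 : R) 1 (fun t => phi (x + t *: e i)) (partial i phi x).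
Proof. by move=> dphi; apply/line_is_derive; exact: DeriveDef. Qed.

Lemma foldr_partial_cat phi s1 s2 :
  foldr partial phi (s1 ++ s2) = foldr partial (foldr partial phi s2) s1.
Proof. exact: foldr_cat. Qed.

Lemma smooth_partial i phi : smooth phi -> smooth (partial i phi).
Proof. by move=> sphi s; have := sphi (s ++ [:: i]); rewrite foldr_partial_cat. Qed.

Lemma smooth_foldr s phi : smooth phi -> smooth (foldr partial phi s).
Proof.
move=> sphi; elim: s => [|i s IH]; first exact: sphi.
exact: (@smooth_partial i _ IH).
Qed.

(** A mixed derivative as a word of single partial derivatives, so that integration by parts can
    remove one letter at a time. *)
Definition multi_seq (al : 'I_d -> nat) : seq 'I_d :=
  flatten [seq nseq (al i) i | i <- enum 'I_d].

Lemma multi_partialE (al : 'I_d -> nat) phi : multi_partial al phi = foldr partial phi (multi_seq al).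
Proof.
rewrite /multi_partial /multi_seq; elim: (enum 'I_d) => //= i s ->.
rewrite foldr_partial_cat; elim: (al i) => //= k IH.
by rewrite -IH.
Qed.

Lemma count_multi_seq (al : 'I_d -> nat) i : count_mem i (multi_seq al) = al i.
Proof.
rewrite /multi_seq count_flatten -map_comp sumnE big_map.
rewrite big_enum/= (bigD1 i)//= count_nseq /= eqxx mul1n big1 ?addn0// => j ji.
by rewrite count_nseq/= (negbTE ji) mul0n.
Qed.

Lemma size_multi_seq (al : 'I_d -> nat) : size (multi_seq al) = (\sum_i al i)%N.
Proof.
rewrite /multi_seq size_flatten /shape -map_comp sumnE big_map big_enum/=.
by apply: eq_bigr => i _; rewrite /= size_nseq.
Qed.

Lemma partial_prod_fun i al : (forall l, smooth1 (al l)) ->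
  partial i (prod_fun al) = prod_fun (upd i (derive1 (al i)) al) /\
  forall x, derivable (prod_fun al) x (e i).
Proof.
move=> sal.
have H x : is_derive x (e i) (prod_fun al) (prod_fun (upd i (derive1 (al i)) al) x).
  apply/line_is_derive; under eq_fun do rewrite prod_fun_shift.
  rewrite prod_fun_upd.
  have h0 : is_derive (1 * 0 + x ord0 i) 1 (al i) (derive1 (al i) (x ord0 i)).
    by rewrite mulr0 add0r; exact: smooth1_is_derive.
  have h1 := is_derive1_affine h0; rewrite mulr1 in h1.
  have h2 := is_derive1M h1 (is_derive_cst (\prod_(l | l != i) al l (x ord0 l)) (0 : R) 1).
  rewrite mulr0 addr0 in h2.
  rewrite (_ : (fun t => _) = (fun t : R => al i (1 * t + x ord0 i) *
    cst (\prod_(l | l != i) al l (x ord0 l)) t)) //.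
  by apply/funext => t; rewrite mul1r [t + _]addrC.
split=> [|x]; last by case: (H x).
by apply/funext => x; have := H x => /@derive_val.
Qed.

(** The right side depends on the word only through its letter counts, so on products the order of
    differentiation is irrelevant. *)
Lemma foldr_partial_prod_fun al s : (forall l, smooth1 (al l)) ->
  foldr partial (prod_fun al) s = prod_fun (fun l => derive1n (count_mem l s) (al l)).
Proof.
move=> sal; have sn k l : smooth1 (derive1n k (al l)).
  by elim: k => [|k IH]; [rewrite derive1n0|rewrite derive1nS; exact: smooth1_derive].
elim: s => [|i s IH] //=.
rewrite IH; have [-> _] := @partial_prod_fun i (fun l => derive1n (count_mem l s) (al l)) (fun l => sn _ l).
congr prod_fun; apply/funext => l; rewrite /upd; case: (eqVneq l i) => [->|li] /=.
  by rewrite add0n.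
by rewrite add0n.
Qed.

Lemma continuous_prod_fun al : (forall l, continuous (al l)) -> continuous (prod_fun al).
Proof.
move=> cal x; rewrite /prod_fun.
have H (r : seq 'I_d) : {for x, continuous (fun y : 'rV[R]_d => \prod_(l <- r) al l (y ord0 l))}.
  elim: r => [|l r IH].
    by rewrite (_ : (fun y => _) = cst 1); [exact: (@cst_continuous _ _ (1 : R) x)|apply/funext => y; rewrite big_nil].
  rewrite (_ : (fun y => _) = (fun y : 'rV[R]_d => al l (y ord0 l) * \prod_(l <- r) al l (y ord0 l))).
    have cl : {for x, continuous (al l \o (fun y : 'rV[R]_d => y ord0 l))}.
      by apply: continuous_comp; [exact: coord_continuous|exact: cal].
    exact: (@continuousM _ _ _ _ x cl IH).
  by apply/funext => y; rewrite big_cons.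
exact: H.
Qed.

Lemma smooth_prod_fun al : (forall l, smooth1 (al l)) -> smooth (prod_fun al).
Proof.
move=> sal s; rewrite foldr_partial_prod_fun//.
have sn k l : smooth1 (derive1n k (al l)).
  by elim: k => [|k IH]; [rewrite derive1n0|rewrite derive1nS; exact: smooth1_derive].
split; first by apply: continuous_prod_fun => l; exact: smooth1_continuous.
by move=> i; have [] := @partial_prod_fun i _ (fun l => sn (count_mem l s) l).
Qed.

Lemma closed_box_compact (M : R) :
  compact [set v : 'rV[R]_d | forall i, `[- M, M]%classic (v ord0 i)].
Proof.
apply: (@rV_compact _ _ (fun=> `[- M, M]%classic)) => i; exact: segment_compact.
Qed.

Lemma compactly_supported_prod_fun al (M : R) :
  (forall l t, M <= `|t| -> al l t = 0) -> compactly_supported (prod_fun al).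
Proof.
move=> alM0; have cb := @closed_box_compact M.
have clb := compact_closed (@norm_hausdorff _ 'rV[R]_d) cb.
apply: (subclosed_compact (@closed_closure _ _) cb).
rewrite closureE => y; apply; split; first exact: clb.
move=> x /= px i; rewrite in_itv/= -ler_norml leNgt; apply/negP => Mx.
by move/eqP: px; apply; rewrite (prod_fun_D1 i) (alM0 i _ (ltW Mx)) mul0r.
Qed.

End tests.

(** * The substitution on the open cube *)

Section change_of_variables.
Context {R : realType} {d : nat}.
Variables psi rho : 'I_d -> R -> R.
Hypothesis Ht : forall l, univariate_transformation (psi l).
Hypothesis Hd : forall l, density (psi l) (rho l).
Hypothesis crho : forall l, continuous (rho l).
Local Notation lam := (@lebesgue_rV R d).
Local Notation ob := (open_box d (- 2^-1 : R) 2^-1).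
Local Notation X := (rV_map (fun l => inv_transf (psi l))).
Local Notation P := (rV_map psi).
Local Notation J := (prod_fun rho).

Lemma rV_mapE n (f : 'I_n -> R -> R) y l : rV_map f y ord0 l = f l (y ord0 l).
Proof. by rewrite mxE. Qed.

Lemma inv_map_in y : ob (X y).
Proof. by move=> l; rewrite rV_mapE; exact: inv_transf_in. Qed.

Lemma map_inv_mapK y : P (X y) = y.
Proof. by apply/rowP => l; rewrite !mxE transfK. Qed.

Lemma prod_rho_ge0 y : 0 <= J y.
Proof. by apply: prodr_ge0 => l _; exact/ltW/(rho_gt0 (Ht l) (Hd l)). Qed.

Lemma measurable_inv_map : measurable_fun setT (X : 'rV[R]_d -> 'rV[R]_d).
Proof.
apply: measurable_rV_map => l; apply: continuous_measurable_fun.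
exact: (inv_transf_continuous (Hd l)).
Qed.

Lemma measurable_prod_rho : measurable_fun setT J.
Proof. exact: measurable_prod_fun. Qed.

Lemma measurable_comp_map (g : 'rV[R]_d -> R) :
  measurable_fun setT g -> measurable_fun ob (fun x => g (P x)).
Proof.
move=> mg.
(* Nothing is known about [psi] outside the open interval; the extension by zero is measurable on
   the line and agrees with it on the open cube. *)
pose psi0 l : R -> R := psi l \_ [set` @Ihalf R].
have mpsi0 l : measurable_fun setT (psi0 l : measurableTypeR R -> measurableTypeR R).
  have mI : measurable ([set` @Ihalf R] : set (measurableTypeR R)) by exact: measurable_itv.
  exact: ((@measurable_restrictT _ _ (measurableTypeR R) (measurableTypeR R) _ (psi l) mI).1 (measurable_psi (Ht l))).
apply: (eq_measurable_fun (g \o rV_map psi0)).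
  move=> x; rewrite inE => obx /=; congr g; apply/rowP => l; rewrite !mxE /psi0 patchE.
  by rewrite mem_set//; exact: obx.
exact: measurable_funTS (measurableT_comp mg (measurable_rV_map mpsi0)).
Qed.

Lemma ge0_integral_transf (G : 'rV[R]_d -> \bar R) : measurable_fun ob G ->
  (forall x, ob x -> 0 <= G x)%E ->
  (\int[lam]_y (G (X y) * (J y)%:E) = \int[lam]_(x in ob) G x)%E.
Proof.
move=> mG G0.
have mob := @measurable_open_box R d (- 2^-1) 2^-1.
have mG' : measurable_fun setT (G \_ ob) by exact: (measurable_restrictT G mob).1.
have G0' x : (0 <= (G \_ ob) x)%E by rewrite patchE; case: ifPn => // /set_mem; exact: G0.
have h1 l : measurable_fun setT (inv_transf (psi l) : measurableTypeR R -> measurableTypeR R).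
  by apply: continuous_measurable_fun; exact: (inv_transf_continuous (Hd l)).
have h2 l : measurable_fun setT (rho l : measurableTypeR R -> measurableTypeR R).
  exact: continuous_measurable_fun.
have h3 l y : 0 <= rho l y by exact/ltW/(rho_gt0 (Ht l) (Hd l)).
have h4 l (K : R -> \bar R) : measurable_fun setT K -> (forall x, 0 <= K x)%E ->
    (\int[@lebesgue_measure R]_y (K (inv_transf (psi l) y) * (rho l y)%:E) =
     \int[@lebesgue_measure R]_(x in `](- 2^-1)%R, (2^-1)%R[%classic) K x)%E.
  move=> mK K0; apply: (@ge0_integral_chi _ _ (psi l)) => //.
  - exact: inv_transf_is_derive (Hd l).
  - by move=> y; exact: (rho_gt0 (Ht l) (Hd l)).
  - exact: inv_transf_in.
  - by move=> x; exact: (inv_transfK (Ht l)).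
  - exact: (measurable_psi (Ht l)).
  - exact: measurable_funTS.
have := ge0_integral_rV_map h1 h2 h3 h4 mG' G0'.
rewrite (eq_integral (fun y => G (X y) * (J y)%:E))%E; last first.
  by move=> y _; rewrite patchE mem_set//; exact: inv_map_in.
move=> ->; apply: eq_integral => x; rewrite inE => obx.
by rewrite patchE mem_set.
Qed.

Lemma integral_transf (G : 'rV[R]_d -> R) : measurable_fun ob G ->
  \int[lam]_(x in ob) G x = \int[lam]_y (G (X y) * J y).
Proof.
move=> mG; rewrite /Rintegral; congr fine.
have mG' : measurable_fun ob (EFin \o G) by exact/measurable_EFinP.
rewrite [LHS]integralE [RHS]integralE; congr (_ - _)%E.
- rewrite -(ge0_integral_transf (measurable_funepos mG')) => [|x _]; last exact: funepos_ge0.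
  apply: eq_integral => y _; rewrite !funeposE/=.
  by rewrite -!EFin_max -EFinM maxr_pMl ?mul0r// prod_rho_ge0.
- rewrite -(ge0_integral_transf (measurable_funeneg mG')) => [|x _]; last exact: funeneg_ge0.
  apply: eq_integral => y _; rewrite !funenegE/=.
  by rewrite -!EFin_max -EFinM maxr_pMl ?mul0r ?mulNr// prod_rho_ge0.
Qed.

(** By the substitution its integral is the volume of the open cube. *)
Lemma integrable_prod_rho : lam.-integrable setT (EFin \o J).
Proof.
apply/integrableP; split; first by apply/measurable_EFinP; exact: measurable_prod_rho.
rewrite (_ : (fun y => _) = (fun y => cst 1 (X y) * (J y)%:E)%E); last first.
  by apply/funext => y; rewrite [LHS]/= /cst mul1e (ger0_norm (prod_rho_ge0 y)).
rewrite ge0_integral_transf//.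
rewrite integral_cst ?mul1e; last exact: measurable_open_box.
apply: (lebesgue_rV_fin_box (A := fun=> `](- 2^-1)%R, (2^-1)%R[%classic)) => _.
  exact: measurable_itv.
by rewrite lebesgue_measure_itv/= lte_fin; case: ifP => // _; rewrite -EFinB ltry.
Qed.

End change_of_variables.

(** * One integration by parts in the transformed variable *)

Section transfer.
Context {R : realType} {d : nat}.
Variables psi rho : 'I_d -> R -> R.
Hypothesis Ht : forall l, univariate_transformation (psi l).
Hypothesis Hd : forall l, density (psi l) (rho l).
Hypothesis crho : forall l, continuous (rho l).
Hypothesis brho : forall l, bounded_fun (rho l).
Local Notation lam := (@lebesgue_rV R d).
Local Notation X := (rV_map (fun l => inv_transf (psi l))).
Local Notation J := (prod_fun rho).
Local Notation Q := (prod_fun (fun l y => Num.sqrt (rho l y))).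
Local Notation e i := (delta_mx ord0 i : 'rV[R]_d).
Implicit Types (a : 'I_d -> R -> R) (phi : 'rV[R]_d -> R).

Let rho_pos l y : 0 < rho l y := rho_gt0 (Ht l) (Hd l) y.

Definition tame l (f : R -> R) :=
  measurable_fun setT f /\ exists C : R, forall y, f y ^+ 2 * rho l y <= C.

Lemma prod_fun_eq a1 a2 (y : 'rV[R]_d) : (forall l, a1 l (y ord0 l) = a2 l (y ord0 l)) ->
  prod_fun a1 y = prod_fun a2 y.
Proof. by move=> E; apply: eq_bigr. Qed.

Lemma prod_funM a1 a2 (y : 'rV[R]_d) : prod_fun a1 y * prod_fun a2 y =
  prod_fun (fun l t => a1 l t * a2 l t) y.
Proof. by rewrite /prod_fun -big_split. Qed.

Lemma prod_sqrt_ge0 y : 0 <= Q y.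
Proof. by apply: prodr_ge0 => l _; exact: sqrtr_ge0. Qed.

Lemma sqr_prod_sqrt y : Q y ^+ 2 = J y.
Proof.
by rewrite expr2 prod_funM; apply: prod_fun_eq => l; rewrite -expr2 sqr_sqrtr// ltW.
Qed.

Lemma prod_fun_le a1 a2 (y : 'rV[R]_d) : (forall l, `|a1 l (y ord0 l)| <= a2 l (y ord0 l)) ->
  `|prod_fun a1 y| <= prod_fun a2 y.
Proof. by move=> h; rewrite /prod_fun normr_prod; apply: ler_prod => l _; rewrite normr_ge0 h. Qed.

Lemma continuous_sqrt (f : R -> R) : continuous f -> continuous (fun y => Num.sqrt (f y)).
Proof.
by move=> cf y; apply: (@continuous_comp _ _ _ f (@Num.sqrt R) y); [exact: cf|exact: sqrt_continuous].
Qed.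

Lemma measurable_prod_sqrt : measurable_fun setT Q.
Proof. by apply: measurable_prod_fun => l; exact: continuous_sqrt. Qed.

Lemma sq_integrable_prod_sqrt : sq_integrable Q.
Proof.
split; first exact: measurable_prod_sqrt.
rewrite (_ : (fun y => _) = EFin \o J); first exact: integrable_prod_rho.
by apply/funext => y; rewrite sqr_prod_sqrt.
Qed.

Lemma measurable_tame_prod a : (forall l, tame l (a l)) -> measurable_fun setT (prod_fun a).
Proof.
move=> ta; apply: measurable_prod => l _.
by apply: (measurableT_comp _ (measurable_rV_coord l)); case: (ta l).
Qed.

Lemma tame_bound l f : tame l f ->
  exists C : R, 0 <= C /\ forall y, `|f y| * Num.sqrt (rho l y) <= C.
Proof.
move=> [_ [C HC]]; exists (Num.sqrt C); split=> [|y]; first exact: sqrtr_ge0.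
rewrite -sqrtr_sqr -sqrtrM ?sqr_ge0//; exact: ler_wsqrtr.
Qed.

Lemma tame_prod_bound a : (forall l, tame l (a l)) ->
  exists K : R, 0 <= K /\ forall y, `|prod_fun a y * Q y| <= K.
Proof.
move=> ta; have /choice[C HC] l := tame_bound (ta l).
exists (\prod_l C l); split=> [|y]; first by apply: prodr_ge0 => l _; case: (HC l).
rewrite prod_funM; apply: (@prod_fun_le _ (fun l _ => C l) y) => l.
by rewrite normrM (ger0_norm (sqrtr_ge0 _)); case: (HC l).
Qed.

Lemma tame_prod_bound_rho a : (forall l, tame l (a l)) ->
  exists K : R, 0 <= K /\ forall y, `|prod_fun a y * J y| <= K * Q y.
Proof.
move=> ta; have [K [K0 HK]] := tame_prod_bound ta; exists K; split=> // y.
rewrite -sqr_prod_sqrt expr2 mulrA normrM (ger0_norm (prod_sqrt_ge0 y)).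
exact: ler_wpM2r (prod_sqrt_ge0 y) _ _ (HK y).
Qed.

Lemma sq_integrableZ (k : R) (u : 'rV[R]_d -> R) : sq_integrable u ->
  sq_integrable (fun y => k * u y).
Proof.
move=> [mu iu]; split; first exact: measurable_funM.
rewrite (_ : (fun y => _) = (fun y => (k ^+ 2)%:E * (u y ^+ 2)%:E)%E).
  exact: integrableZl.
by apply/funext => y; rewrite exprMn EFinM.
Qed.

Lemma sq_integrable_tame (u : 'rV[R]_d -> R) a : (forall l, tame l (a l)) ->
  sq_integrable u -> sq_integrable (fun y => u y * prod_fun a y * Q y).
Proof.
move=> ta hu; have [K [K0 HK]] := tame_prod_bound ta.
apply: (sq_integrable_le _ (sq_integrableZ K hu)).
  apply: measurable_funM; last exact: measurable_prod_sqrt.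
  by apply: measurable_funM; [case: hu|exact: measurable_tame_prod].
by move=> y; rewrite -mulrA normrM [leRHS]normrM (ger0_norm K0) mulrC ler_wpM2r.
Qed.

Lemma continuous_box_bounded phi : continuous phi ->
  exists M : R, 0 <= M /\ forall y, `|phi (X y)| <= M.
Proof.
move=> cphi; have cb := @closed_box_compact R d 2^-1.
have /compact_bounded [M [_ HM]] := continuous_compact (continuous_subspaceT cphi) cb.
exists (`|M| + 1); split=> [|y]; first by rewrite addr_ge0.
apply: (HM (`|M| + 1)); first by rewrite (le_lt_trans (ler_norm M))// ltrDl.
exists (X y) => // l; have := @inv_map_in R d psi Ht y l.
by rewrite /= !in_itv/= => /andP[/ltW-> /ltW->].
Qed.

Lemma measurable_phi_X phi : continuous phi -> measurable_fun setT (fun y => phi (X y)).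
Proof.
move=> cphi; apply: (measurableT_comp (continuous_measurable_rV cphi)).
exact: (measurable_inv_map Hd).
Qed.

Definition kernel a phi (y : 'rV[R]_d) := prod_fun a y * J y * phi (X y).

Lemma kernel_bound a phi : (forall l, tame l (a l)) -> continuous phi ->
  exists C : R, 0 <= C /\ forall y, `|kernel a phi y| <= C * Q y.
Proof.
move=> ta cphi; have [K [K0 HK]] := tame_prod_bound_rho ta.
have [M [M0 HM]] := continuous_box_bounded cphi.
exists (K * M); split=> [|y]; first exact: mulr_ge0.
by rewrite /kernel normrM mulrAC; apply: ler_pM.
Qed.

Lemma sq_integrable_kernel a phi : (forall l, tame l (a l)) -> continuous phi ->
  sq_integrable (kernel a phi).
Proof.
move=> ta cphi; have [C [C0 HC]] := kernel_bound ta cphi.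
apply: (sq_integrable_le _ (sq_integrableZ C sq_integrable_prod_sqrt)).
  apply: measurable_funM; last exact: measurable_phi_X.
  by apply: measurable_funM; [exact: measurable_tame_prod|exact: measurable_prod_rho].
by move=> y; rewrite [leRHS]ger0_norm ?mulr_ge0 ?prod_sqrt_ge0.
Qed.

Lemma tame_upd i f a : tame i f -> (forall l, tame l (a l)) -> forall l, tame l (upd i f a l).
Proof. by move=> tf ta l; rewrite /upd; case: eqP => // ->. Qed.

Lemma upd_id i a : upd i (a i) a = a.
Proof. by apply/funext => l; rewrite /upd; case: eqP => // ->. Qed.

Lemma kernel_upd i f a phi y : kernel (upd i f a) phi y = f (y ord0 i) * rho i (y ord0 i) *
  (\prod_(l | l != i) (a l (y ord0 l) * rho l (y ord0 l)) * phi (X y)).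
Proof.
rewrite /kernel prod_fun_upd (prod_fun_D1 i rho) big_split/=; ring.
Qed.

Lemma inv_map_shift i y (t : R) :
  X (y + t *: e i) = X y + (inv_transf (psi i) (1 * t + y ord0 i) - inv_transf (psi i) (y ord0 i)) *: e i.
Proof.
apply/rowP => l; rewrite shiftE !rV_mapE shiftE; case: eqP => [->|_].
  by rewrite !mulr1 mul1r [t + _]addrC [RHS]addrC subrK.
by rewrite !mulr0 !addr0.
Qed.

Lemma is_derive_phi_X i phi y : (forall x, derivable phi x (e i)) ->
  is_derive (0 : R) 1 (fun t : R => phi (X (y + t *: e i)))
    (partial i phi (X y) * rho i (y ord0 i)).
Proof.
move=> dphi; under eq_fun do rewrite inv_map_shift.
have h0 : is_derive (1 * 0 + y ord0 i) 1 (inv_transf (psi i)) (rho i (y ord0 i)).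
  by rewrite mulr0 add0r; exact: (inv_transf_is_derive (Hd i)).
have h1 := is_derive1_affine h0; rewrite mulr1 in h1.
have h2 := is_derive1D h1 (is_derive_cst (- inv_transf (psi i) (y ord0 i)) (0 : R) 1).
rewrite addr0 in h2.
have h3 : is_derive (inv_transf (psi i) (1 * 0 + y ord0 i) + (- inv_transf (psi i) (y ord0 i))) 1
    (fun s : R => phi (X y + s *: e i)) (partial i phi (X y)).
  by rewrite mulr0 add0r subrr; exact: partialE.
exact: (@is_derive1_comp _ (fun s : R => phi (X y + s *: e i))
  (fun t : R => inv_transf (psi i) (1 * t + y ord0 i) - inv_transf (psi i) (y ord0 i))
  0 _ _ h3 h2).
Qed.

(** Dividing [f] by [rho i] cancels the factor [rho i] of the density, so [rho i] itself is never
    differentiated. The derivatives of [f] and of [phi] along the inverse map each bring back one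
    factor [rho i], which completes the density again. *)
Lemma is_derive_kernel i f a f' phi y : (forall x, derivable phi x (e i)) ->
  (forall y : R, is_derive y 1 f (rho i y * f' y)) ->
  is_derive (0 : R) 1
    (fun t : R => kernel (upd i (fun y => (rho i y)^-1 * f y) a) phi (y + t *: e i))
    (kernel (upd i f' a) phi y + kernel (upd i f a) (partial i phi) y).
Proof.
move=> dphi df; rewrite !kernel_upd.
set D := \prod_(l | _) _.
rewrite (_ : (fun t => _) =
  (fun t : R => f (1 * t + y ord0 i) * (cst D t * phi (X (y + t *: e i))))); last first.
  apply/funext => t; rewrite kernel_upd shiftE eqxx mulr1 mul1r [t + _]addrC; congr (_ * (_ * _)).
    by rewrite mulrAC mulVf ?mul1r// gt_eqF.
  by apply: eq_bigr => l /negbTE li; rewrite shiftE li mulr0 addr0.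
have h0 : is_derive (1 * 0 + y ord0 i) 1 f (rho i (y ord0 i) * f' (y ord0 i)).
  by rewrite mulr0 add0r.
have h1 := is_derive1_affine h0; rewrite mulr1 in h1.
have h2 := is_derive1M (is_derive_cst D (0 : R) 1) (is_derive_phi_X y dphi).
have h3 := is_derive1M h1 h2.
rewrite mulr0 add0r scale0r addr0 mul0r add0r in h3.
apply: is_derive_eq h3 _; rewrite /cst; ring.
Qed.

(** The weight to differentiate is the kernel with [a i] divided by [rho i]: its derivative contains
    the wanted kernel against [partial i phi] as one of two summands. *)
Lemma transfer_step i a (a' : R -> R) (u v : 'rV[R]_d -> R) phi : (forall l, tame l (a l)) ->
  tame i a' -> tame i (fun y => (rho i y)^-1 * a i y) ->
  (forall y : R, is_derive y 1 (a i) (rho i y * a' y)) ->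
  sq_integrable u -> sq_integrable v -> weak_partial i u v ->
  continuous phi -> continuous (partial i phi) -> (forall x, derivable phi x (e i)) ->
  \int[lam]_y (u y * kernel a (partial i phi) y) =
  (- \int[lam]_y (u y * kernel (upd i a' a) phi y))
  - \int[lam]_y (v y * kernel (upd i (fun y => (rho i y)^-1 * a i y) a) phi y).
Proof.
move=> ta ta' tra da hu hv huv cphi cdphi dphi.
set b := upd i (fun y => (rho i y)^-1 * a i y) a; set b' := upd i a' a.
have tb : forall l, tame l (b l) by exact: tame_upd.
have tb' : forall l, tame l (b' l) by exact: tame_upd.
have [C1 [C10 HC1]] := kernel_bound tb cphi.
have [C2 [C20 HC2]] := kernel_bound tb' cphi.
have [C3 [C30 HC3]] := kernel_bound ta cdphi.
have [Cr HCr] := brho i.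
pose c := Num.sqrt Cr; have c0 : 0 <= c by exact: sqrtr_ge0.
pose C := C1 + (C2 + C3); have C0 : 0 <= C by rewrite !addr_ge0.
(* The factor [sqrt rho_i] of the natural majorant is replaced by its bound [c], which makes [B]
   constant along [e i]. *)
pose B y := C * c * prod_fun (upd i (fun=> 1) (fun l y => Num.sqrt (rho l y))) y.
have BE y : B y = C * c * \prod_(l | l != i) Num.sqrt (rho l (y ord0 l)).
  by rewrite /B prod_fun_upd mul1r.
have D0 (y : 'rV[R]_d) : 0 <= \prod_(l | l != i) Num.sqrt (rho l (y ord0 l)).
  by apply: prodr_ge0 => l _; exact: sqrtr_ge0.
have QB y : C * Q y <= B y.
  rewrite BE -mulrA ler_wpM2l// (prod_fun_D1 i) ler_wpM2r//.
  apply: ler_wsqrtr; exact: le_trans (ler_norm _) (HCr _).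
have PQ y : `|kernel b phi y| <= C * Q y.
  apply: le_trans (HC1 y) _; rewrite ler_wpM2r ?prod_sqrt_ge0//.
  by rewrite lerDl addr_ge0.
have PQ' y : `|kernel b' phi y + kernel a (partial i phi) y| <= C * Q y.
  apply: le_trans (ler_normD _ _) _; apply: le_trans (lerD (HC2 y) (HC3 y)) _.
  by rewrite -mulrDl ler_wpM2r ?prod_sqrt_ge0// lerDr.
have mB : measurable_fun setT B.
  apply: measurable_funM => //; apply: measurable_prod_fun => l; rewrite /upd.
  by case: eqP => _; [move=> x; exact: cvg_cst|exact: continuous_sqrt].
have k1 := sq_integrable_kernel tb cphi.
have k2 := sq_integrable_kernel tb' cphi.
have k3 := sq_integrable_kernel ta cdphi.
have k23 := sq_integrableD k2 k3.
have dK y : is_derive (0 : R) 1 (fun t : R => kernel b phi (y + t *: e i))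
    (kernel b' phi y + kernel a (partial i phi) y).
  have h := is_derive_kernel a y dphi da; rewrite upd_id in h; exact: h.
have Bsh y (t : R) : B (y + t *: e i) = B y.
  by rewrite /B prod_fun_shift prod_fun_upd /upd eqxx; congr (_ * (_ * _)); apply: eq_bigr => l /negbTE ->.
have BN (N : R) : sq_integrable (fun y => B y * \1_(`[- N, N]%classic) (y ord0 i)).
  (* On a bounded range of [y_i] the continuous positive [rho i] has a positive minimum, so there
     [B] is at most a constant multiple of the square-integrable product of the [sqrt rho_l]. *)
  have [cN [cN0 HcN]] : exists cN : R, 0 < cN /\ forall t, `|t| <= `|N| -> cN <= rho i t.
    have NN : - `|N| <= `|N| by rewrite ge0_cp.
    have [z _ Hz] := EVT_min NN (continuous_subspaceT (@crho i)).
    by exists (rho i z); split=> // t tN; apply: Hz; rewrite in_itv/= -ler_norml.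
  have sc0 : 0 < Num.sqrt cN by rewrite sqrtr_gt0.
  apply: (sq_integrable_le _ (sq_integrableZ (C * c / Num.sqrt cN) sq_integrable_prod_sqrt)).
    apply: measurable_funM => //.
    apply: (measurableT_comp _ (measurable_rV_coord i)).
    exact: (measurable_indic (measurable_itv `[- N, N])).
  move=> y; rewrite [leRHS]ger0_norm ?mulr_ge0 ?prod_sqrt_ge0 ?invr_ge0 ?sqrtr_ge0//.
  rewrite indicE; case: (boolP (_ \in _)) => yN; last first.
    by rewrite mulr0 normr0 !mulr_ge0 ?prod_sqrt_ge0 ?invr_ge0 ?sqrtr_ge0.
  move: yN; rewrite mulr1 inE /= in_itv/= -ler_norml => yN.
  rewrite ger0_norm ?BE ?mulr_ge0// -[leRHS]mulrA ler_wpM2l ?mulr_ge0//.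
  rewrite (prod_fun_D1 i) mulrA ler_peMl// mulrC ler_pdivlMr// mul1r.
  by apply: ler_wsqrtr; apply: HcN; apply: le_trans yN (ler_norm _).
have := weak_partial_extend hu hv huv k1 k23 dK Bsh (fun y => le_trans (PQ y) (QB y))
  (fun y => le_trans (PQ' y) (QB y)) BN.
under eq_Rintegral do rewrite mulrDr.
rewrite RintegralD//; [|exact: (sq_integrableM hu k2)|exact: (sq_integrableM hu k3)].
by move=> E; rewrite -E addKr.
Qed.

End transfer.

(** * Iterated integration by parts *)

Section iteration.
Context {R : realType} {d : nat}.
Variables (m : nat) (psi rho : 'I_d -> R -> R) (F : 'I_d -> nat -> R -> R).
Hypothesis Ht : forall l, univariate_transformation (psi l).
Hypothesis Hd : forall l, density (psi l) (rho l).
Hypothesis rhoC : forall l, Cb m (rho l).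
Hypothesis dF : forall l i (y : R), (i < m)%N ->
  is_derive y 1 (F l i) (rho l y * F l i.+1 y).
Hypothesis mF : forall l i, (i <= m)%N -> measurable_fun setT (F l i).
Hypothesis F_bound0 : forall l b, (b <= m)%N ->
  exists C : R, forall y, F l b y ^+ 2 * rho l y <= C.
Hypothesis F_bound : forall l i j, (0 < j)%N -> (i + j <= m)%N ->
  exists C : R, forall y, F l i y ^+ 2 <= C * rho l y ^+ (4 * j - 3).
Local Notation lam := (@lebesgue_rV R d).
Local Notation X := (rV_map (fun l => inv_transf (psi l))).
Local Notation J := (prod_fun rho).
Local Notation Q := (prod_fun (fun l y => Num.sqrt (rho l y))).
Local Notation kernel := (kernel psi rho).
Implicit Types (phi : 'rV[R]_d -> R) (g beta : 'I_d -> nat).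

Let rho_pos l y : 0 < rho l y := rho_gt0 (Ht l) (Hd l) y.
Let crho l : continuous (rho l) := Cb_continuous (rhoC l).
Let brho l : bounded_fun (rho l) := Cb_bounded (rhoC l).

(** The sum has the shape to which [count_mem l (i :: s)] reduces. *)
Definition idx_succ (i : 'I_d) g : 'I_d -> nat := fun l => ((i == l) + g l)%N.

(* A pair (g, a) stands for the summand (D^g h) * prod_l a_l of a derivative of
   the transformed function. *)
Definition summand := (('I_d -> nat) * ('I_d -> R -> R))%type.

(** The multi-index [beta] records the derivatives already taken off the test function, whether they
    went to h or to the coefficients. *)
Definition admissible beta (s : summand) :=
  forall l, (s.1 l <= beta l)%N /\ lincomb m (rho l) (F l) (beta l) (s.2 l).

Fixpoint all_admissible beta (L : seq summand) : Prop :=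
  if L is s :: L' then admissible beta s /\ all_admissible beta L' else True.

Definition sum_value (U : ('I_d -> nat) -> 'rV[R]_d -> R) (L : seq summand) y : R :=
  \sum_(s <- L) U s.1 y * prod_fun s.2 y.

Definition weak_family (U : ('I_d -> nat) -> 'rV[R]_d -> R) :=
  (forall g, (forall l, g l <= m)%N -> sq_integrable (U g)) /\
  (forall i g, (forall l, g l <= m)%N -> (g i < m)%N ->
    weak_partial i (U g) (U (idx_succ i g))).

Definition pairing U L phi := \int[lam]_y (sum_value U L y * (J y * phi (X y))).

Lemma sum_value_cons U s L y : sum_value U (s :: L) y =
  U s.1 y * prod_fun s.2 y + sum_value U L y.
Proof. by rewrite /sum_value big_cons. Qed.

Lemma lincomb_tame l b a : (b <= m)%N -> lincomb m (rho l) (F l) b a -> tame rho l a.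
Proof.
move=> bm h; split.
  exact: (measurable_lincomb (rho_pos l) (rhoC l) (@mF l) bm h).
exact: (lincomb_bound0 (rho_pos l) (@F_bound0 l) (@F_bound l) bm h).
Qed.

Lemma admissible_tame beta s : (forall l, beta l <= m)%N -> admissible beta s ->
  forall l, tame rho l (s.2 l).
Proof. by move=> bm hs l; apply: lincomb_tame (bm l) _; case: (hs l). Qed.

Lemma admissible_le beta s : (forall l, beta l <= m)%N -> admissible beta s ->
  forall l, (s.1 l <= m)%N.
Proof. by move=> bm hs l; apply: leq_trans (bm l); case: (hs l). Qed.

Lemma sq_integrable_sum_value U beta L : (forall l, beta l <= m)%N ->
  all_admissible beta L -> weak_family U ->
  sq_integrable (fun y => sum_value U L y * Q y).
Proof.
move=> bm + [hU _]; elim: L => [_|s L IH [hs hL]].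
  rewrite (_ : (fun y => _) = (fun y => 0 * Q y)); last first.
    by apply/funext => y; rewrite /sum_value big_nil.
  exact: sq_integrableZ (sq_integrable_prod_sqrt Ht Hd crho).
under eq_fun do rewrite sum_value_cons mulrDl.
apply: sq_integrableD (IH hL).
apply: sq_integrable_tame => //; first exact: admissible_tame hs.
by apply: hU; exact: admissible_le hs.
Qed.

Lemma measurable_sum_value U beta L : (forall l, beta l <= m)%N ->
  all_admissible beta L -> weak_family U -> measurable_fun setT (sum_value U L).
Proof.
move=> bm + [hU _]; elim: L => [_|s L IH [hs hL]].
  rewrite (_ : sum_value U [::] = cst 0)//.
  by apply/funext => y; rewrite /sum_value big_nil.
rewrite (_ : sum_value U _ = (fun y => U s.1 y * prod_fun s.2 y + sum_value U L y)); last first.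
  by apply/funext => y; rewrite sum_value_cons.
apply: measurable_funD (IH hL); apply: measurable_funM.
  by have [] := hU _ (admissible_le bm hs).
exact: measurable_tame_prod (admissible_tame bm hs).
Qed.

(** The density is split as the square of its root: one root makes the sum square integrable, the
    other does so for the bounded test function. *)
Lemma integrable_pairing U beta L phi : (forall l, beta l <= m)%N ->
  all_admissible beta L -> weak_family U -> continuous phi ->
  lam.-integrable setT (fun y => (sum_value U L y * (J y * phi (X y)))%:E).
Proof.
move=> bm hL hU cphi.
have t1 l : tame rho l (fun=> 1).
  have [C HC] := brho l; split=> //; exists C => y.
  by rewrite expr1n mul1r; exact: le_trans (ler_norm _) (HC y).
have [C [C0 HC]] := kernel_bound Ht Hd t1 cphi.
pose w y := phi (X y) * Q y.
have hw : sq_integrable w.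
  have [M [M0 HM]] := continuous_box_bounded Ht cphi.
  apply: (sq_integrable_le _ (sq_integrableZ M (sq_integrable_prod_sqrt Ht Hd crho))).
    by apply: measurable_funM; [exact: measurable_phi_X|exact: measurable_prod_sqrt].
  move=> y; rewrite !normrM (ger0_norm M0) ler_wpM2r//; exact: HM.
have := sq_integrableM (sq_integrable_sum_value bm hL hU) hw.
congr integrable; apply/funext => y; congr EFin.
rewrite /w -(sqr_prod_sqrt Ht Hd); ring.
Qed.

Lemma pairing_cons U beta s L phi : (forall l, beta l <= m)%N ->
  all_admissible beta (s :: L) -> weak_family U -> continuous phi ->
  pairing U (s :: L) phi = \int[lam]_y (U s.1 y * kernel s.2 phi y) + pairing U L phi.
Proof.
move=> bm [hs hL] hU cphi; rewrite /pairing.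
under eq_Rintegral do rewrite sum_value_cons mulrDl.
rewrite RintegralD//; last exact: integrable_pairing hL hU cphi.
  by congr (_ + _); apply: eq_Rintegral => y _; rewrite /kernel !mulrA.
have := @integrable_pairing U beta [:: s] phi bm (conj hs I) hU cphi.
by congr integrable; apply/funext => y; rewrite /sum_value big_cons big_nil addr0.
Qed.

Lemma pairing_nil U phi : pairing U [::] phi = 0.
Proof.
rewrite /pairing /Rintegral integral0_eq// => y _.
by rewrite /sum_value big_nil mul0r.
Qed.

(** The derivative taken off [phi] falls either on the coefficient ([s1]) or on the function ([s2]).
    The list is chosen before [U] and [phi], so it serves real and imaginary parts and all test
    functions alike. *)
Lemma step_admissible beta i s : (forall l, beta l <= m)%N -> (beta i < m)%N ->
  admissible beta s -> exists L, all_admissible (idx_succ i beta) L /\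
    forall U phi, weak_family U -> smooth phi ->
      \int[lam]_y (U s.1 y * kernel s.2 (partial i phi) y) = - pairing U L phi.
Proof.
move=> bm bi hs; have [gi ai] := hs i.
have [a' la' da'] := lincomb_derive (rho_pos i) (rhoC i) (@dF i) bi ai.
have lra' := lincomb_rhoV (rho_pos i) (rhoC i) bi ai.
pose s1 : summand := (s.1, upd i a' s.2).
pose s2 : summand := (idx_succ i s.1, upd i (fun y => (rho i y)^-1 * s.2 i y) s.2).
have bm' l : (idx_succ i beta l <= m)%N.
  by rewrite /idx_succ; case: eqP => [<-|_]; [exact: bi|exact: bm].
have h1 : admissible (idx_succ i beta) s1.
  move=> l; have [gl al] := hs l; rewrite /s1 /upd /idx_succ /= [l == i]eq_sym.
  by case: eqP => [<-|_]; split => //; exact: leqW.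
have h2 : admissible (idx_succ i beta) s2.
  move=> l; have [gl al] := hs l; rewrite /s2 /upd /idx_succ /= [l == i]eq_sym.
  by case: eqP => [<-|_]; split.
exists [:: s1; s2]; split=> // U phi hU sphi.
have [cphi dphi] := sphi [::]; have [cdphi _] := sphi [:: i].
have ta := admissible_tame bm hs.
have [hU1 hU2] := hU; have gm := admissible_le bm hs.
have gim : (s.1 i < m)%N by exact: leq_ltn_trans gi bi.
rewrite (@pairing_cons U (idx_succ i beta))//.
rewrite (@pairing_cons U (idx_succ i beta))//.
rewrite pairing_nil addr0 opprD.
apply: (transfer_step Ht Hd crho brho ta (lincomb_tame bi la') (lincomb_tame bi lra') da') => //.
- exact: hU1.
- by apply: hU1 => l; rewrite /s2 /= /idx_succ; case: eqP => [<-|_]; [exact: gim|exact: gm].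
- exact: hU2.
Qed.

Lemma all_admissible_cat beta L1 L2 : all_admissible beta L1 -> all_admissible beta L2 ->
  all_admissible beta (L1 ++ L2).
Proof. by elim: L1 => //= s L IH [h1 h2] h3; split => //; exact: IH. Qed.

Lemma pairing_cat U beta L1 L2 phi : (forall l, beta l <= m)%N ->
  all_admissible beta L1 -> all_admissible beta L2 -> weak_family U -> continuous phi ->
  pairing U (L1 ++ L2) phi = pairing U L1 phi + pairing U L2 phi.
Proof.
move=> bm h1 h2 hU cphi; elim: L1 h1 => [_|s L IH /= [hs hL]].
  by rewrite pairing_nil add0r.
have hL12 := all_admissible_cat hL h2.
rewrite (@pairing_cons U beta)// (@pairing_cons U beta s L)// -addrA; congr (_ + _).
exact: IH.
Qed.

Lemma step_all_admissible beta i L : (forall l, beta l <= m)%N -> (beta i < m)%N ->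
  all_admissible beta L -> exists L', all_admissible (idx_succ i beta) L' /\
    forall U phi, weak_family U -> smooth phi ->
      pairing U L (partial i phi) = - pairing U L' phi.
Proof.
move=> bm bi; elim: L => [_|s L IH [hs hL]].
  by exists [::]; split => // U phi _ _; rewrite !pairing_nil oppr0.
have [L1 [h1 E1]] := step_admissible bm bi hs; have [L2 [h2 E2]] := IH hL.
have bm' l : (idx_succ i beta l <= m)%N.
  by rewrite /idx_succ; case: eqP => [<-|_]; [exact: bi|exact: bm].
exists (L1 ++ L2); split=> [|U phi hU sphi]; first exact: all_admissible_cat.
have [cphi _] := sphi [::]; have [cdphi _] := sphi [:: i].
rewrite (@pairing_cons U beta)// (@pairing_cat U (idx_succ i beta))//.
by rewrite E1// E2// opprD.
Qed.

(** The hypothesis is a budget: in each coordinate the derivatives still to be moved and those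
    already moved total at most [m], so every single step is allowed. *)
Lemma pairing_foldr_partial beta (s : seq 'I_d) L :
  (forall l, count_mem l s + beta l <= m)%N -> all_admissible beta L ->
  exists beta' L', [/\ (forall l, beta' l <= m)%N, all_admissible beta' L' &
    forall U phi, weak_family U -> smooth phi ->
      pairing U L (foldr partial phi s) = (-1) ^+ size s * pairing U L' phi].
Proof.
elim: s beta L => [|i s IH] beta L bm hL.
  by exists beta, L; split => // U phi _ _; rewrite expr0 mul1r.
have bm0 l : (beta l <= m)%N by apply: leq_trans (bm l); exact: leq_addl.
have bi : (beta i < m)%N.
  by apply: leq_trans (bm i); rewrite /= eqxx addnAC add1n ltnS leq_addr.
have [L1 [hL1 E1]] := step_all_admissible bm0 bi hL.
have bm1 l : (count_mem l s + idx_succ i beta l <= m)%N.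
  by apply: leq_trans (bm l); rewrite /idx_succ /= addnA [(_ + (i == l))%N]addnC.
have [beta' [L' [h1 h2 E2]]] := IH _ _ bm1 hL1.
exists beta', L'; split => // U phi hU sphi.
rewrite /= E1//; last exact: smooth_foldr.
by rewrite E2// exprS mulN1r mulNr.
Qed.

End iteration.

(** * The transformed function *)

Section complex_valued.
Context {R : realType} {d : nat}.
Local Notation lam := (@lebesgue_rV R d).
Local Notation normc := ComplexField.Normc.normc.
Implicit Types (z : R[i]) (f : 'rV[R]_d -> R[i]) (D : set 'rV[R]_d).

Lemma normc_sqr z : normc z ^+ 2 = complex.Re z ^+ 2 + complex.Im z ^+ 2.
Proof. by case: z => a b /=; rewrite sqr_sqrtr// addr_ge0// sqr_ge0. Qed.

Lemma ReMr z (r : R) : complex.Re (z * r%:C%C) = complex.Re z * r.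
Proof. by case: z => a b /=; rewrite mulr0 subr0. Qed.

Lemma ImMr z (r : R) : complex.Im (z * r%:C%C) = complex.Im z * r.
Proof. by case: z => a b /=; rewrite mulr0 add0r. Qed.

Lemma complex_signM n (a b : R) :
  (-1) ^+ n * Complex a b = Complex ((-1) ^+ n * a) ((-1) ^+ n * b).
Proof.
rewrite -signr_odd -[in RHS]signr_odd; case: (odd n); rewrite ?expr0 ?expr1.
  by rewrite !mulN1r.
by rewrite !mul1r.
Qed.

Lemma measurable_normc_sqr D f : cmeasurable D f ->
  measurable_fun D (fun x => (normc (f x) ^+ 2)%:E).
Proof.
move=> [mr mi]; apply/measurable_EFinP; under eq_fun do rewrite normc_sqr.
by apply: measurable_funD; exact: (measurable_funX 2).
Qed.

Lemma lty_poweR (x : \bar R) : (x `^ 2^-1 < +oo)%E -> (0 <= x)%E -> (x < +oo)%E.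
Proof.
case: x => [r| |]//; first by move=> _ _; exact: ltry.
by rewrite poweRyr ?invr_eq0 ?pnatr_eq0.
Qed.

Lemma L2norm_lty D f :
  (L2norm D f < +oo)%E <-> (\int[lam]_(x in D) (normc (f x) ^+ 2)%:E < +oo)%E.
Proof.
split=> [/lty_poweR|]; last exact: poweR_lty.
by apply; apply: integral_ge0 => x _; rewrite lee_fin sqr_ge0.
Qed.

Lemma mix_norm_lty m D (Df : {ffun 'I_d -> 'I_m.+1} -> 'rV[R]_d -> R[i]) :
  (mix_norm D Df < +oo)%E <-> forall alpha, (L2norm D (Df alpha) < +oo)%E.
Proof.
split=> [h alpha|h].
  have := lty_poweR h; rewrite sume_ge0// => [/(_ isT)|al _]; last by rewrite expe_ge0// poweR_ge0.
  rewrite (bigD1 alpha)//; set S := (\big[_/_]_(_ | _) _)%R => Soo.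
  have S0 : (0 <= S)%E by apply: sume_ge0 => al _; rewrite expe_ge0// poweR_ge0.
  have : (L2norm D (Df alpha) ^+ 2 < +oo)%E by apply: le_lt_trans Soo; exact: leeDl.
  have : (0 <= L2norm D (Df alpha))%E by exact: poweR_ge0.
  by case: (L2norm D (Df alpha)) => [r _ _| |]//; first exact: ltry.
apply: poweR_lty; apply: lte_sum_pinfty => alpha _; rewrite expe2.
have h0 : (0 <= L2norm D (Df alpha))%E by exact: poweR_ge0.
by apply: lte_mul_pinfty => //; rewrite ge0_fin_numE.
Qed.

Lemma sq_integrable_Re_Im f : cmeasurable setT f -> (L2norm setT f < +oo)%E ->
  sq_integrable (@complex.Re R \o f) /\ sq_integrable (@complex.Im R \o f).
Proof.
move=> mf /L2norm_lty foo; have mn := measurable_normc_sqr mf; have [mr mi] := mf.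
have inn : lam.-integrable setT (fun x => (normc (f x) ^+ 2)%:E).
  apply/integrableP; split=> //; apply: le_lt_trans foo; apply: ge0_le_integral => //.
  - exact: measurableT_comp.
  - by move=> x _; rewrite gee0_abs// lee_fin sqr_ge0.
split; split => //.
- apply: (le_integrable _ _ _ inn) => //.
    by apply/measurable_EFinP; exact: (measurable_funX 2).
  by move=> x _; rewrite !gee0_abs ?lee_fin ?sqr_ge0// normc_sqr lerDl sqr_ge0.
- apply: (le_integrable _ _ _ inn) => //.
    by apply/measurable_EFinP; exact: (measurable_funX 2).
  by move=> x _; rewrite !gee0_abs ?lee_fin ?sqr_ge0// normc_sqr lerDr sqr_ge0.
Qed.

End complex_valued.

(** * The half-open cube and its null faces *)

Section cube.
Context {R : realType} {d : nat}.
Local Notation lam := (@lebesgue_rV R d).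
Local Notation ob := (open_box d (- 2^-1 : R) 2^-1).

Lemma measurable_cube : measurable (@cube R d).
Proof.
apply: (@measurable_box _ _ (fun=> `[- 2^-1, 2^-1[%classic)) => i; exact: measurable_itv.
Qed.

Lemma open_box_cube : ob `<=` @cube R d.
Proof. by move=> x h i; have := h i; rewrite !in_itv/= => /andP[/ltW-> ->]. Qed.

(** The half-open and the open cube both have volume 1. *)
Lemma cube_faces_null : lam (@cube R d `\` ob) = 0%E.
Proof.
have half2 : 2^-1 + 2^-1 = 1 :> R by lra.
have lc : lam (@cube R d) = (\prod_(i < d) (1%:E : \bar R))%E.
  rewrite (@lebesgue_rV_box R d (fun=> `[(- 2^-1)%R, (2^-1)%R[%classic)) => [|i]; last exact: measurable_itv.
  by apply: eq_bigr => i _; rewrite lebesgue_measure_itv/= lte_fin gtrN ?invr_gt0// -EFinB opprK half2.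
have lo : lam ob = (\prod_(i < d) (1%:E : \bar R))%E.
  rewrite (@lebesgue_rV_box R d (fun=> `](- 2^-1)%R, (2^-1)%R[%classic)) => [|i]; last exact: measurable_itv.
  by apply: eq_bigr => i _; rewrite lebesgue_measure_itv/= lte_fin gtrN ?invr_gt0// -EFinB opprK half2.
rewrite measureD; [|exact: measurable_cube|exact: measurable_open_box|].
  rewrite (setIidr open_box_cube); transitivity (1 - 1 : \bar R)%E; last by rewrite subee.
  by congr (_ - _)%E; [apply: etrans lc _|apply: etrans lo _]; rewrite big1.
by apply: le_lt_trans (ltry (1 : R)); rewrite le_eqVlt; apply/orP; left; apply/eqP; apply: etrans lc _; rewrite big1.
Qed.

Lemma integral_cube (G : 'rV[R]_d -> \bar R) : measurable_fun (@cube R d) G ->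
  (\int[lam]_(x in @cube R d) G x = \int[lam]_(x in ob) G x)%E.
Proof.
move=> mG; have mob := @measurable_open_box R d (- 2^-1) 2^-1.
rewrite -[in RHS](setIidr open_box_cube) integral_mkcondr.
apply: ae_eq_integral => //; first exact: measurable_cube.
  by apply/(measurable_restrict _ _ measurable_cube) => //; apply: measurable_funS mG => //; exact: measurable_cube.
exists (@cube R d `\` ob); split; [|exact: cube_faces_null|].
  by apply: measurableD => //; exact: measurable_cube.
move=> x /= /not_implyP[cx h]; split=> // obx; apply: h.
by rewrite patchE mem_set.
Qed.

End cube.

(** * Measurability and L_2 norm of the transformed function *)

Section torus.
Context {R : realType} {d : nat}.
Variables psi rho omega : 'I_d -> R -> R.
Hypothesis Ht : forall l, univariate_transformation (psi l).
Hypothesis Hd : forall l, density (psi l) (rho l).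
Hypothesis crho : forall l, continuous (rho l).
Hypothesis Hw : forall l, weight_function (omega l).
Local Notation lam := (@lebesgue_rV R d).
Local Notation normc := ComplexField.Normc.normc.
Local Notation X := (rV_map (fun l => inv_transf (psi l))).
Local Notation P := (rV_map psi).
Local Notation J := (prod_fun rho).
Local Notation FF := (prod_fun (fun l => sqrt_factor (psi l) (omega l))).

(** The end point -1/2 belongs to the torus cell but not to the domain of a transformation; whatever
    value is taken there, a function on a singleton is measurable. *)
Lemma measurable_half_open (f : R -> R) : measurable_fun [set` @Ihalf R] f ->
  measurable_fun (`[- 2^-1, 2^-1[%classic : set (measurableTypeR R)) f.
Proof.
move=> mf; rewrite -(@setU1itv _ _ _ _ false); last by rewrite bnd_simp gtrN// invr_gt0.
apply/measurable_funU; [exact: measurable_set1|exact: measurable_itv|].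
by split => //; exact: measurable_fun_set1.
Qed.

Lemma measurable_cube_comp (G : 'I_d -> R -> R) (g : 'rV[R]_d -> R) :
  (forall l, measurable_fun [set` @Ihalf R] (G l)) -> measurable_fun setT g ->
  measurable_fun (@cube R d) (fun x => g (rV_map G x)).
Proof.
move=> mG mg; pose H : set (measurableTypeR R) := `[- 2^-1, 2^-1[%classic.
have mH : measurable H by exact: measurable_itv.
have mG0 l : measurable_fun setT ((G l \_ H) : measurableTypeR R -> measurableTypeR R).
  exact: ((@measurable_restrictT _ _ (measurableTypeR R) (measurableTypeR R) _ (G l) mH).1 (measurable_half_open (mG l))).
apply: (eq_measurable_fun (g \o rV_map (fun l => G l \_ H))).
  move=> x; rewrite inE => cx /=; congr g; apply/rowP => l; rewrite !mxE patchE.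
  by rewrite mem_set//; exact: cx.
exact: measurable_funTS (measurableT_comp mg (measurable_rV_map mG0)).
Qed.

Lemma measurable_cube_prod (G : 'I_d -> R -> R) :
  (forall l, measurable_fun [set` @Ihalf R] (G l)) -> measurable_fun (@cube R d) (prod_fun G).
Proof.
move=> mG.
have m1 : measurable_fun setT (prod_fun (fun (_ : 'I_d) (t : R) => t)).
  by apply: measurable_prod_fun => l x; exact: cvg_id.
have := measurable_cube_comp mG m1; congr measurable_fun; apply/funext => x.
by apply: eq_bigr => l _; rewrite rV_mapE.
Qed.

Lemma measurable_sqrt_factor l : measurable_fun [set` @Ihalf R] (sqrt_factor (psi l) (omega l)).
Proof.
have mI : measurable ([set` @Ihalf R] : set (measurableTypeR R)) by exact: measurable_itv.
apply: (measurableT_comp (f := @Num.sqrt R)).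
  by apply: continuous_measurable_fun; exact: sqrt_continuous.
apply: measurable_funM.
  by apply: (measurableT_comp (f := omega l)); [case: (Hw l)|exact: measurable_psi].
apply: open_continuous_measurable_fun; first exact: interval_open.
by move=> x; rewrite inE => xI; have [[_ h] _] := Ht l; exact: h.
Qed.

(** The derivative of [psi] at the preimage of [y] is 1/rho, which the density cancels. Hence the
    substitution turns the L_2 norm over the cube into the weighted norm of h. *)
Lemma sqr_sqrt_factor_inv l y :
  sqrt_factor (psi l) (omega l) (inv_transf (psi l) y) ^+ 2 * rho l y = omega l y.
Proof.
have yI := inv_transf_in (Ht l) y.
have r0 := rho_gt0 (Ht l) (Hd l) y.
rewrite /sqrt_factor (derive1_psiE (Ht l) (Hd l) yI) (transfK (Ht l)) sqr_sqrtr.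
  by rewrite -mulrA mulVf ?mulr1// gt_eqF.
by apply: mulr_ge0; [case: (Hw l)|rewrite invr_ge0 ltW].
Qed.

Lemma cmeasurable_transformed h : cmeasurable setT h ->
  cmeasurable (@cube R d) (transformed psi omega h).
Proof.
move=> [mr mi]; have mF := measurable_cube_prod measurable_sqrt_factor.
have mpsi l := measurable_psi (Ht l).
split.
- rewrite (_ : _ \o _ = fun x => complex.Re (h (P x)) * FF x).
    by apply: measurable_funM => //; exact: (measurable_cube_comp mpsi mr).
  by apply/funext => x; rewrite /= /transformed ReMr.
- rewrite (_ : _ \o _ = fun x => complex.Im (h (P x)) * FF x).
    by apply: measurable_funM => //; exact: (measurable_cube_comp mpsi mi).
  by apply/funext => x; rewrite /= /transformed ImMr.
Qed.

Lemma L2_transformed h : weighted_L2 (product_weight omega) h ->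
  L2 (@cube R d) (transformed psi omega h).
Proof.
move=> [[mh _] wh]; have mf := cmeasurable_transformed mh.
split=> //; apply/L2norm_lty.
have mn := measurable_normc_sqr mf.
rewrite integral_cube//.
rewrite -(ge0_integral_transf Ht Hd crho) => [||x _]; last by rewrite lee_fin sqr_ge0.
  have := lty_poweR wh; rewrite (_ : integral _ _ _ =
      (\int[lam]_y ((normc (transformed psi omega h (X y)) ^+ 2)%:E * (J y)%:E))%E).
    apply; apply: integral_ge0 => y _; apply: mule_ge0; rewrite lee_fin ?sqr_ge0//.
    exact: (prod_rho_ge0 Ht Hd).
  apply: eq_integral => y _; rewrite -EFinM; congr EFin.
  rewrite !normc_sqr /transformed ReMr ImMr -/(rV_map psi (X y)) (map_inv_mapK Ht).
  rewrite !exprMn -mulrDl -mulrA; congr (_ * _).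
  rewrite /product_weight /prod_fun -prodrXl -big_split; apply: eq_bigr => l _ /=.
  by rewrite rV_mapE sqr_sqrt_factor_inv.
exact: measurable_funS measurable_cube (@open_box_cube R d) mn.
Qed.

End torus.

(** * Weak derivatives of h as families of real functions *)

Section derivative_family.
Context {R : realType} {d : nat}.
Variables (m : nat) (h : 'rV[R]_d -> R[i]) (Dh : {ffun 'I_d -> 'I_m.+1} -> 'rV[R]_d -> R[i]).
Local Notation test := [set phi : 'rV[R]_d -> R | smooth phi /\ compactly_supported phi].
Hypothesis hh : L2 setT h.
Hypothesis hD : forall alpha, cmeasurable setT (Dh alpha) /\
  weak_derivative setT test (fun i => nat_of_ord (alpha i)) h (Dh alpha).
Hypothesis hN : (mix_norm setT Dh < +oo)%E.

(* Junk values when [g l > m] for some [l]. *)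
Definition derivative_family (g : 'I_d -> nat) : 'rV[R]_d -> R[i] :=
  if [forall l, g l == 0%N] then h else Dh [ffun l => inord (g l)].

Lemma L2_derivative_family g : L2 setT (derivative_family g).
Proof.
rewrite /derivative_family; case: ifP => // _; split; first by case: (hD [ffun l => inord (g l)]).
exact: (mix_norm_lty _ _).1.
Qed.

Lemma weak_derivative_family g : (forall l, g l <= m)%N ->
  weak_derivative setT test g h (derivative_family g).
Proof.
move=> gm; rewrite /derivative_family; case: ifP => [/forallP g0|_].
  have E : (\sum_i g i)%N = 0%N by apply: big1 => i _; exact/eqP.
  move=> phi _; rewrite multi_partialE E expr0 mul1r.
  by rewrite (size0nil (etrans (size_multi_seq g) E)).
have [_ ] := hD [ffun l => inord (g l)].
by congr weak_derivative; apply/funext => l; rewrite ffunE inordK// ltnS.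
Qed.

Lemma multi_partial_upd i g (al : 'I_d -> R -> R) : (forall l, smooth1 (al l)) ->
  multi_partial g (prod_fun (upd i (derive1 (al i)) al)) =
  multi_partial (idx_succ i g) (prod_fun al).
Proof.
move=> sal; rewrite !multi_partialE !foldr_partial_prod_fun//; last first.
  by move=> l; rewrite /upd; case: eqP => // _; exact: smooth1_derive.
congr prod_fun; apply/funext => l; rewrite !count_multi_seq /idx_succ /upd [l == i]eq_sym.
by case: eqP => [<-|_]; rewrite ?add0n// add1n derive1Sn.
Qed.

(** Both integrals are pairings of h with the same mixed derivative of the product test function,
    taken in different orders; the orders differ by one, whence the sign. *)
Lemma Cintegral_derivative_family i g (al : 'I_d -> R -> R) (M : R) :
  (forall l, g l <= m)%N -> (g i < m)%N ->
  (forall l, smooth1 (al l)) -> (forall l t, M <= `|t| -> al l t = 0) ->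
  Cintegral setT (fun x => derivative_family g x *
    (prod_fun (upd i (derive1 (al i)) al) x)%:C%C) =
  - Cintegral setT (fun x => derivative_family (idx_succ i g) x * (prod_fun al x)%:C%C).
Proof.
move=> gm gi sal alM.
have gm' l : (idx_succ i g l <= m)%N.
  by rewrite /idx_succ; case: eqP => [<-|_]; [exact: gi|exact: gm].
have su l : smooth1 (upd i (derive1 (al i)) al l).
  by rewrite /upd; case: eqP => // _; exact: smooth1_derive.
have t1 : test (prod_fun (upd i (derive1 (al i)) al)).
  split; first exact: smooth_prod_fun.
  apply: (@compactly_supported_prod_fun _ _ _ (M + 1)) => l t Mt; rewrite /upd; case: eqP => _.
    by apply: is_derive1E; apply: (derive1_support (alM i)); rewrite (lt_le_trans _ Mt)// ltrDl.
  by apply: alM; rewrite (le_trans _ Mt)// lerDl.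
have t2 : test (prod_fun al).
  by split; [exact: smooth_prod_fun|exact: compactly_supported_prod_fun alM].
have := weak_derivative_family gm t1; rewrite (multi_partial_upd i g sal).
rewrite (weak_derivative_family gm' t2) => E.
have Es : (\sum_l idx_succ i g l)%N = (\sum_l g l)%N.+1.
  rewrite /idx_succ big_split/= (bigD1 i)//= eqxx big1 ?addn0// => l li.
  by rewrite eq_sym (negbTE li).
move: E; rewrite Es exprS mulN1r mulNr -mulrN => E.
have s0 : (-1) ^+ (\sum_l g l)%N != 0 :> R[i] by rewrite signr_eq0.
by apply: (mulfI s0); rewrite E.
Qed.

Lemma weak_family_Re_Im :
  weak_family m (fun g => @complex.Re R \o derivative_family g) /\
  weak_family m (fun g => @complex.Im R \o derivative_family g).
Proof.
have sq g : sq_integrable (@complex.Re R \o derivative_family g) /\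
    sq_integrable (@complex.Im R \o derivative_family g).
  by have [h1 h2] := L2_derivative_family g; exact: sq_integrable_Re_Im.
split; split=> [g _|i g gm gi al sal [M alM]]; try by case: (sq g).
- have := congr1 (@complex.Re R) (Cintegral_derivative_family gm gi sal alM).
  by rewrite /Cintegral /=; under eq_Rintegral do rewrite ReMr; under [in X in - X]eq_Rintegral do rewrite ReMr.
- have := congr1 (@complex.Im R) (Cintegral_derivative_family gm gi sal alM).
  by rewrite /Cintegral /=; under eq_Rintegral do rewrite ImMr; under [in X in - X]eq_Rintegral do rewrite ImMr.
Qed.

End derivative_family.

(** * Weak derivatives of the transformed function *)

Section transformed_derivatives.
Context {R : realType} {d : nat}.
Variables (m : nat) (psi rho omega : 'I_d -> R -> R).
Hypothesis m0 : (0 < m)%N.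
Hypothesis Ht : forall l, univariate_transformation (psi l).
Hypothesis Hd : forall l, density (psi l) (rho l).
Hypothesis Hw : forall l, weight_function (omega l).
Hypothesis rhoC : forall l, Cb m (rho l).
Hypothesis HF : forall l,
  differentiable_upto [set` Ihalf] m (sqrt_factor (psi l) (omega l)).
Hypothesis HL : forall l b, (b <= m)%N ->
  (\big[maxe/-oo]_(j < b.+1) Linfty_torus (fun x : R =>
     derive1n (b - j) (sqrt_factor (psi l) (omega l)) x *
     derive1 (psi l) x `^ Num.max (- (1 / 2)) (2 * j%:R - 3 / 2))%R < +oo)%E.
Local Notation lam := (@lebesgue_rV R d).
Local Notation ob := (open_box d (- 2^-1 : R) 2^-1).
Local Notation X := (rV_map (fun l => inv_transf (psi l))).
Local Notation P := (rV_map psi).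
Local Notation FF := (prod_fun (fun l => sqrt_factor (psi l) (omega l))).
Local Notation F := (fun l => pullback (psi l) (sqrt_factor (psi l) (omega l))).

Let crho l : continuous (rho l) := Cb_continuous (rhoC l).

Let dF l i (y : R) : (i < m)%N -> is_derive y 1 (F l i) (rho l y * F l i.+1 y).
Proof. exact: (is_derive_pullback (Ht l) (Hd l) (@HF l) y). Qed.

Let mF l i : (i <= m)%N -> measurable_fun setT (F l i).
Proof. exact: (measurable_pullback m0 (Ht l) (Hd l) (@HF l) (@crho l)). Qed.

Let F_bound0 l b : (b <= m)%N -> exists C : R, forall y, F l b y ^+ 2 * rho l y <= C.
Proof. exact: (pullback_bound0 m0 (Ht l) (Hd l) (@HF l) (HL l)). Qed.

Let F_bound l i j : (0 < j)%N -> (i + j <= m)%N ->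
  exists C : R, forall y, F l i y ^+ 2 <= C * rho l y ^+ (4 * j - 3).
Proof. exact: (pullback_bound (Ht l) (Hd l) (@HF l) (HL l)). Qed.

Definition initial_sum : seq (@summand R d) := [:: (fun=> 0%N, fun l => F l 0%N)].

Lemma admissible_initial_sum : all_admissible m rho F (fun=> 0%N) initial_sum.
Proof.
split=> // l; split => //=.
rewrite (_ : F l 0%N = term (rho l) (F l) 0 0 (fun=> 1)).
  by apply: lincomb_term => //; exact: Cb_cst.
by apply/funext => y; rewrite /term /= expr0 invr1 !mulr1.
Qed.

Lemma initial_sum_value U y : sum_value U initial_sum y = U (fun=> 0%N) y * FF (X y).
Proof.
rewrite /sum_value big_cons big_nil addr0; congr (_ * _).
by apply: eq_bigr => l _; rewrite rV_mapE.
Qed.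

Lemma pairingE U L phi : measurable_fun setT (sum_value U L) -> continuous phi ->
  \int[lam]_(x in ob) (sum_value U L (P x) * phi x) = pairing psi rho U L phi.
Proof.
move=> mL cphi; rewrite (integral_transf Ht Hd crho).
  apply: eq_Rintegral => y _; rewrite (map_inv_mapK Ht); ring.
apply: measurable_funM; first exact: measurable_comp_map.
exact: measurable_funTS (continuous_measurable_rV cphi).
Qed.

(** A candidate weak derivative on the torus, set to 0 off the open cube, where [psi] is not
    controlled. *)
Definition pushed_sum (U : ('I_d -> nat) -> 'rV[R]_d -> R) L : 'rV[R]_d -> R :=
  (fun x => sum_value U L (P x)) \_ ob.

Lemma measurable_pushed_sum U L : measurable_fun setT (sum_value U L) ->
  measurable_fun setT (pushed_sum U L).
Proof.
move=> mL; have mob := @measurable_open_box R d (- 2^-1) 2^-1.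
by apply/(measurable_restrictT _ mob); exact: measurable_comp_map.
Qed.

Lemma Rintegral_cube (G : 'rV[R]_d -> R) : measurable_fun (@cube R d) G ->
  \int[lam]_(x in @cube R d) G x = \int[lam]_(x in ob) G x.
Proof. by move=> mG; rewrite /Rintegral integral_cube//; exact/measurable_EFinP. Qed.

Lemma integral_pushed_sum U L phi : measurable_fun setT (sum_value U L) -> continuous phi ->
  \int[lam]_(x in @cube R d) (pushed_sum U L x * phi x) = pairing psi rho U L phi.
Proof.
move=> mL cphi; have mphi := continuous_measurable_rV cphi.
rewrite Rintegral_cube; last first.
  by apply: measurable_funTS; apply: measurable_funM => //; exact: measurable_pushed_sum.
rewrite -pairingE//; apply: eq_Rintegral => x xob.
by rewrite /pushed_sum patchE xob.
Qed.

Lemma pushed_sum_sqr_lty U beta L : (forall l, beta l <= m)%N ->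
  all_admissible m rho F beta L -> weak_family m U ->
  (\int[lam]_(x in @cube R d) (pushed_sum U L x ^+ 2)%:E < +oo)%E.
Proof.
move=> bm hL hU.
have mL := measurable_sum_value Ht Hd rhoC mF F_bound0 F_bound bm hL hU.
have mG : measurable_fun setT (fun x => (pushed_sum U L x ^+ 2)%:E).
  by apply/measurable_EFinP; apply: (measurable_funX 2); exact: measurable_pushed_sum.
rewrite integral_cube; last exact: measurable_funTS.
rewrite -(ge0_integral_transf Ht Hd crho) => [||x _]; last by rewrite lee_fin sqr_ge0.
  have [_ /integrableP[_]] := sq_integrable_sum_value Ht Hd rhoC mF F_bound0 F_bound bm hL hU.
  apply: le_lt_trans; rewrite le_eqVlt; apply/orP; left; apply/eqP.
  apply: eq_integral => y _; rewrite gee0_abs ?lee_fin ?sqr_ge0// -EFinM; congr EFin.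
  rewrite exprMn (sqr_prod_sqrt Ht Hd) /pushed_sum patchE mem_set; last exact: inv_map_in.
  by rewrite (map_inv_mapK Ht).
exact: measurable_funTS.
Qed.

Lemma integral_transformed_partial U phi (D : 'rV[R]_d -> R) : weak_family m U -> continuous phi ->
  (forall x, D x = U (fun=> 0%N) (P x) * FF x) ->
  \int[lam]_(x in @cube R d) (D x * phi x) = pairing psi rho U initial_sum phi.
Proof.
move=> hU cphi DE.
have mU : measurable_fun setT (U (fun=> 0%N)) by have [+ _] := hU; case/(_ (fun=> 0%N) (fun=> isT)).
have -> : D = fun x => U (fun=> 0%N) (P x) * FF x by exact/funext.
have mD : measurable_fun (@cube R d) (fun x => U (fun=> 0%N) (P x) * FF x).
  apply: measurable_funM.
    exact: measurable_cube_comp (fun l => measurable_psi (Ht l)) mU.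
  exact: measurable_cube_prod (measurable_sqrt_factor Ht Hw).
have mphi := continuous_measurable_rV cphi.
rewrite Rintegral_cube; last by apply: measurable_funM => //; exact: measurable_funTS.
rewrite (integral_transf Ht Hd crho).
  apply: eq_Rintegral => y _; rewrite initial_sum_value (map_inv_mapK Ht); ring.
apply: measurable_funM; last exact: measurable_funTS.
exact: measurable_funS measurable_cube (@open_box_cube R d) mD.
Qed.

Lemma Hmix_transformed h : weighted_L2 (product_weight omega) h -> Hmix_Rd m h ->
  Hmix_torus m (transformed psi omega h).
Proof.
move=> hw [hh [Dh [hD hN]]].
have [hRe hIm] := weak_family_Re_Im hh hD hN.
set UR := (fun g => @complex.Re R \o _) in hRe.
set UI := (fun g => @complex.Im R \o _) in hIm.
(* At order zero the family is h itself, not the given derivative of order zero, which is determined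
   only up to null sets; the transformed function is thus matched pointwise. *)
have U0 : derivative_family h Dh (fun=> 0%N) = h.
  by rewrite /derivative_family; case: ifPn => // /forallP[].
(* The list depends on [alpha] alone, so [UR] and [UI] are expanded with the same coefficients. *)
have /choice[L HL'] (alpha : {ffun 'I_d -> 'I_m.+1}) : exists L, exists beta,
    [/\ (forall l, beta l <= m)%N, all_admissible m rho F beta L &
      forall U phi, weak_family m U -> smooth phi ->
        pairing psi rho U initial_sum (multi_partial (fun l => nat_of_ord (alpha l)) phi) =
        (-1) ^+ (\sum_l alpha l)%N * pairing psi rho U L phi].
  have cm l : (count_mem l (multi_seq (fun l => nat_of_ord (alpha l))) + 0 <= m)%N.
    by rewrite count_multi_seq addn0 -ltnS.
  have [beta [L [h1 h2 h3]]] := pairing_foldr_partial Ht Hd rhoC dF mF F_bound0 F_bound cm admissible_initial_sum.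
  exists L, beta; split=> // U phi hU sphi.
  by rewrite multi_partialE h3// size_multi_seq.
have mL alpha U : weak_family m U -> measurable_fun setT (sum_value U (L alpha)).
  have [beta [h1 h2 _]] := HL' alpha.
  exact: (measurable_sum_value Ht Hd rhoC mF F_bound0 F_bound h1 h2).
split; first exact: (L2_transformed Ht Hd crho Hw hw).
exists (fun alpha x => Complex (pushed_sum UR (L alpha) x) (pushed_sum UI (L alpha) x)); split.
- move=> alpha; split.
    by split; apply: measurable_funTS; apply: measurable_pushed_sum; exact: mL.
  move=> phi [sphi _]; have [beta [_ _ hp]] := HL' alpha.
  have [cphi _] := sphi [::].
  have cDphi : continuous (multi_partial (fun l => nat_of_ord (alpha l)) phi).
    by rewrite multi_partialE; have [] := sphi (multi_seq (fun l => nat_of_ord (alpha l))).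
  rewrite /Cintegral complex_signM; congr Complex.
  + under eq_Rintegral do rewrite ReMr; under [in RHS]eq_Rintegral do rewrite ReMr.
    rewrite (integral_pushed_sum (mL alpha _ hRe) cphi) -hp//.
    apply: integral_transformed_partial => // x.
    by rewrite /UR U0 /transformed ReMr.
  + under eq_Rintegral do rewrite ImMr; under [in RHS]eq_Rintegral do rewrite ImMr.
    rewrite (integral_pushed_sum (mL alpha _ hIm) cphi) -hp//.
    apply: integral_transformed_partial => // x.
    by rewrite /UI U0 /transformed ImMr.
- apply/mix_norm_lty => alpha; apply/L2norm_lty; have [beta [h1 h2 _]] := HL' alpha.
  under eq_integral do rewrite normc_sqr EFinD.
  have ms U : weak_family m U ->
      measurable_fun (@cube R d) (fun x => (pushed_sum U (L alpha) x ^+ 2)%:E).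
    move=> hU; apply/measurable_EFinP; apply: measurable_funTS; apply: (measurable_funX 2).
    exact: measurable_pushed_sum (mL alpha _ hU).
  rewrite ge0_integralD//=; last 5 first.
  + exact: measurable_cube.
  + by move=> x _; rewrite lee_fin sqr_ge0.
  + exact: ms.
  + by move=> x _; rewrite lee_fin sqr_ge0.
  + exact: ms.
  by apply: lte_add_pinfty; exact: pushed_sum_sqr_lty h1 h2 _.
Qed.

End transformed_derivatives.

(** The only multi-index with entries in ['I_1] is zero, and the function is its own derivative of
    that order. *)
Lemma Hmix_torus0 (R : realType) (d : nat) (f : 'rV[R]_d -> R[i]) :
  L2 (@cube R d) f -> Hmix_torus 0 f.
Proof.
move=> [mf fN]; split=> //; exists (fun=> f); split; last exact/mix_norm_lty.
move=> alpha; split=> // phi _.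
have E : (\sum_i alpha i)%N = 0%N by apply: big1 => i _; rewrite ord1.
rewrite E expr0 mul1r multi_partialE.
by rewrite (size0nil (etrans (size_multi_seq (fun l => nat_of_ord (alpha l))) E)).
Qed.

Theorem theorem3p5 (R : realType) (d m : nat) (psi rho omega : 'I_d -> R -> R)
    (h : 'rV[R]_d -> R[i]) :
  (0 < d)%N ->
  (forall l, univariate_transformation (psi l)) ->
  (forall l, density (psi l) (rho l)) ->
  (forall l, weight_function (omega l)) ->
  weighted_L2 (product_weight omega) h ->
  Hmix_Rd m h ->
  (forall a : 'I_d -> nat, (\max_(i < d) a i <= m)%N -> forall l : 'I_d,
    (forall j, (j <= m)%N ->
      (differentiable_upto setT j (rho l) /\ C0_line (derive1n j (rho l))) /\
      (differentiable_upto [set` Ihalf] j (psi l) /\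
       {in Ihalf, continuous (derive1n j (psi l))})) /\
    differentiable_upto [set` Ihalf] (a l) (sqrt_factor (psi l) (omega l)) /\
    (\big[maxe/-oo]_(j < (a l).+1) Linfty_torus (fun x : R =>
        derive1n (a l - j) (sqrt_factor (psi l) (omega l)) x *
        derive1 (psi l) x `^ Num.max (- (1 / 2)) (2 * j%:R - 3 / 2))%R < +oo)%E) ->
  Hmix_torus m (transformed psi omega h).
Proof.
move=> _ Ht Hd Hw hw hm Ha.
(* The constant multi-index [b] gives access to the bound of order [b] in every coordinate. *)
have Hb b : (b <= m)%N -> (\max_(i < d) (fun=> b) i <= m)%N.
  by move=> bm; apply/bigmax_leqP.
have rhoC l : Cb m (rho l).
  by apply: C0_Cb => j jm; have [/(_ j jm)[]] := Ha _ (Hb _ (leqnn m)) l.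
(* The everywhere bounds start from a differentiable factor and so require m > 0; for m = 0
   membership in L_2 is all there is to prove. *)
case: (posnP m) => [m0|m0]; last first.
  apply: (Hmix_transformed m0 Ht Hd Hw rhoC) => //.
    by move=> l; have [_ []] := Ha _ (Hb _ (leqnn m)) l.
  by move=> l b bm; have [_ []] := Ha _ (Hb _ bm) l.
have crho l : continuous (rho l) := Cb_continuous (rhoC l).
rewrite m0; apply: Hmix_torus0; exact: (L2_transformed Ht Hd crho Hw hw).
Qed.
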